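(* Let $\alpha,\beta\in\mathbb{R}$ with $\beta\neq0$. Let $-1/4<s\le 0$ and $7/12<b<11/12$. Then there is a constant $C$ such that for all $u,v,w\in X^{s,b}$, $$\|uv\overline{w}\|_{X^{s,b-1}}\le C\,\|u\|_{X^{s,b}}\|v\|_{X^{s,b}}\|w\|_{X^{s,b}}.$$
   Context: Notation: $\langle\xi\rangle=1+|\xi|$, $\phi(\xi)=\alpha\xi^2+\beta\xi^3$, and for $s,b\in\mathbb{R}$ $$\|u\|_{X^{s,b}}=\|\langle\xi\rangle^s\langle\tau-\phi(\xi)\rangle^b\hat u(\xi,\tau)\|_{L^2_\xi L^2_\tau},$$ where $\hat u$ is the Fourier transform of $u=u(x,t)$ in both variables; $X^{s,b}$ is the space of complex-valued tempered distributions on $\mathbb{R}^2$ whose Fourier transform is a measurable function with finite norm. The product $uv\overline{w}$ is understood through its Fourier transform, namely (up to a normalizing constant) the convolution $\hat u*\hat v*\widehat{\overline{w}}$. *)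

(* Defs.v *)
From HB Require Import structures.
From mathcomp Require Import all_boot all_order all_algebra.
From mathcomp Require Import complex.
From mathcomp Require Import all_classical all_reals all_analysis.

Set Implicit Arguments.
Unset Strict Implicit.
Unset Printing Implicit Defensive.

Import Order.TTheory GRing.Theory Num.Theory.
Import numFieldNormedType.Exports.

Local Open Scope classical_set_scope.
Local Open Scope ring_scope.
Local Open Scope complex_scope.

(* [measurableTypeR R] is convertible to [R]; the ascription selects the Borel
   sigma-algebra on each factor. *)
Notation plane R := (measurableTypeR R * measurableTypeR R)%type.

(* Lebesgue measure on the plane. It gets a name and its own instances because
   the sigma-finiteness of a bare product of two infinite measures is not
   inferred (the instance for products of probabilities takes precedence). *)
Section LebesguePlane.
Context {R : realType}.

Definition lebesgue2 : set (plane R) -> \bar R :=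
  (@lebesgue_measure R \x @lebesgue_measure R)%E.

HB.instance Definition _ := Measure.on lebesgue2.

Let lebesgue2_sigma_finite : sigma_finite [set: plane R] lebesgue2.
Proof.
have /sigma_finiteP[F [TF ndF Foo]] := sigma_finiteT (@lebesgue_measure R).
exists (fun n => F n `*` F n).
  rewrite -setXTT TF predeqE => -[x y]; split.
    move=> [/= [n _ Fnx] [k _ Fky]]; exists (maxn n k) => //; split.
    - by move: x Fnx; exact/subsetPset/ndF/leq_maxl.
    - by move: y Fky; exact/subsetPset/ndF/leq_maxr.
  by move=> [n _ []/= ? ?]; split; exists n.
move=> k; have [mF Fk] := Foo k; split; first exact: measurableX.
by rewrite /lebesgue2 product_measure1E// lte_mul_pinfty// ge0_fin_numE.
Qed.

HB.instance Definition _ :=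
  Measure_isSigmaFinite.Build _ _ _ lebesgue2 lebesgue2_sigma_finite.

End LebesguePlane.

Section ComplexIntegral.
Context {d : measure_display} {T : measurableType d} {R : realType}.
Implicit Types (mu : {measure set T -> \bar R}) (f : T -> R[i]).

Definition cmeasurable f : Prop :=
  measurable_fun [set: T] (fun x => complex.Re (f x)) /\
  measurable_fun [set: T] (fun x => complex.Im (f x)).

Definition cintegrable mu f : Prop :=
  mu.-integrable [set: T] (fun x => (complex.Re (f x))%:E) /\
  mu.-integrable [set: T] (fun x => (complex.Im (f x))%:E).

Definition cintegral mu f : R[i] :=
  (\int[mu]_x complex.Re (f x)) +i* (\int[mu]_x complex.Im (f x)).

End ComplexIntegral.

Section Schwartz.
Context {R : realType}.
Implicit Types (g : R * R -> R) (f : R * R -> R[i]).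

Definition axis (k : bool) : R * R := if k then (0, 1) else (1, 0).

(* Iterated partial derivative along a word of axes; words (rather than
   multi-indices) avoid presupposing that partial derivatives commute. *)
Definition partials (w : seq bool) g : R * R -> R :=
  foldr (fun k h z => 'D_(axis k) h z) g w.

Definition cpartials (w : seq bool) f : R * R -> R[i] := fun z =>
  partials w (fun y => complex.Re (f y)) z
    +i* partials w (fun y => complex.Im (f y)) z.

Definition smooth g : Prop :=
  forall w k z, derivable (partials w g) z (axis k).

Definition schwartz f : Prop :=
  [/\ smooth (fun y => complex.Re (f y)),
      smooth (fun y => complex.Im (f y)) &
      forall n w, exists M : R,
        forall z, (1 + `|z|) ^+ n * Normc.normc (cpartials w f z) <= M].

End Schwartz.

Section TemperedDistribution.
Context {R : realType}.
Implicit Types (T : (R * R -> R[i]) -> R[i]).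

(* A tempered distribution is represented by a functional on all functions,
   of which only the values on Schwartz functions are relevant. *)
Definition tempered T : Prop :=
  (forall (a : R[i]) f g, schwartz f -> schwartz g ->
     T (fun z => a * f z + g z) = a * T f + T g) /\
  (exists (n m : nat) (K : R), forall f (A : R), schwartz f ->
     (forall w z, (size w <= m)%N ->
        (1 + `|z|) ^+ n * Normc.normc (cpartials w f z) <= A) ->
     Normc.normc (T f) <= K * A).

Definition conj_distr T : (R * R -> R[i]) -> R[i] :=
  fun f => (T (fun z => (f z)^*))^*.

(* The kernel is e^{-i(x xi + t tau)}, without normalizing factor. *)
Definition fourier (f : R * R -> R[i]) : R * R -> R[i] := fun zeta =>
  cintegral lebesgue2 (fun z : plane R =>
    let theta := z.1 * zeta.1 + z.2 * zeta.2 in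
    f z * (cos theta -i* sin theta)).

(* The Fourier transform of [T], i.e. the distribution [T \o fourier], is the
   measurable function [h]. *)
Definition is_fourier T (h : plane R -> R[i]) : Prop :=
  cmeasurable h /\
  forall f : R * R -> R[i], schwartz f ->
    cintegrable lebesgue2 (fun z => h z * f z) /\
    T (fourier f) = cintegral lebesgue2 (fun z => h z * f z).

(* The Fourier transform of [T] when it is a function (unique up to a null
   set), and an irrelevant value otherwise. *)
Definition hat T : plane R -> R[i] := xget (fun=> 0) [set h | is_fourier T h].

End TemperedDistribution.

Section BourgainSpace.
Context {R : realType}.
Variables (alpha beta : R).

Definition bracket (xi : R) : R := 1 + `|xi|.

Definition phase (xi : R) : R := alpha * xi ^+ 2 + beta * xi ^+ 3.

(* The X^{s,b} norm as a function of the Fourier transform. *)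
Definition Xnorm_hat (s b : R) (h : plane R -> R[i]) : \bar R :=
  Lnorm (@lebesgue_measure R) 2%:E (fun xi =>
    Lnorm (@lebesgue_measure R) 2%:E (fun tau =>
      (bracket xi `^ s * bracket (tau - phase xi) `^ b
         * Normc.normc (h (xi, tau)))%:E)).

Definition Xnorm (s b : R) (u : (R * R -> R[i]) -> R[i]) : \bar R :=
  Xnorm_hat s b (hat u).

Definition Xspace (s b : R) : set ((R * R -> R[i]) -> R[i]) :=
  [set u | [/\ tempered u, (exists h, is_fourier u h)
             & (Xnorm s b u < +oo)%E]].

End BourgainSpace.

Section TripleConvolution.
Context {R : realType}.
Implicit Types (f g h : plane R -> R[i]).

(* (f * g * h)(z) written as one integral of f(y1) g(y2) h(z - y1 - y2) over
   (y1, y2); where it does not converge absolutely [conv3] is junk, hence the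
   separate predicate [conv3_converges]. *)
Definition conv3_integrand f g h (z : plane R) :
    plane R * plane R -> R[i] :=
  fun y => f y.1 * g y.2 * h (z - y.1 - y.2).

Definition conv3_converges f g h (z : plane R) : Prop :=
  cintegrable (lebesgue2 \x lebesgue2)%E (conv3_integrand f g h z).

Definition conv3 f g h : plane R -> R[i] := fun z =>
  cintegral (lebesgue2 \x lebesgue2)%E (conv3_integrand f g h z).

End TripleConvolution.

(* Main.v *)
Require Import Defs.
From HB Require Import structures.
From mathcomp Require Import all_boot all_order all_algebra.
From mathcomp Require Import complex.
From mathcomp Require Import all_classical all_reals all_analysis.
From mathcomp Require Import measurable_realfun ring lra.
Import Order.TTheory GRing.Theory Num.Theory.
Import numFieldNormedType.Exports.
Set Implicit Arguments.
Unset Strict Implicit.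
Unset Printing Implicit Defensive.
Local Open Scope classical_set_scope.
Local Open Scope ring_scope.

(** The estimate lives entirely on the Fourier side, where it is a weighted
    bound for a triple convolution. Write sigma = - s, p = 2 b and
    gamma = 2 - 2 b. Dividing and multiplying each factor by its weight and
    applying Cauchy-Schwarz to the convolution integral at a fixed point
    (xi, tau) bounds the square of the weighted convolution by

      K(xi, tau) * (U * V * W)(xi, tau),

    where U, V, W are the squared weighted moduli of the three factors and K
    is the squared output weight times the integral of the inverse squared
    input weights ([trilinear_pointwise]). By Tonelli the integral of U * V * W
    is the product of the three squared norms, so everything follows once K
    is bounded uniformly in (xi, tau) ([integral_spacetime_kernel]).

    The third factor carries a conjugate, so its frequency and its modulation
    enter with the opposite sign. The integrals of K in the two time
    frequencies are convolutions of inverse powers of brackets, which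
    reproduce themselves ([bracket_convolution]). What remains is a planar
    integral over the frequencies of < c + H > ^ (- p) times frequency weights,
    with c = tau - phi(xi) and H the resonance function. Shifting every
    frequency by alpha / (3 beta), the conjugated one in the opposite direction,
    removes the quadratic part of the cubic phase and gives, with m = a + b + d
    the shifted frequencies,

      H = 3 beta (a + b) (b + d) (a + d)        ([resonance_identity]).

    - Resonance absorbs derivatives: up to constants,
      < a > < b > < d > is at most < m > < M > ^ 2 < H > ^ (1/3), where M is the
      largest of |a|, |b|, |d| ([resonance_gain]). Raised to the power 2 sigma
      this costs at most < H > ^ (1/6), which is paid by
      < c > ^ (1/6) < c + H > ^ (1/6). The output weight has gamma >= 1/6 to
      spare since b < 11/12, and p - 1/6 stays above 1 since b > 7/12. The only
      weight left is < M > ^ (4 sigma) ([weighted_kernel_le]).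
    - The remaining integral of < M > ^ nu < c + H > ^ (- q), nu = 4 sigma < 1 < q,
      is split according to which of a, b, d has the middle modulus. In the
      sum Y and half-difference t of the two other frequencies, H is affine in
      t ^ 2 with slope proportional to Y, so the t-integral costs a power of
      |Y| ([integral_quadratic]), and the condition that the third frequency is
      in the middle bounds |t| below by the distance of Y to 2 m or to 2 m / 3.
      Some of the weight may thus be traded for integrable singularities in Y
      at 0, 2 m and 2 m / 3 ([middle_weight_bound]).

    The transform of the distribution conj w is only characterized by its
    pairings with Schwartz functions. Pairing shows that
    z |-> conj (hat w (- z)) is one transform of conj w, and two locally
    integrable functions with the same pairings agree almost everywhere
    ([is_fourier_unique]); this is tested against products of a Gaussian with
    steep logistic functions, which converge to Gaussians cut off to
    quadrants. *)

(** * Affine changes of variable on the line *)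

Section AffineChange.
Context {R : realType}.
Notation mu := (@lebesgue_measure R).
Implicit Types (f : R -> \bar R) (a l : R).
Local Open Scope ereal_scope.

Lemma ge0_integral_opp f : measurable_fun [set: R] f ->
  (forall x, 0 <= f x) -> \int[mu]_x f (- x)%R = \int[mu]_x f x.
Proof.
move=> mf f0.
have mN : measurable_fun setT (-%R : measurableTypeR R -> measurableTypeR R).
  exact: oppr_measurable.
transitivity (\int[pushforward mu (-%R : _ -> measurableTypeR R)]_y f y).
  by rewrite ge0_integral_pushforward// preimage_setT.
by apply: eq_measure_integral => //= A mA _; exact: lebesgue_measureN.
Qed.

(** The image of Lebesgue measure under x |-> l x + a, multiplied by l, has the
    right value on intervals, hence is Lebesgue measure. *)
Lemma ge0_integral_affine f l a : (0 < l)%R ->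
  measurable_fun [set: R] f -> (forall x, 0 <= f x) ->
  \int[mu]_x f (l * x + a)%R = (l^-1)%:E * \int[mu]_x f x.
Proof.
move=> l0 mf f0.
pose phi (x : measurableTypeR R) : measurableTypeR R := (l * x + a)%R.
have mphi : measurable_fun setT phi.
  by apply: measurable_funD => //; exact: mulrl_measurable.
have li : (0 <= l)%R by exact: ltW.
transitivity (\int[pushforward mu phi]_y f y).
  by rewrite ge0_integral_pushforward// preimage_setT.
have linv : (l^-1 * l = 1)%R by rewrite mulVf// gt_eqF.
rewrite -[LHS]mul1e -linv EFinM -muleA; congr (_ * _).
rewrite -(ge0_integral_mscale _ _ (NngNum li))//=.
apply: eq_measure_integral => /= A mA _.
apply/esym.
apply: (@lebesgue_measure_unique _ (mscale (NngNum li) (pushforward mu phi))) => //= _ [[u v]] _ <-.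
rewrite /mscale /= /pushforward.
have -> : phi @^-1` [set` `]u, v]] = [set` `]((u - a) / l), ((v - a) / l)]]%R.
  apply/seteqP; split => x /=; rewrite !in_itv /= /phi ltr_pdivrMr// ler_pdivlMr//;
   by rewrite ltrBlDr lerBrDr (mulrC x).
rewrite !lebesgue_measure_itv/= !lte_fin ltr_pM2r ?invr_gt0// ltrD2r.
case: ifPn => uv; last by rewrite mule0.
rewrite -!EFinB -EFinM; congr EFin.
by field; rewrite gt_eqF.
Qed.

Lemma ge0_integral_shift f a : measurable_fun [set: R] f ->
  (forall x, 0 <= f x) -> \int[mu]_x f (x + a)%R = \int[mu]_x f x.
Proof.
move=> mf f0; rewrite -[RHS]mul1e -[1%E]/((1 : R)%:E) -[X in X%:E]invr1.
rewrite -(@ge0_integral_affine f 1%R a)//.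
by under [in RHS]eq_integral do rewrite mul1r.
Qed.

Lemma ge0_integral_reflect f a : measurable_fun [set: R] f ->
  (forall x, 0 <= f x) -> \int[mu]_x f (a - x)%R = \int[mu]_x f x.
Proof.
move=> mf f0; rewrite -[RHS](ge0_integral_shift a)//.
rewrite -(@ge0_integral_opp (fun x => f (x + a)%R))//.
  by under [in RHS]eq_integral do rewrite addrC.
apply: (measurableT_comp mf).
exact: measurable_funD.
Qed.
End AffineChange.

(** * The bracket and its integrable powers *)

Section Bracket.
Context {R : realType}.
Notation mu := (@lebesgue_measure R).
Implicit Types x y p a b : R.

Lemma bracket_ge1 x : 1 <= bracket x.
Proof. by rewrite /bracket lerDl. Qed.

Lemma bracket_gt0 x : 0 < bracket x.
Proof. exact: lt_le_trans (bracket_ge1 x). Qed.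

Lemma bracketN x : bracket (- x) = bracket x.
Proof. by rewrite /bracket normrN. Qed.

(** Submultiplicativity is what lets a weight at a sum be distributed over the
    summands, in place of the triangle inequality. *)
Lemma bracketD x y : bracket (x + y) <= bracket x * bracket y.
Proof.
rewrite /bracket; have := ler_normD x y; have := normr_ge0 x; have := normr_ge0 y.
nra.
Qed.

Lemma bracket_powRN_le1 x p : 0 <= p -> bracket x `^ (- p) <= 1.
Proof.
move=> p0; rewrite powRN invf_le1 ?powR_gt0 ?bracket_gt0//.
by rewrite -[leLHS](powRr0 (bracket x)); apply: ler_powR => //; exact: bracket_ge1.
Qed.

Lemma measurable_bracket_powR d (T : measurableType d) (D : set T) (f : T -> R) p :
  measurable_fun D f -> measurable_fun D (fun u => bracket (f u) `^ p).
Proof.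
move=> mf.
apply: (measurableT_comp (f := fun u : R => u `^ p)); first exact: measurable_powR.
apply: measurable_funD => //.
exact: measurableT_comp.
Qed.

Lemma continuous_bracket_powR p : continuous (fun x : R => bracket x `^ p).
Proof.
move=> x.
apply: (continuous_comp (f := @bracket R) (g := fun u : R => u `^ p)).
  apply: cvgD; first exact: cvg_cst.
  exact: norm_continuous.
apply: differentiable_continuous; apply/derivable1_diffP.
by apply: derivable_powR; rewrite in_itv /= bracket_gt0.
Qed.

Local Open Scope ereal_scope.

Lemma integral_bracket_powR p : (1 < p)%R ->
  exists2 C : R, (0 <= C)%R & \int[mu]_x (bracket x `^ (- p))%:E = C%:E.
Proof.
move=> p1.
exists (2 * (p - 1)^-1)%R; first by rewrite mulr_ge0 ?invr_ge0 ?subr_ge0// ltW.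
rewrite ge0_symfun_integralT; last 3 first.
- by move=> x; exact: powR_ge0.
- exact: continuous_bracket_powR.
- by move=> x /=; rewrite bracketN.
rewrite EFinM; congr (_ * _).
pose F (x : R) : R := (- (p - 1)^-1 * (1 + x) `^ (1 - p))%R.
have isd (x : R) : (0 <= x)%R -> is_derive x 1%R F ((1 + x) `^ (- p))%R.
  move=> x0; have x1 : (0 < 1 + x)%R by lra.
  have := is_derive1_powR (1 - p) x1.
  move=> H.
  have H1 : is_derive x 1%R (fun y : R => 1 + y)%R 1%R.
    rewrite -[X in is_derive _ _ _ X]add0r; exact: is_deriveD.
  have H2 := is_derive1_comp (f := fun u : R => (u `^ (1 - p))%R) (g := fun y : R => (1 + y)%R) (x := x).
  have -> : ((1 + x) `^ (- p) = - (p - 1)^-1 *: (1 * ((1 - p) * (1 + x) `^ (1 - p - 1))))%R.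
    rewrite (_ : (1 - p - 1 = - p)%R); last by ring.
    rewrite /GRing.scale/= mul1r mulrA (_ : (- (p - 1)^-1 * (1 - p) = 1)%R) ?mul1r//.
    by field; apply/eqP; lra.
  apply: is_deriveZ.
  rewrite mulrC.
  exact: H2.
rewrite [X in \int[mu]_(x in X) _ = _](_ : _ = [set` `[0%R, +oo[]); last first.
  by rewrite set_itvcy.
rewrite (@ge0_continuous_FTC2y _ _ F _ 0%R).
- rewrite /F addr0 powR1 mulr1 -EFinB; congr EFin; ring.
- by move=> x _; exact: powR_ge0.
- apply: continuous_subspaceT; exact: continuous_bracket_powR.
- rewrite -[X in _ --> X](mulr0 (- (p - 1)^-1)%R).
  apply: cvgM; first exact: cvg_cst.
  apply/cvgrPdist_le => /= e e0; near=> x.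
  have p0 : (0 < p - 1)%R by lra.
  have x0 : (0 <= x)%R by near: x; exact: nbhs_pinfty_ge.
  have xe : ((e^-1) `^ (p - 1)^-1 <= x)%R by near: x; exact: nbhs_pinfty_ge.
  rewrite sub0r normrN ger0_norm ?powR_ge0// (_ : (1 - p = - (p - 1))%R); last by ring.
  rewrite powRN -[leRHS]invrK lef_pV2 ?posrE ?invr_gt0// ?powR_gt0//; last by lra.
  rewrite (_ : e^-1 = (e^-1 `^ (p - 1)^-1) `^ (p - 1))%R; last first.
    by rewrite -powRrM mulVf ?gt_eqF// powRr1// invr_ge0 ltW.
  apply: ge0_ler_powR; rewrite ?nnegrE ?powR_ge0// ?ltW//; lra.
- by move=> x x0; have [] := isd x (ltW x0).
- apply: cvg_at_right_filter.
  apply: differentiable_continuous; apply/derivable1_diffP.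
  by have [] := isd 0%R (lexx _).
- move=> x; rewrite in_itv/= andbT => x0.
  rewrite derive1E; have [_ ->] := isd x (ltW x0).
  by rewrite /bracket ger0_norm// ltW.
Unshelve. all: by end_near.
Qed.
End Bracket.

(** * Integrable singularities and convolutions of bracket powers *)

Section Peak.
Context {R : realType}.
Notation mu := (@lebesgue_measure R).
Implicit Types x y p q a b theta : R.

(** A singularity of order theta at the origin with a tail of order q; for
    theta < 1 < q it is integrable. *)
Definition rpeak (theta q x : R) : R :=
  if `|x| <= 1 then `|x| `^ (- theta) else `|x| `^ (- q).

Lemma rpeak_ge0 theta q x : 0 <= rpeak theta q x.
Proof. by rewrite /rpeak; case: ifP => _; exact: powR_ge0. Qed.

(** The value at the origin is infinite rather than the arbitrary value of a
    power of 0, so that a bound by a translated peak is trivial on the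
    exceptional lines where a change of variables degenerates. *)
Definition peak (theta q x : R) : \bar R :=
  if x == 0 then +oo%E else (rpeak theta q x)%:E.

Lemma peak_ge0 theta q x : (0 <= peak theta q x)%E.
Proof.
by rewrite /peak; case: eqP => // _; rewrite lee_fin rpeak_ge0.
Qed.

Lemma measurable_norm_powR d (T : measurableType d) (D : set T) (f : T -> R) p :
  measurable_fun D f -> measurable_fun D (fun u => `|f u| `^ p).
Proof.
move=> mf.
apply: (measurableT_comp (f := fun u : R => u `^ p)); first exact: measurable_powR.
exact: measurableT_comp.
Qed.

Lemma measurable_peak theta q : measurable_fun [set: R] (peak theta q).
Proof.
apply: measurable_fun_ifT => //.
  exact: measurable_fun_eqr.
apply/measurable_EFinP; apply: measurable_fun_ifT; try exact: measurable_norm_powR.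
by apply: measurable_fun_ler => //; exact: measurableT_comp.
Qed.

Local Open Scope ereal_scope.

(** Layer-cake: |x| ^ (- theta) is the length of the interval [0, |x| ^ (- theta)[,
    and after exchanging the integrals the slice at height s is contained in
    |x| <= (2 / < s >) ^ (1 / theta), which is integrable in s because
    1 / theta > 1. *)
Lemma integral_norm_powR_unit theta : (0 < theta < 1)%R ->
  exists2 C : R, (0 <= C)%R &
  \int[mu]_x (if (`|x| <= 1)%R then `|x| `^ (- theta) else 0)%R%:E <= C%:E.
Proof.
move=> /andP[t0 t1].
have ti1 : (1 < theta^-1)%R by rewrite invf_gt1.
have [C C0 hC] := integral_bracket_powR ti1.
exists (2 * 2 `^ theta^-1 * C)%R; first by rewrite !mulr_ge0// powR_ge0.
pose P (z : measurableTypeR R * measurableTypeR R) : bool :=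
  ((`|z.1| <= 1) && (0 <= z.2) && (z.2 < `|z.1| `^ (- theta)))%R.
pose f (z : measurableTypeR R * measurableTypeR R) : \bar R :=
  (if P z then 1 else 0)%R%:E.
have mf : measurable_fun setT f.
  apply/measurable_EFinP; apply: measurable_fun_ifT => //.
  apply: measurable_and; first apply: measurable_and.
  - by apply: measurable_fun_ler => //; exact: measurableT_comp.
  - exact: measurable_fun_ler.
  - by apply: measurable_fun_ltr => //; exact: measurable_norm_powR.
have f0 z : 0 <= f z by rewrite lee_fin; case: ifP.
have fE x : (if (`|x| <= 1)%R then `|x| `^ (- theta) else 0)%R%:E =
    \int[mu]_s f (x, s).
  rewrite [RHS](_ : _ = \int[mu]_(s in
    if (`|x| <= 1)%R then `[0%R, (`|x| `^ (- theta))%R[%classic else set0) 1%:E).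
    case: ifP => hx; last by rewrite integral_set0.
    rewrite integral_cst//= mul1e lebesgue_measure_itv /= lte_fin.
    case: (ltP 0%R (`|x| `^ (- theta))%R) => [_|h]; first by rewrite sube0.
    by congr EFin; apply/le_anti; rewrite h powR_ge0.
  rewrite [RHS]integral_mkcond; apply: eq_integral => s _.
  rewrite /f /P patchE/=; case: (`|x| <= 1)%R => /=; last by rewrite in_set0.
  case: ifPn => h; first by rewrite ifT// inE/= in_itv.
  by rewrite ifF//; apply/negbTE; rewrite notin_setE/= in_itv/=; exact/negP.
under eq_integral do rewrite fE.
rewrite fubini_tonelli//.
rewrite EFinM -hC -ge0_integralZl_EFin//; last 2 first.
- by move=> x _; rewrite lee_fin powR_ge0.
- by apply/measurable_EFinP; exact: measurable_bracket_powR.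
apply: ge0_le_integral => //.
- by move=> s _; exact: integral_ge0.
- exact: measurable_fun_fubini_tonelli_G.
- apply: measurable_funeM; apply/measurable_EFinP; exact: measurable_bracket_powR.
move=> s _.
have [s0|s0] := ltP s 0%R.
  rewrite [leLHS](_ : _ = 0); first by rewrite lee_fin !mulr_ge0// powR_ge0.
  by apply: integral0_eq => x _; rewrite /f /P/= (leNgt 0%R) s0 andbF.
set r := (2 `^ theta^-1 * bracket s `^ (- theta^-1))%R.
have r0 : (0 <= r)%R by rewrite mulr_ge0// powR_ge0.
apply: (@le_trans _ _ (\int[mu]_(x in `[(- r)%R, r]) 1%:E)).
  rewrite [leRHS]integral_mkcond; apply: ge0_le_integral => //.
  - exact: measurableT_comp.
  - by apply/(measurable_restrictT _ _).1.
  move=> x _; rewrite patchE /f; case: ifPn => /= hP; last by case: ifP.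
  rewrite ifT// inE/= in_itv/= -ler_norml.
  move: hP => /andP[/andP[/= x1 _]] sx.
  have [->|xn0] := eqVneq x 0%R; first by rewrite normr0.
  have x0 : (0 < `|x|)%R by rewrite normr_gt0.
  have h1 : (1 <= `|x| `^ (- theta))%R.
    rewrite powRN -[leLHS]invr1 lef_pV2 ?posrE ?powR_gt0//.
    by rewrite -[leRHS](powRr0 `|x|); apply: ger_powR; rewrite ?x0//= ltW.
  have h2 : (bracket s <= 2 * `|x| `^ (- theta))%R by rewrite /bracket ger0_norm//; lra.
  have h3 : (bracket s `^ theta^-1 <= 2 `^ theta^-1 * `|x|^-1)%R.
    have -> : (`|x|^-1 = (`|x| `^ (- theta)) `^ theta^-1)%R.
      by rewrite -powRrM mulNr mulfV ?gt_eqF// powR_inv1.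
    rewrite -powRM ?powR_ge0//; apply: ge0_ler_powR => //.
    - by rewrite invr_ge0 ltW.
    - by rewrite nnegrE ltW// bracket_gt0.
    - by rewrite nnegrE mulr_ge0// powR_ge0.
  rewrite /r powRN ler_pdivlMr ?powR_gt0 ?bracket_gt0//.
  by rewrite mulrC -ler_pdivlMr.
rewrite integral_cst//= mul1e lebesgue_measure_itv/= lte_fin.
case: ifP => _; last by rewrite lee_fin !mulr_ge0// powR_ge0.
by rewrite -EFinB lee_fin /r; lra.
Qed.

Lemma ler_powRN (x y p : R) : (0 < x)%R -> (x <= y)%R -> (0 <= p)%R ->
  (y `^ (- p) <= x `^ (- p))%R.
Proof.
move=> x0 xy p0; have y0 : (0 < y)%R by exact: lt_le_trans xy.
rewrite !powRN lef_pV2 ?posrE ?powR_gt0//.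
by apply: ge0_ler_powR; rewrite ?nnegrE// ltW.
Qed.

Lemma integral_peak theta q : (0 < theta < 1)%R -> (1 < q)%R ->
  exists2 C : R, (0 <= C)%R & \int[mu]_x peak theta q x <= C%:E.
Proof.
move=> theta01 q1.
have [C1 C10 hC1] := integral_norm_powR_unit theta01.
have [C2 C20 hC2] := integral_bracket_powR q1.
exists (C1 + 2 `^ q * C2)%R; first by rewrite addr_ge0// mulr_ge0// powR_ge0.
have mf1 : measurable_fun [set: R] (fun x : R => (if (`|x| <= 1)%R then `|x| `^ (- theta) else 0)%R%:E).
  apply/measurable_EFinP; apply: measurable_fun_ifT => //.
    by apply: measurable_fun_ler => //; exact: measurableT_comp.
  exact: measurable_norm_powR.
have mf2 : measurable_fun [set: R] (fun x : R => ((2 `^ q)%:E * (bracket x `^ (- q))%:E)).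
  by apply: measurable_funeM; apply/measurable_EFinP; exact: measurable_bracket_powR.
rewrite EFinD EFinM -hC2 -ge0_integralZl_EFin ?powR_ge0//; last 2 first.
- by move=> x _; rewrite lee_fin powR_ge0.
- by apply/measurable_EFinP; exact: measurable_bracket_powR.
apply: le_trans (leeD hC1 (lexx _)).
rewrite -ge0_integralD//; last 2 first.
- by move=> x _; rewrite lee_fin; case: ifP => // _; exact: powR_ge0.
- by move=> x _; rewrite -EFinM lee_fin mulr_ge0// powR_ge0.
apply: ae_ge0_le_integral => //.
- by move=> x _; exact: peak_ge0.
- exact: measurable_peak.
- move=> x _; rewrite adde_ge0//.
    by rewrite lee_fin; case: ifP => // _; exact: powR_ge0.
  by rewrite -EFinM lee_fin mulr_ge0// powR_ge0.
- exact: emeasurable_funD.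
exists [set 0%R]; split => //; first exact: lebesgue_measure_set1.
move=> x /= /not_implyP[_ h]; apply: contrapT => /eqP x0; apply: h.
rewrite /peak (negbTE x0) /rpeak; case: ifPn => hx.
  by rewrite leeDl// -EFinM lee_fin mulr_ge0// powR_ge0.
rewrite add0e -EFinM lee_fin.
have -> : (2 `^ q * bracket x `^ (- q) = (bracket x / 2) `^ (- q))%R.
  rewrite powRM ?invr_ge0 ?ltW ?bracket_gt0// mulrC; congr (_ * _)%R.
  by rewrite -powR_inv1// -powRrM mulN1r opprK.
rewrite -ltNge in hx.
apply: ler_powRN; [by rewrite divr_gt0// bracket_gt0 | | by lra].
by rewrite /bracket; lra.
Qed.

(** The points a and b cannot both be close to x: one of < x - a >, < b - x > is at
    least < b - a > / 2, and the other factor is integrable. *)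
Lemma bracket_convolution p : (1 < p)%R ->
  exists2 C : R, (0 <= C)%R & forall a b : R,
    \int[mu]_x (bracket (x - a) `^ (- p) * bracket (b - x) `^ (- p))%R%:E <=
      (C * bracket (b - a) `^ (- p))%R%:E.
Proof.
move=> p1.
have [C C0 hC] := integral_bracket_powR p1.
exists (2 `^ p * C + 2 `^ p * C)%R; first by rewrite addr_ge0// mulr_ge0// powR_ge0.
move=> a b.
set K := (2 `^ p * bracket (b - a) `^ (- p))%R.
have K0 : (0 <= K)%R by rewrite mulr_ge0// powR_ge0.
have m1 : measurable_fun [set: R] (fun x : R => (bracket (x - a) `^ (- p))%:E).
  by apply/measurable_EFinP; apply: measurable_bracket_powR; exact: measurable_funB.
have m2 : measurable_fun [set: R] (fun x : R => (bracket (b - x) `^ (- p))%:E).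
  by apply/measurable_EFinP; apply: measurable_bracket_powR; exact: measurable_funB.
have m0 : measurable_fun [set: R] (fun x : R => (bracket x `^ (- p))%:E).
  by apply/measurable_EFinP; apply: measurable_bracket_powR.
have -> : ((2 `^ p * C + 2 `^ p * C) * bracket (b - a) `^ (- p) = K * C + K * C)%R.
  by rewrite /K; ring.
have i1 : (K * C)%:E = \int[mu]_x (K%:E * (bracket (x - a) `^ (- p))%:E).
  rewrite ge0_integralZl_EFin//; last by move=> x _; rewrite lee_fin powR_ge0.
  rewrite EFinM; congr (_ * _).
  rewrite -hC -(ge0_integral_shift (f := fun x => (bracket x `^ (- p))%:E) (- a)%R)//.
  by move=> x; rewrite lee_fin powR_ge0.
have i2 : (K * C)%:E = \int[mu]_x (K%:E * (bracket (b - x) `^ (- p))%:E).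
  rewrite ge0_integralZl_EFin//; last by move=> x _; rewrite lee_fin powR_ge0.
  rewrite EFinM; congr (_ * _).
  rewrite -hC -(ge0_integral_reflect (f := fun x => (bracket x `^ (- p))%:E) b)//.
  by move=> x; rewrite lee_fin powR_ge0.
rewrite EFinD {1}i1 i2 -ge0_integralD//; last 4 first.
- by move=> x _; rewrite -EFinM lee_fin mulr_ge0// powR_ge0.
- exact: measurable_funeM.
- by move=> x _; rewrite -EFinM lee_fin mulr_ge0// powR_ge0.
- exact: measurable_funeM.
apply: ge0_le_integral => //.
- by move=> x _; rewrite lee_fin mulr_ge0// powR_ge0.
- under eq_fun do rewrite EFinM; exact: emeasurable_funM.
- by apply: emeasurable_funD; exact: measurable_funeM.
move=> x _; rewrite -!EFinM -EFinD lee_fin.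
have key (u v : R) : (bracket (b - a) <= 2 * bracket u)%R ->
    (bracket u `^ (- p) * bracket v `^ (- p) <= K * bracket v `^ (- p))%R.
  move=> h; apply: ler_wpM2r; first exact: powR_ge0.
  have -> : K = ((bracket (b - a) / 2) `^ (- p))%R.
    rewrite powRM ?invr_ge0 ?ltW ?bracket_gt0// /K mulrC; congr (_ * _)%R.
    by rewrite -powR_inv1// -powRrM mulN1r opprK.
  apply: ler_powRN; [by rewrite divr_gt0// bracket_gt0 | | by lra].
  by rewrite ler_pdivrMr// mulrC.
have [h|h] := leP (bracket (x - a)) (bracket (b - x)).
  apply: le_trans (_ : _ <= K * bracket (x - a) `^ (- p))%R _; last first.
    by rewrite lerDl mulr_ge0// powR_ge0.
  rewrite mulrC; apply: key.
  have := ler_normD (x - a)%R (b - x)%R; rewrite (_ : (x - a + (b - x) = b - a)%R); last by ring.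
  by move: h; rewrite /bracket; lra.
apply: le_trans (_ : _ <= K * bracket (b - x) `^ (- p))%R _; last first.
  by rewrite lerDr mulr_ge0// powR_ge0.
apply: key.
have := ler_normD (x - a)%R (b - x)%R; rewrite (_ : (x - a + (b - x) = b - a)%R); last by ring.
by move: h; rewrite /bracket; lra.
Qed.

End Peak.

(** * An integral with a quadratic phase *)

Section Quadratic.
Context {R : realType}.
Notation mu := (@lebesgue_measure R).
Implicit Types c q : R.
Local Open Scope ereal_scope.

(** The substitution w = t ^ 2 on [0, n], followed by n -> oo; integrals of
    < c - w > ^ (- q) over any set are at most C. *)
Lemma integral_square_substitution q (C : R) : (1 < q)%R ->
  \int[mu]_x (bracket x `^ (- q))%:E = C%:E -> forall c,
  \int[mu]_(t in `[0%R, +oo[) (bracket (c - t ^+ 2) `^ (- q) * (t *+ 2))%R%:E <= C%:E.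
Proof.
move=> q1 hC c.
pose G (w : R) : R := (bracket (c - w) `^ (- q))%R.
pose F (t : R) : R := (t ^+ 2)%R.
have mG : measurable_fun [set: R] (EFin \o G).
  by apply/measurable_EFinP; apply: measurable_bracket_powR; exact: measurable_funB.
have iG : \int[mu]_w (G w)%:E = C%:E.
  rewrite -hC -[RHS](ge0_integral_reflect (f := fun x => (bracket x `^ (- q))%:E) c)//.
    by apply/measurable_EFinP; exact: measurable_bracket_powR.
  by move=> x; rewrite lee_fin powR_ge0.
have F' (t : R) : is_derive t 1%R F (t *+ 2)%R.
  apply: (is_derive_eq (@is_deriveX R R id 2%N t 1%R 1%R (is_derive_id t 1%R))).
  by rewrite expr1 /GRing.scale /= mulr1 mulr_natl.
have F'E : derive1 F = (fun t => t *+ 2)%R.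
  by apply/funext => t; rewrite derive1E; have [_ ->] := F' t.
have cF' : continuous (fun t : R => t *+ 2)%R.
  by move=> t; apply: cvgMn; exact: cvg_id.
have cF : continuous F.
  by move=> t; apply: differentiable_continuous; apply/derivable1_diffP; have [] := F' t.
have cG : continuous G.
  move=> w; apply: (continuous_comp (f := fun w : R => (c - w)%R) (g := fun u : R => (bracket u `^ (- q))%R)).
    by apply: cvgB; [exact: cvg_cst|exact: cvg_id].
  exact: continuous_bracket_powR.
have mF : measurable_fun [set: R] F by exact: continuous_measurable_fun.
have mF' : measurable_fun [set: R] (fun t : R => t *+ 2)%R.
  exact: continuous_measurable_fun.
have bnd n : \int[mu]_(t in `[0%R, n%:R]) (G (F t) * (t *+ 2))%R%:E <= C%:E.
  have := @integration_by_substitution_increasing _ F G 0%R n%:R (ler0n _ _).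
  rewrite /F expr0n /= => H.
  under eq_integral => t _.
    rewrite -[(t *+ 2)%R]/((fun t => t *+ 2)%R t) -F'E.
    over.
  rewrite -[leLHS]H.
  - rewrite -iG; apply: ge0_subset_integral => //.
    by move=> x _; rewrite lee_fin powR_ge0.
  - move=> x y; rewrite !in_itv/= => /andP[x0 _] /andP[y0 _] xy.
    by rewrite ltr_pXn2r.
  - by rewrite F'E => x _; exact: cF'.
  - by rewrite F'E; apply/cvg_ex; eexists; apply: cvg_at_right_filter; exact: cF'.
  - by rewrite F'E; apply/cvg_ex; eexists; apply: cvg_at_left_filter; exact: cF'.
  - split.
    + by move=> x _; have [] := F' x.
    + by apply: cvg_at_right_filter; exact: cF.
    + by apply: cvg_at_left_filter; exact: cF.
  - exact: continuous_subspaceT.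
have hU : `[0%R, +oo[%classic = \bigcup_n `[0%R, (n%:R : R)]%classic.
  apply/seteqP; split => x /=; rewrite in_itv/= ?andbT.
    move=> x0; exists (Num.truncn x).+1 => //=; rewrite in_itv/= x0/=.
    by apply/ltW; exact: truncnS_gt.
  by move=> [n _ /=]; rewrite in_itv/= => /andP[].
rewrite hU.
have mf : measurable_fun [set: R] (fun t : R => (bracket (c - t ^+ 2) `^ (- q) * (t *+ 2))%R%:E).
  apply/measurable_EFinP; apply: measurable_funM.
    apply: measurable_bracket_powR; apply: measurable_funB => //.
  exact: mF'.
apply: (@cvge_to_le _ \oo _ _ (fun n => \int[mu]_(t in `[0%R, n%:R]) (G (F t) * (t *+ 2))%R%:E)); last exact: nearW.
apply: ge0_nondecreasing_set_cvg_integral.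
- move=> m n mn; rewrite subsetEset => x /=; rewrite !in_itv/= => /andP[-> /=] h.
  by apply: le_trans h _; rewrite ler_nat.
- by move=> i; exact: measurable_itv.
- by move=> i; apply: measurable_funTS.
- move=> i x /=; rewrite in_itv/= => /andP[x0 _].
  by rewrite lee_fin mulr_ge0// ?powR_ge0// mulrn_wge0.
Qed.

(** Scaling by |l| ^ (1/2) reduces to l = 1 (changing the sign of c if l < 0),
    and produces the power of |l|. When l = 1, the region |t| <= 1 contributes
    at most its length 2, and beyond it |t| ^ rho <= |t| makes t dt the
    differential of t ^ 2 / 2. *)
Lemma integral_quadratic (rho q : R) : (0 < rho <= 1)%R -> (1 < q)%R ->
  exists2 C : R, (0 <= C)%R & forall c l : R, l != 0%R ->
  \int[mu]_t (`|t| `^ rho * bracket (c - l * t ^+ 2) `^ (- q))%R%:E <=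
    (C * `|l| `^ (- ((1 + rho) / 2)))%R%:E.
Proof.
move=> /andP[rho0 rho1] q1.
have [C C0 hC] := integral_bracket_powR q1.
exists (2 + C)%R; first by rewrite addr_ge0.
pose g (c t : R) : R := (`|t| `^ rho * bracket (c - t ^+ 2) `^ (- q))%R.
have g0 c t : (0 <= g c t)%R by rewrite mulr_ge0// powR_ge0.
have msq c l : measurable_fun [set: R] (fun t : R => c - l * t ^+ 2)%R.
  by apply: measurable_funB => //; apply: measurable_funM => //; exact: measurable_funX.
have msq1 c : measurable_fun [set: R] (fun t : R => c - t ^+ 2)%R.
  by apply: measurable_funB => //; exact: measurable_funX.
have mg c : measurable_fun [set: R] (fun t => (g c t)%:E).
  apply/measurable_EFinP; apply: measurable_funM; first exact: measurable_norm_powR.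
  by apply: measurable_bracket_powR; exact: msq1.
have bnd c : \int[mu]_t (g c t)%:E <= (2 + C)%:E.
  pose h (t : R) : R := (`|t| * bracket (c - t ^+ 2) `^ (- q))%R.
  have h0 t : (0 <= h t)%R by rewrite mulr_ge0// powR_ge0.
  have mh : measurable_fun [set: R] (fun t => (h t)%:E).
    apply/measurable_EFinP; apply: measurable_funM; first exact: normr_measurable.
    by apply: measurable_bracket_powR; exact: msq1.
  have ih : \int[mu]_t (h t)%:E <= C%:E.
    rewrite ge0_symfun_integralT//; last 2 first.
    - move=> t; apply: cvgM; first exact: norm_continuous.
      apply: (continuous_comp (f := fun w : R => (c - w ^+ 2)%R) (g := fun u : R => (bracket u `^ (- q))%R)).
        by apply: cvgB; [exact: cvg_cst|exact: exprn_continuous].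
      exact: continuous_bracket_powR.
    - by move=> t /=; rewrite /h normrN sqrrN.
    rewrite -set_itvcy -ge0_integralZl_EFin//; last first.
    - by apply: measurable_funTS.
    - by move=> x _; rewrite lee_fin.
    apply: le_trans (integral_square_substitution q1 hC c).
    apply: ge0_le_integral => //.
    - by move=> x _; rewrite -EFinM lee_fin mulr_ge0.
    - by apply: measurable_funTS; exact: measurable_funeM.
    - apply: measurable_funTS; apply/measurable_EFinP; apply: measurable_funM.
        by apply: measurable_bracket_powR; exact: msq1.
      exact: natmul_measurable.
    - move=> x /=; rewrite in_itv/= andbT => x0; rewrite -EFinM lee_fin /h ger0_norm//.
      by rewrite le_eqVlt; apply/orP; left; apply/eqP; ring.
  have i2 : 2%:E = \int[mu]_(t in `[(-1)%R, 1%R]) 1%:E.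
    rewrite integral_cst//= mul1e lebesgue_measure_itv/= lte_fin ifT; last by lra.
    by rewrite -EFinB; congr EFin; ring.
  rewrite EFinD; apply: le_trans (leeD (lexx _) ih).
  rewrite i2 [X in _ <= X + _]integral_mkcond -ge0_integralD//; last 3 first.
  - by move=> x _; apply: erestrict_ge0.
  - by apply/(measurable_restrictT _ _).1.
  - by move=> x _; rewrite lee_fin.
  apply: ge0_le_integral => //.
  - by move=> x _; rewrite lee_fin.
  - exact: mg.
  - by apply: emeasurable_funD => //; apply/(measurable_restrictT _ _).1.
  move=> x _; rewrite patchE; case: ifPn => [hx|].
    rewrite -EFinD lee_fin; apply: le_trans (_ : 1 <= _)%R; last by rewrite lerDl.
    move: hx; rewrite inE/= in_itv/= -ler_norml => hx.
    rewrite -[leRHS](mulr1 1%R); apply: ler_pM; rewrite ?powR_ge0//.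
      apply: (@le_trans _ _ (1 `^ rho)%R); last by rewrite powR1.
      by apply: ge0_ler_powR; rewrite ?nnegrE//; exact: ltW.
    rewrite powRN invf_le1 ?powR_gt0 ?bracket_gt0//.
    by rewrite -[leLHS](powRr0 (bracket (c - x ^+ 2))); apply: ler_powR; [exact: bracket_ge1|lra].
  rewrite notin_setE/= in_itv/= -ler_norml => /negP; rewrite -ltNge => x1.
  rewrite add0e lee_fin; apply: ler_wpM2r; first exact: powR_ge0.
  by apply: ler1_powR => //; exact: ltW.
move=> c l l0.
have l1 : (0 < `|l|)%R by rewrite normr_gt0.
set k := (`|l| `^ 2^-1)%R.
have k0 : (0 < k)%R by exact: powR_gt0.
have k2 : (k ^+ 2 = `|l|)%R.
  by rewrite /k -powR_mulrn ?powR_ge0// -powRrM mulVf// powRr1.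
pose c' := (if (0 < l) then c else - c)%R.
have E t : (`|t| `^ rho * bracket (c - l * t ^+ 2) `^ (- q))%R%:E =
    (`|l| `^ (- (rho / 2)))%:E * (g c' (k * t + 0))%R%:E.
  rewrite -EFinM; congr EFin; rewrite addr0 /g normrM (gtr0_norm k0) powRM//; last exact: ltW.
  rewrite [RHS]mulrA; congr (_ * powR _ _)%R.
    by rewrite /k -powRrM powRN [(2^-1 * rho)%R]mulrC mulrA mulVf ?mul1r// gt_eqF// powR_gt0.
  rewrite exprMn k2 /c'; case: ifPn => hl; first by rewrite gtr0_norm.
  rewrite ltr0_norm; first by rewrite -bracketN; congr bracket; ring.
  by rewrite lt_neqAle l0 leNgt.
under eq_integral do rewrite E.
rewrite ge0_integralZl_EFin//; last 2 first.
- by move=> x _; rewrite lee_fin.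
- have : measurable_fun [set: R] (fun x : R => (k * x + 0)%R).
    by apply: measurable_funD => //; apply: measurable_funM.
  by move=> /(measurableT_comp (mg c')).
rewrite (ge0_integral_affine (f := fun t => (g c' t)%:E))//.
rewrite (_ : (2 + C) * _ = `|l| `^ (- (rho / 2)) * (k^-1 * (2 + C)))%R; last first.
  rewrite (_ : - ((1 + rho) / 2) = - (rho / 2) + - 2^-1)%R; last by field.
  rewrite powRD; last by apply/implyP => _; rewrite gt_eqF.
  by rewrite /k -powRN; ring.
rewrite (EFinM (`|l| `^ _)); apply: lee_wpmul2l; first by rewrite lee_fin powR_ge0.
rewrite EFinM; apply: lee_wpmul2l; first by rewrite lee_fin invr_ge0 ltW.
  exact: bnd.
by move=> x; rewrite lee_fin.
Qed.
End Quadratic.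

(** * Bounds for the weight when the resonance is quadratic *)

Section WeightBound.
Context {R : realType}.
Notation mu := (@lebesgue_measure R).
Implicit Types m Y t e : R.

Lemma powR_le3 (eps x y : R) : 0 <= eps <= 1 -> 0 <= x -> x <= 3 * y ->
  x `^ eps <= 3 * y `^ eps.
Proof.
move=> /andP[e0 e1] x0 xy; have y0 : 0 <= y by lra.
apply: (@le_trans _ _ ((3 * y) `^ eps)).
  by apply: ge0_ler_powR; rewrite ?nnegrE// mulr_ge0.
rewrite powRM//; apply: ler_wpM2r; first exact: powR_ge0.
by apply: ler1_powR => //; lra.
Qed.

Lemma powR_split (x a b c : R) : 0 < x -> a = b + c -> x `^ a = x `^ b * x `^ c.
Proof. by move=> x0 ->; rewrite powRD//; apply/implyP => _; rewrite gt_eqF. Qed.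

(** The product of two powers is bounded by the sum of the corresponding single
    powers, by comparing |e| with |Y|. For |e| <= 1 the exponent rho is enlarged to
    theta, so that all singularities have the same order. *)
Lemma powR_mul_le_rpeak (kap rho theta Y e : R) : 0 <= kap -> 0 <= rho <= theta ->
  1 < `|Y| -> e != 0 ->
  `|Y| `^ (- kap) * `|e| `^ (- rho) <=
    rpeak theta (kap + rho) Y + rpeak theta (kap + rho) e.
Proof.
move=> kap0 /andP[rho0 rhot] Y1 e0.
have e1 : 0 < `|e| by rewrite normr_gt0.
have Y0 : 0 < `|Y| by lra.
rewrite {1}/rpeak (lt_geF Y1) /rpeak; case: ifPn => he.
  apply: (@le_trans _ _ (`|e| `^ (- theta))); last by rewrite lerDr powR_ge0.
  rewrite -[leRHS]mul1r; apply: ler_pM; rewrite ?powR_ge0//.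
    by rewrite -[leRHS](powRr0 `|Y|); apply: ler_powR; [exact: ltW|lra].
  by apply: ger_powR; [rewrite e1|lra].
rewrite -ltNge in he.
have [h|h] := leP `|e| `|Y|.
  apply: (@le_trans _ _ (`|e| `^ (- (kap + rho)))); last by rewrite lerDr powR_ge0.
  rewrite (@powR_split `|e| (- (kap + rho)) (- kap) (- rho))//; last by ring.
  by apply: ler_wpM2r; [exact: powR_ge0 | exact: ler_powRN].
apply: (@le_trans _ _ (`|Y| `^ (- (kap + rho)))); last by rewrite lerDl powR_ge0.
rewrite (@powR_split `|Y| (- (kap + rho)) (- kap) (- rho))//; last by ring.
by apply: ler_wpM2l; [exact: powR_ge0 | apply: ler_powRN => //; exact: ltW].
Qed.

(** The condition holds when the modulus of m - Y is between those of Y / 2 + t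
    and Y / 2 - t. At t = 0 it would force |m - Y| = |Y| / 2, that is Y = 2 m or
    Y = 2 m / 3, so |t| controls the distance of Y to one of these points. *)
Lemma distance_to_roots m Y t : `| `|m - Y| - `|Y| / 2 | <= `|t| ->
  `|Y - 2 * m| <= 2 * `|t| \/ `|Y - 2 / 3 * m| <= 2 * `|t|.
Proof.
move: `|t| => T.
have [h1|h1] := leP 0 (m - Y); have [h2|h2] := leP 0 Y;
  rewrite ?(ger0_norm h1) ?(ltr0_norm h1) ?(ger0_norm h2) ?(ltr0_norm h2) !ler_norml => /andP[a1 a2].
- by right; apply/andP; split; lra.
- by left; apply/andP; split; lra.
- by left; apply/andP; split; lra.
- by right; apply/andP; split; lra.
Qed.

(** The factor |t| ^ rho is what [integral_quadratic] integrates at the price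
    |Y| ^ (- theta), where theta = (1 + rho) / 2, and the remaining function of Y
    must have integrable peaks once this price is paid. Away from the unit
    square there are two regimes. If |t| dominates |Y|, or |Y| <= 1, then
    nu <= rho suffices. Otherwise the weight is comparable to |Y| ^ nu, and the factor
    |t| ^ rho is recovered by dividing by the distance e of Y to 2 m or 2 m / 3:
    what is left is |Y| ^ (- (theta - nu)) |e| ^ (- rho), a sum of two peaks with
    tail exponent q = theta - nu + rho. Integrability asks for theta < 1 < q,
    that is (1 + 2 nu) / 3 < rho < 1; the value rho = (1 + nu) / 2 satisfies it
    if and only if nu < 1. *)
Lemma middle_weight_bound (nu m Y t : R) : 0 <= nu < 1 ->
  Y != 0 -> Y - 2 * m != 0 -> Y - 2 / 3 * m != 0 ->
  `| `|m - Y| - `|Y| / 2 | <= `|t| ->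
  bracket (`|Y| / 2 + `|t|) `^ nu <=
   3 * ((`|Y| <= 1) && (`|t| <= 1))%:R +
   6 * (`|t| `^ ((1 + nu) / 2) * (`|Y| `^ ((3 + nu) / 4) *
     (rpeak ((3 + nu) / 4) ((5 - nu) / 4) Y +
      rpeak ((3 + nu) / 4) ((5 - nu) / 4) (Y - 2 * m) +
      rpeak ((3 + nu) / 4) ((5 - nu) / 4) (Y - 2 / 3 * m)))).
Proof.
move=> /andP[nu0 nu1] Y0 e1 e2 ht.
set rho := (1 + nu) / 2; set theta := (3 + nu) / 4; set q := (5 - nu) / 4.
set S := (_ + _ + _).
have hS0 x : 0 <= rpeak theta q x by exact: rpeak_ge0.
have nu01 : 0 <= nu <= 1 by rewrite nu0 ltW.
have Yp : 0 < `|Y| by rewrite normr_gt0.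
have S0 : 0 <= S by rewrite /S !addr_ge0.
have YS : rpeak theta q Y <= S.
  by rewrite /S -addrA lerDl addr_ge0.
have brE : bracket (`|Y| / 2 + `|t|) = 1 + `|Y| / 2 + `|t|.
  by rewrite /bracket ger0_norm ?addrA// addr_ge0// divr_ge0.
have T0 : 0 <= `|t| `^ rho by exact: powR_ge0.
have P0 : 0 <= `|Y| `^ theta by exact: powR_ge0.
have b0 : 0 <= bracket (`|Y| / 2 + `|t|) by apply/ltW/bracket_gt0.
have tp := normr_ge0 t.
have fin (X : R) : bracket (`|Y| / 2 + `|t|) `^ nu <= 3 * X ->
    X <= 2 * (`|t| `^ rho * (`|Y| `^ theta * S)) ->
    bracket (`|Y| / 2 + `|t|) `^ nu <=
      3 * ((`|Y| <= 1) && (`|t| <= 1))%:R + 6 * (`|t| `^ rho * (`|Y| `^ theta * S)).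
  move=> h1 h2; apply: (le_trans h1).
  have : 0 <= ((`|Y| <= 1) && (`|t| <= 1))%:R :> R by [].
  by lra.
have [hY|hY] := leP `|Y| 1.
  have [ht1|ht1] := leP `|t| 1.
    rewrite mulr1.
    apply: (@le_trans _ _ (3 * 1 `^ nu)); last first.
      by rewrite powR1 mulr1 lerDl !mulr_ge0.
    by apply: powR_le3 => //; rewrite brE; lra.
  rewrite mulr0 add0r.
  have YS1 : 1 <= `|Y| `^ theta * S.
    apply: (@le_trans _ _ (`|Y| `^ theta * rpeak theta q Y)); last exact: ler_wpM2l.
    by rewrite /rpeak hY powRN mulfV// gt_eqF// powR_gt0.
  apply: (@le_trans _ _ (3 * `|t| `^ nu)).
    by apply: powR_le3 => //; rewrite brE; lra.
  have : `|t| `^ nu <= `|t| `^ rho by apply: ler_powR; [exact: ltW|rewrite /rho; lra].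
  by move: T0; nra.
move: fin; rewrite (lt_geF hY)/= mulr0 add0r => fin.
have [htY|htY] := leP `|Y| `|t|.
  have t0 : 0 < `|t| by lra.
  apply: (fin (`|t| `^ nu)); first by apply: powR_le3 => //; rewrite brE; lra.
  apply: (@le_trans _ _ (`|t| `^ rho * (`|Y| `^ theta * rpeak theta q Y))); last first.
    apply: (@le_trans _ _ (`|t| `^ rho * (`|Y| `^ theta * S))).
      by do 2 apply: ler_wpM2l => //.
    by rewrite mulr_natl mulr2n lerDl !mulr_ge0.
  rewrite /rpeak (lt_geF hY)/= -(@powR_split _ (nu - rho))//; last by rewrite /theta /q /rho; field.
  rewrite (@powR_split `|t| nu rho (nu - rho))//; last by ring.
  apply: ler_wpM2l => //.
  by rewrite -opprB; apply: ler_powRN => //; rewrite /rho; lra.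
apply: (fin (`|Y| `^ nu)); first by apply: powR_le3 => //; rewrite brE; lra.
have key (e : R) : e != 0 -> `|e| <= 2 * `|t| -> rpeak theta q Y + rpeak theta q e <= S ->
    `|Y| `^ nu <= 2 * (`|t| `^ rho * (`|Y| `^ theta * S)).
  move=> e0 he hsum.
  have ep : 0 < `|e| by rewrite normr_gt0.
  have h1 : 1 <= 2 * (`|t| `^ rho * `|e| `^ (- rho)).
    have h : `|e| `^ rho <= 2 * `|t| `^ rho.
      apply: (@le_trans _ _ ((2 * `|t|) `^ rho)).
        by apply: ge0_ler_powR; rewrite ?nnegrE//; rewrite /rho; lra.
      rewrite powRM//; apply: ler_wpM2r => //.
      by apply: ler1_powR; rewrite /rho; lra.
    by rewrite mulrA powRN ler_pdivlMr ?powR_gt0// mul1r.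
  have h2 : `|Y| `^ nu * `|e| `^ (- rho) <= `|Y| `^ theta * S.
    rewrite (@powR_split `|Y| nu theta (- (theta - nu)))//; last by ring.
    rewrite -mulrA; apply: ler_wpM2l => //.
    apply: (le_trans _ hsum).
    rewrite (_ : q = theta - nu + rho); last by rewrite /theta /q /rho; field.
    by apply: powR_mul_le_rpeak => //; rewrite /theta /rho; lra.
  apply: (@le_trans _ _ (2 * (`|t| `^ rho * `|e| `^ (- rho)) * `|Y| `^ nu)).
    by rewrite -[leLHS]mul1r; apply: ler_wpM2r => //; exact: powR_ge0.
  rewrite -mulrA; apply: ler_wpM2l => //; rewrite -mulrA; apply: ler_wpM2l => //.
  by rewrite mulrC.
have [h|h] := distance_to_roots ht.
- apply: (key _ e1 h); rewrite /S lerDl; exact: hS0.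
- by apply: (key _ e2 h); rewrite /S lerD2r lerDl; exact: hS0.
Qed.

End WeightBound.

(** * The kernel where a given frequency has middle modulus *)

Section MiddleKernel.
Context {R : realType}.
Notation mu := (@lebesgue_measure R).
Implicit Types m c k Y t : R.
Variables (nu q k : R).
Hypotheses (nu01 : 0 <= nu < 1) (q1 : 1 < q) (k0 : k != 0).

(** For m = x + w + z with w of middle modulus, put Y = x + z and t = (x - z) / 2.
    Then w = m - Y, the largest modulus is |Y| / 2 + |t|, the smallest is the
    distance of |Y| / 2 to |t|, and (x + z) (m - x) (m - z) equals
    Y ((m - Y / 2) ^ 2 - t ^ 2). *)
Definition middle_kernel m c Y t : R :=
  if `| `|m - Y| - `|Y| / 2 | <= `|t| then
    bracket (`|Y| / 2 + `|t|) `^ nu *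
    bracket (c + k * Y * ((m - Y / 2) ^+ 2 - t ^+ 2)) `^ (- q)
  else 0.

Lemma middle_kernel_ge0 m c Y t : 0 <= middle_kernel m c Y t.
Proof. by rewrite /middle_kernel; case: ifP => // _; rewrite mulr_ge0 ?powR_ge0. Qed.

Lemma measurable_normr_comp d (T : measurableType d) (D : set T) (f : T -> R) :
  measurable_fun D f -> measurable_fun D (fun x => `|f x|).
Proof. exact: measurableT_comp. Qed.

Lemma measurable_middle_kernel d (T : measurableType d) (f g : T -> R) m c :
  measurable_fun setT f -> measurable_fun setT g ->
  measurable_fun setT (fun x => middle_kernel m c (f x) (g x)).
Proof.
move=> mf mg; apply: measurable_fun_ifT => //.
  apply: measurable_fun_ler; apply: measurable_normr_comp => //.
  apply: measurable_funB; first by apply: measurable_normr_comp; exact: measurable_funB.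
  by apply: measurable_funM => //; exact: measurable_normr_comp.
apply: measurable_funM.
  apply: measurable_bracket_powR; apply: measurable_funD; last exact: measurable_normr_comp.
  by apply: measurable_funM => //; exact: measurable_normr_comp.
apply: measurable_bracket_powR; apply: measurable_funD => //; apply: measurable_funM.
  exact: measurable_funM.
apply: measurable_funB; last exact: measurable_funX.
apply: measurable_funX; apply: measurable_funB => //.
exact: measurable_funM.
Qed.

Local Open Scope ereal_scope.
Let theta : R := ((3 + nu) / 4)%R.
Let q' : R := ((5 - nu) / 4)%R.

Definition kernel_majorant m Y : \bar R :=
  (if `|Y| <= 1 then 1 else 0)%R%:E +
  (peak theta q' Y + peak theta q' (Y - 2 * m)%R + peak theta q' (Y - 2 / 3 * m)%R).

Lemma kernel_majorant_ge0 m Y : 0 <= kernel_majorant m Y.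
Proof. by rewrite /kernel_majorant !adde_ge0 ?peak_ge0//; case: ifP; rewrite lee_fin. Qed.

Lemma measurable_peak_shift e : measurable_fun [set: R] (fun Y : R => peak theta q' (Y - e)%R).
Proof.
apply: (measurableT_comp (measurable_peak theta q')).
exact: measurable_funB.
Qed.

Lemma measurable_unit_indicator : measurable_fun [set: R] (fun Y : R => (if `|Y| <= 1 then 1 else 0)%R%:E : \bar R).
Proof.
apply/measurable_EFinP; apply: measurable_fun_ifT => //.
by apply: measurable_fun_ler => //; exact: measurable_normr_comp.
Qed.

Lemma measurable_kernel_majorant m : measurable_fun [set: R] (kernel_majorant m).
Proof.
apply: emeasurable_funD; first exact: measurable_unit_indicator.
apply: emeasurable_funD; last exact: measurable_peak_shift.
by apply: emeasurable_funD; [exact: measurable_peak|exact: measurable_peak_shift].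
Qed.

(** Translations do not change the integral of a peak, so the bound is uniform
    in the position of the singularities. *)
Lemma integral_kernel_majorant : exists2 C : R, (0 <= C)%R &
  forall m, \int[mu]_Y kernel_majorant m Y <= C%:E.
Proof.
have [nu0 nu1] := andP nu01.
have t01 : (0 < theta < 1)%R by rewrite /theta; lra.
have q'1 : (1 < q')%R by rewrite /q'; lra.
have [C C0 hC] := integral_peak t01 q'1.
exists (2 + (C + C + C))%R; first by rewrite !addr_ge0.
move=> m; rewrite /kernel_majorant.
have shift e : \int[mu]_Y peak theta q' (Y - e)%R <= C%:E.
  rewrite (ge0_integral_shift (f := peak theta q'))//; first exact: measurable_peak.
  by move=> x; exact: peak_ge0.
have m1 := measurable_peak theta q'.
have m2 := measurable_peak_shift (2 * m).
have m3 := measurable_peak_shift (2 / 3 * m).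
rewrite ge0_integralD//; last 4 first.
- by move=> x _; case: ifP; rewrite lee_fin.
- exact: measurable_unit_indicator.
- by move=> x _; rewrite !adde_ge0 ?peak_ge0.
- by apply: emeasurable_funD => //; exact: emeasurable_funD.
rewrite EFinD; apply: leeD.
  rewrite [leLHS](_ : _ = \int[mu]_(t in `[(-1)%R, 1%R]) 1%:E).
    rewrite integral_cst//= mul1e lebesgue_measure_itv/= lte_fin ifT; last by lra.
    by rewrite -EFinB lee_fin; lra.
  rewrite [RHS]integral_mkcond; apply: eq_integral => x _; rewrite patchE.
  rewrite ler_norml; case: ifPn => h; first by rewrite ifT// inE/= in_itv.
  by rewrite ifF//; apply/negbTE; rewrite notin_setE/= in_itv/=; exact/negP.
rewrite ge0_integralD//; last 3 first.
- by move=> x _; rewrite !adde_ge0 ?peak_ge0.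
- exact: emeasurable_funD.
- by move=> x _; exact: peak_ge0.
rewrite EFinD; apply: leeD => //.
rewrite ge0_integralD//; last 2 first.
- by move=> x _; exact: peak_ge0.
- by move=> x _; exact: peak_ge0.
by rewrite EFinD; apply: leeD.
Qed.

(** The low frequency part of [middle_weight_bound] is integrated over |t| <= 1,
    and the rest by [integral_quadratic] with slope k Y, whose power
    |Y| ^ (- theta) cancels the prefactor |Y| ^ theta. *)
Lemma integral_middle_kernel : exists2 C : R, (0 <= C)%R & forall m c Y,
  \int[mu]_t (middle_kernel m c Y t)%:E <= C%:E * kernel_majorant m Y.
Proof.
have [nu0 nu1] := andP nu01.
have rho01 : (0 < (1 + nu) / 2 <= 1)%R by lra.
have [C C0 hC] := integral_quadratic rho01 q1.
pose K := (6 + 6 * (C * `|k| `^ (- theta)))%R.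
have K'0 : (0 <= C * `|k| `^ (- theta))%R by rewrite mulr_ge0// powR_ge0.
exists K; first by rewrite addr_ge0// !mulr_ge0// powR_ge0.
have Kgt0 : (0 < K)%R by rewrite /K; lra.
move=> m c Y.
(* On the three lines where a singularity sits, the majorant is infinite. *)
have inf e : peak theta q' e = +oo -> peak theta q' e <= kernel_majorant m Y ->
    \int[mu]_t (middle_kernel m c Y t)%:E <= K%:E * kernel_majorant m Y.
  by move=> ->; rewrite leye_eq => /eqP ->; rewrite gt0_muley ?leey.
have unit0 : 0 <= (if `|Y| <= 1 then 1 else 0)%R%:E :> \bar R by case: ifP; rewrite lee_fin.
have [Y0|Y0] := eqVneq Y 0%R.
  apply: (inf Y); first by rewrite /peak Y0 eqxx.
  apply: le_trans _ (leeDr _ unit0); rewrite -addeA; apply: leeDl.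
  by rewrite adde_ge0 ?peak_ge0.
have [e1|e1] := eqVneq (Y - 2 * m)%R 0%R.
  apply: (inf (Y - 2 * m)%R); first by rewrite /peak e1 eqxx.
  apply: le_trans _ (leeDr _ unit0); apply: le_trans _ (leeDl _ (peak_ge0 _ _ _)).
  exact: leeDr _ (peak_ge0 _ _ _).
have [e2|e2] := eqVneq (Y - 2 / 3 * m)%R 0%R.
  apply: (inf (Y - 2 / 3 * m)%R); first by rewrite /peak e2 eqxx.
  apply: le_trans _ (leeDr _ unit0); apply: leeDr.
  by rewrite adde_ge0 ?peak_ge0.
rewrite /kernel_majorant /peak (negbTE Y0) (negbTE e1) (negbTE e2) -!EFinD -EFinM.
set S := (rpeak theta q' Y + _ + _)%R.
have S0 : (0 <= S)%R by rewrite /S !addr_ge0 ?rpeak_ge0.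
pose c' := (c + k * Y * (m - Y / 2) ^+ 2)%R.
pose Q t := (`|t| `^ ((1 + nu) / 2) * bracket (c' - k * Y * t ^+ 2) `^ (- q))%R.
have Q0 t : (0 <= Q t)%R by rewrite mulr_ge0// powR_ge0.
have mQ : measurable_fun [set: R] (fun t => (Q t)%:E).
  apply/measurable_EFinP; apply: measurable_funM; first exact: measurable_norm_powR.
  apply: measurable_bracket_powR; apply: measurable_funB => //.
  by apply: measurable_funM => //; exact: measurable_funX.
pose A := (6 * (`|Y| `^ theta * S))%R.
have A0 : (0 <= A)%R by rewrite !mulr_ge0// powR_ge0.
pose u : R := (if `|Y| <= 1 then 1 else 0)%R.
have u0 : (0 <= u)%R by rewrite /u; case: ifP.
pose I t : R := (3 * u * \1_(`[(-1)%R, 1%R]%classic : set R) t)%R.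
have I0 t : (0 <= I t)%R by rewrite !mulr_ge0.
have mI : measurable_fun [set: R] (fun t => (I t)%:E).
  by apply/measurable_EFinP; apply: measurable_funM => //; exact: measurable_indic.
apply: (@le_trans _ _ (\int[mu]_t ((I t)%:E + A%:E * (Q t)%:E))).
  apply: ge0_le_integral => //.
  - by move=> t _; rewrite lee_fin middle_kernel_ge0.
  - by apply/measurable_EFinP; exact: measurable_middle_kernel.
  - by apply: emeasurable_funD => //; exact: measurable_funeM.
  move=> t _; rewrite -EFinM -EFinD lee_fin /middle_kernel; case: ifPn => ht; last first.
    by rewrite addr_ge0// mulr_ge0.
  have B0 := powR_ge0 (bracket (c' - k * Y * t ^+ 2)) (- q)%R.
  have B1 : (bracket (c' - k * Y * t ^+ 2) `^ (- q) <= 1)%R.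
    by apply: bracket_powRN_le1; exact: ltW (lt_trans ltr01 q1).
  rewrite (_ : c + k * Y * ((m - Y / 2) ^+ 2 - t ^+ 2) = c' - k * Y * t ^+ 2)%R; last by rewrite /c'; ring.
  apply: le_trans (ler_wpM2r B0 (middle_weight_bound nu01 Y0 e1 e2 ht)) _.
  rewrite -/theta -/q' -/S mulrDl; apply: lerD; last first.
    by rewrite /A /Q le_eqVlt; apply/orP; left; apply/eqP; ring.
  apply: (@le_trans _ _ (3 * ((`|Y| <= 1) && (`|t| <= 1))%:R)%R).
    by rewrite -[leRHS]mulr1; apply: ler_wpM2l => //; rewrite mulr_ge0.
  rewrite /I -mulrA; apply: ler_wpM2l => //; rewrite /u.
  case: (`|Y| <= 1)%R => /=; last by rewrite mul0r.
  by rewrite mul1r indicE ler_nat; case: (boolP (`|t| <= 1)%R) => // h; rewrite mem_set//= in_itv/= -ler_norml.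
rewrite ge0_integralD//; last 3 first.
- by move=> t _; rewrite lee_fin.
- by move=> t _; rewrite -EFinM lee_fin mulr_ge0.
- exact: measurable_funeM.
rewrite ge0_integralZl_EFin//; last by move=> t _; rewrite lee_fin.
have -> : \int[mu]_t (I t)%:E = (6 * u)%:E.
  under eq_integral do rewrite /I EFinM.
  rewrite ge0_integralZl_EFin//; last 2 first.
  - by apply/measurable_EFinP; exact: measurable_indic.
  - by rewrite mulr_ge0.
  rewrite integral_indic//= setIT lebesgue_measure_itv/= lte_fin ifT; last by lra.
  by rewrite -EFinB -EFinM; congr EFin; ring.
have A0' : 0 <= A%:E by rewrite lee_fin.
have kY0 : (k * Y != 0)%R by rewrite mulf_neq0.
apply: le_trans (leeD (lexx _) (lee_wpmul2l A0' (hC c' (k * Y)%R kY0))) _.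
rewrite (_ : (1 + (1 + nu) / 2) / 2 = theta)%R; last by rewrite /theta; field.
rewrite -EFinM -EFinD lee_fin normrM powRM// -/u.
have -> : (A * (C * (`|k| `^ (- theta) * `|Y| `^ (- theta))) = 6 * (C * `|k| `^ (- theta)) * S)%R.
  by rewrite /A (powRN `|Y|); field; rewrite gt_eqF// powR_gt0 ?normr_gt0.
rewrite /K; move: (C * _)%R K'0 => D D0.
have := mulr_ge0 D0 u0; have := mulr_ge0 D0 S0; nra.
Qed.

Lemma iterated_middle_kernel : exists2 C : R, (0 <= C)%R & forall m c,
  \int[mu]_Y \int[mu]_t (middle_kernel m c Y t)%:E <= C%:E.
Proof.
have [C C0 hC] := integral_middle_kernel.
have [D D0 hD] := integral_kernel_majorant.
exists (C * D)%R; first exact: mulr_ge0.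
move=> m c; rewrite EFinM.
apply: le_trans (lee_wpmul2l _ (hD m)); last by rewrite lee_fin.
rewrite -ge0_integralZl_EFin//; last 2 first.
- by move=> x _; exact: kernel_majorant_ge0.
- exact: measurable_kernel_majorant.
apply: ge0_le_integral => //.
- by move=> Y _; apply: integral_ge0 => t _; rewrite lee_fin middle_kernel_ge0.
- apply: (measurable_fun_fubini_tonelli_F (fun z : plane R => (middle_kernel m c z.1 z.2)%:E)) => //.
  + by apply/measurable_EFinP; exact: measurable_middle_kernel.
  + by move=> z; rewrite lee_fin middle_kernel_ge0.
- by apply: measurable_funeM; exact: measurable_kernel_majorant.
Qed.
End MiddleKernel.

(** * The symmetric kernel *)

Section SymmetricKernel.
Context {R : realType}.
Notation mu := (@lebesgue_measure R).
Implicit Types m c a b x z w : R.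
Variables (nu q k : R).
Hypotheses (nu01 : 0 <= nu < 1) (q1 : 1 < q) (k0 : k != 0).

(** With u = (x + z) / 2 and v = (x - z) / 2, the moduli of x and z are the sum
    and the distance of |u| and |v|. *)
Lemma middle_geometry x z w : `|x| <= `|w| <= `|z| \/ `|z| <= `|w| <= `|x| ->
  `| `|w| - `|x + z| / 2 | <= `|(x - z) / 2| /\
  Num.max `|x| `|z| <= `|x + z| / 2 + `|(x - z) / 2|.
Proof.
move=> h.
have e1 : `|(x + z) / 2| = `|x + z| / 2 by rewrite normrM (@ger0_norm _ 2^-1)// invr_ge0.
rewrite -e1; set u := (x + z) / 2; set v := (x - z) / 2.
have [xE zE] : x = u + v /\ z = u - v by rewrite /u /v; split; lra.
have hx1 : `|x| <= `|u| + `|v| by rewrite xE; exact: ler_normD.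
have hz1 : `|z| <= `|u| + `|v| by rewrite zE; exact: ler_normB.
have hx2 : `|u| <= `|x| + `|v| by rewrite (_ : u = x - v) ?ler_normB// xE addrK.
have hz2 : `|u| <= `|z| + `|v| by rewrite (_ : u = z + v) ?ler_normD// zE subrK.
split; last by rewrite ge_max hx1 hz1.
by rewrite ler_norml; case: h => /andP[h1 h2]; apply/andP; split; lra.
Qed.

Definition largest m a b := Num.max `|a| (Num.max `|b| `|m - a - b|).

Definition symmetric_kernel m c a b : R :=
  bracket (largest m a b) `^ nu * bracket (c + k * ((a + b) * (m - a) * (m - b))) `^ (- q).

(** The kernel is symmetric in a, b and d = m - a - b. Whichever of them has
    middle modulus plays the role of w, and the other two supply Y and t. *)
Lemma symmetric_kernel_le m c a b : symmetric_kernel m c a b <=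
  middle_kernel nu q k m c (m - b) (a - (m - b) / 2) +
  middle_kernel nu q k m c (m - a) (b - (m - a) / 2) +
  middle_kernel nu q k m c (a + b) ((a - b) / 2).
Proof.
have K0 Y t := @middle_kernel_ge0 R nu q k m c Y t.
have single x z w Y t : Y = x + z -> t = (x - z) / 2 -> m - Y = w ->
   `|x| <= `|w| <= `|z| \/ `|z| <= `|w| <= `|x| ->
   largest m a b = Num.max `|x| `|z| ->
   (a + b) * (m - a) * (m - b) = Y * ((m - Y / 2) ^+ 2 - t ^+ 2) ->
   symmetric_kernel m c a b <= middle_kernel nu q k m c Y t.
  move=> EY Et Ew hw hl hH.
  have [g1 g2] := middle_geometry hw.
  rewrite /middle_kernel Ew {1}EY {1}Et g1 /symmetric_kernel -(mulrA k Y) -hH.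
  apply: ler_wpM2r; first exact: powR_ge0.
  have [nu0 _] := andP nu01.
  apply: ge0_ler_powR => //; rewrite ?nnegrE; [exact/ltW/bracket_gt0 | exact/ltW/bracket_gt0|].
  have M0 : 0 <= largest m a b by rewrite hl le_max normr_ge0.
  rewrite /bracket lerD2l (ger0_norm M0) hl EY Et (@ger0_norm _ (_ + _))//.
set T1 := middle_kernel nu q k m c (m - b) (a - (m - b) / 2).
set T2 := middle_kernel nu q k m c (m - a) (b - (m - a) / 2).
set T3 := middle_kernel nu q k m c (a + b) ((a - b) / 2).
have [t1 t2 t3] : [/\ 0 <= T1, 0 <= T2 & 0 <= T3] by split; exact: K0.
have H1 : symmetric_kernel m c a b <= T1 -> symmetric_kernel m c a b <= T1 + T2 + T3.
  by move=> h; lra.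
have H2 : symmetric_kernel m c a b <= T2 -> symmetric_kernel m c a b <= T1 + T2 + T3.
  by move=> h; lra.
have H3 : symmetric_kernel m c a b <= T3 -> symmetric_kernel m c a b <= T1 + T2 + T3.
  by move=> h; lra.
set d := m - a - b.
have G1 (h : `|a| <= `|b| <= `|d| \/ `|d| <= `|b| <= `|a|) (hl : largest m a b = Num.max `|a| `|d|) :=
   H1 (single a d b (m - b) (a - (m - b) / 2) ltac:(rewrite /d; ring) ltac:(by rewrite /d; field)
    ltac:(ring) h hl ltac:(by field)).
have G2 (h : `|b| <= `|a| <= `|d| \/ `|d| <= `|a| <= `|b|) (hl : largest m a b = Num.max `|b| `|d|) :=
   H2 (single b d a (m - a) (b - (m - a) / 2) ltac:(rewrite /d; ring) ltac:(by rewrite /d; field)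
    ltac:(ring) h hl ltac:(by field)).
have G3 (h : `|a| <= `|d| <= `|b| \/ `|b| <= `|d| <= `|a|) (hl : largest m a b = Num.max `|a| `|b|) :=
   H3 (single a b d (a + b) ((a - b) / 2) erefl erefl ltac:(rewrite /d; ring) h hl ltac:(by field)).
have [ab|/ltW ab] := leP `|a| `|b|; have [bd|/ltW bd] := leP `|b| `|d|; have [ad|/ltW ad] := leP `|a| `|d|.
- by refine (G1 (or_introl (introT andP (conj ab bd))) _); rewrite /largest -/d (max_r bd).
- by refine (G1 (or_introl (introT andP (conj ab bd))) _); rewrite /largest -/d (max_r bd).
- by refine (G3 (or_introl (introT andP (conj ad bd))) _); rewrite /largest -/d (max_l bd).
- by refine (G2 (or_intror (introT andP (conj ad ab))) _); rewrite /largest -/d (max_l bd) (max_r ab).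
- by refine (G2 (or_introl (introT andP (conj ab ad))) _); rewrite /largest -/d (max_r bd) (max_r ad).
- by refine (G3 (or_intror (introT andP (conj bd ad))) _); rewrite /largest -/d (max_r bd) (max_l ad) (max_l ab).
- by refine (G1 (or_intror (introT andP (conj bd ab))) _); rewrite /largest -/d (max_l bd) (max_l ab) (max_l (le_trans bd ab)).
- by refine (G1 (or_intror (introT andP (conj bd ab))) _); rewrite /largest -/d (max_l bd) (max_l ab) (max_l ad).
Qed.

Local Open Scope ereal_scope.

Lemma measurable_symmetric_kernel d (T : measurableType d) m c (f g : T -> R) :
  measurable_fun setT f -> measurable_fun setT g ->
  measurable_fun setT (fun u => symmetric_kernel m c (f u) (g u)).
Proof.
move=> mf mg; apply: measurable_funM; apply: measurable_bracket_powR.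
  apply: measurable_maxr; first exact: measurable_normr_comp.
  apply: measurable_maxr; first exact: measurable_normr_comp.
  by apply: measurable_normr_comp; apply: measurable_funB => //; exact: measurable_funB.
apply: measurable_funD => //; apply: measurable_funM => //; apply: measurable_funM.
  by apply: measurable_funM; [exact: measurable_funD|exact: measurable_funB].
exact: measurable_funB.
Qed.

(** Each of the three substitutions (a, b) |-> (Y, t) is a composition of
    reflections and shears of determinant of modulus 1, so Tonelli and
    translation invariance in one variable at a time suffice. *)
Lemma iterated_symmetric_kernel : exists2 C : R, (0 <= C)%R & forall m c,
  \int[mu]_a \int[mu]_b (symmetric_kernel m c a b)%:E <= C%:E.
Proof.
have [C C0 hC] := iterated_middle_kernel nu01 q1 k0.
exists (C + C + C)%R; first by rewrite !addr_ge0.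
move=> m c.
pose T Y t := (middle_kernel nu q k m c Y t)%:E.
have T0 Y t : 0 <= T Y t by rewrite lee_fin middle_kernel_ge0.
have mT d (X : measurableType d) (f g : X -> R) :
    measurable_fun setT f -> measurable_fun setT g ->
    measurable_fun setT (fun u => T (f u) (g u)).
  by move=> mf mg; apply/measurable_EFinP; exact: measurable_middle_kernel.
have hT : \int[mu]_Y \int[mu]_t T Y t <= C%:E by exact: hC.
have hS a b : (symmetric_kernel m c a b)%:E <=
    T (m - b)%R (a - (m - b) / 2)%R + T (m - a)%R (b - (m - a) / 2)%R +
    T (a + b)%R ((a - b) / 2)%R.
  by rewrite /T -!EFinD lee_fin; exact: symmetric_kernel_le.
clearbody T.
have iT0 : measurable_fun [set: R] (fun Y => \int[mu]_t T Y t).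
  by apply: (measurable_fun_fubini_tonelli_F (fun z : plane R => T z.1 z.2)) => //; exact: mT.
have iT00 Y : 0 <= \int[mu]_t T Y t by exact: integral_ge0.
have m1 : measurable_fun [set: plane R] (fun z : plane R => T (m - z.2)%R (z.1 - (m - z.2) / 2)%R).
  apply: mT; first exact: measurable_funB.
  apply: measurable_funB => //; apply: measurable_funM => //; exact: measurable_funB.
have m2 : measurable_fun [set: plane R] (fun z : plane R => T (m - z.1)%R (z.2 - (m - z.1) / 2)%R).
  apply: mT; first exact: measurable_funB.
  apply: measurable_funB => //; apply: measurable_funM => //; exact: measurable_funB.
have m3 : measurable_fun [set: plane R] (fun z : plane R => T (z.1 + z.2)%R ((z.1 - z.2) / 2)%R).
  apply: mT; first exact: measurable_funD.
  apply: measurable_funM => //; exact: measurable_funB.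
have i2 : \int[mu]_a \int[mu]_b T (m - a)%R (b - (m - a) / 2)%R <= C%:E.
  under eq_integral => a _.
    rewrite (ge0_integral_shift (f := fun t => T (m - a)%R t) (- ((m - a) / 2))%R)//; last first.
      by apply: (mT _ _ (fun=> _) id).
    over.
  by rewrite (ge0_integral_reflect (f := fun Y => \int[mu]_t T Y t) m)//; exact: hC.
have i1 : \int[mu]_a \int[mu]_b T (m - b)%R (a - (m - b) / 2)%R <= C%:E.
  by rewrite (fubini_tonelli (fun z : plane R => T (m - z.2)%R (z.1 - (m - z.2) / 2)%R)).
have i3 : \int[mu]_a \int[mu]_b T (a + b)%R ((a - b) / 2)%R <= C%:E.
  have mm : measurable_fun [set: plane R] (fun z : plane R => T z.2 (z.1 - z.2 / 2)%R).
    apply: mT => //; apply: measurable_funB => //; exact: measurable_funM.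
  have -> : \int[mu]_a \int[mu]_b T (a + b)%R ((a - b) / 2)%R = \int[mu]_a \int[mu]_Y T Y (a - Y / 2)%R.
    apply: eq_integral => a _.
    rewrite -(ge0_integral_shift (f := fun Y => T Y (a - Y / 2)%R) a)//.
      apply: eq_integral => b _; congr T; first by rewrite addrC.
      by field.
    apply: mT => //; apply: measurable_funB => //; exact: measurable_funM.
  have F3 := fubini_tonelli (fun z : plane R => T z.2 (z.1 - z.2 / 2)%R) mm (fun=> T0 _ _).
  rewrite /= in F3; rewrite F3 {F3}.
  under eq_integral => Y _.
    rewrite (ge0_integral_shift (f := fun t => T Y t) (- (Y / 2))%R)//; last first.
      by apply: (mT _ _ (fun=> _) id).
    over.
  exact: hT.
have FM (f : plane R -> \bar R) : measurable_fun [set: plane R] f -> (forall u, 0 <= f u) ->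
    measurable_fun [set: R] (fun a => \int[mu]_b f (a, b)).
  by move=> mf f0; exact: (measurable_fun_fubini_tonelli_F f).
have sec (f : plane R -> \bar R) (a : R) : measurable_fun [set: plane R] f -> measurable_fun [set: R] (fun b => f (a, b)).
  by move=> mf; apply: (measurableT_comp mf); exact: pair1_measurable.
have s1 a := sec _ a m1; have s2 a := sec _ a m2; have s3 a := sec _ a m3.
rewrite !EFinD; apply: le_trans (leeD (leeD i1 i2) i3).
rewrite -ge0_integralD//; last 4 first.
- by move=> a _; exact: integral_ge0.
- exact: (FM _ m1).
- by move=> a _; exact: integral_ge0.
- exact: (FM _ m2).
rewrite -ge0_integralD//; last 4 first.
- by move=> a _; rewrite adde_ge0// integral_ge0.
- by apply: emeasurable_funD; [exact: (FM _ m1)|exact: (FM _ m2)].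
- by move=> a _; exact: integral_ge0.
- exact: (FM _ m3).
have mS : measurable_fun [set: plane R] (fun z : plane R => (symmetric_kernel m c z.1 z.2)%:E).
  by apply/measurable_EFinP; exact: measurable_symmetric_kernel.
have S0 a b : 0 <= (symmetric_kernel m c a b)%:E by rewrite lee_fin mulr_ge0// powR_ge0.
apply: ge0_le_integral => //.
- by move=> a _; exact: integral_ge0.
- exact: (FM _ mS).
- apply: emeasurable_funD; last exact: (FM _ m3).
  by apply: emeasurable_funD; [exact: (FM _ m1)|exact: (FM _ m2)].
move=> a _.
rewrite -ge0_integralD//; last 2 first.
- exact: s1.
- exact: s2.
rewrite -ge0_integralD//; last 3 first.
- by move=> b _; rewrite adde_ge0.
- by apply: emeasurable_funD; [exact: s1|exact: s2].
- exact: s3.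
apply: ge0_le_integral => //.
- exact: (sec _ a mS).
- apply: emeasurable_funD; last exact: s3.
  by apply: emeasurable_funD; [exact: s1|exact: s2].
Qed.
End SymmetricKernel.

(** * Resonance against derivatives *)

Section ResonanceGain.
Context {R : realType}.
Implicit Types m c a b d k : R.

(** If |a| <= 4 |m| then < a > < b > < d > is already at most 4 < m > < a > ^ 2. Otherwise
    b + d = m - a and a + d = m - b have size comparable to a, while
    z = |a + b| is at most 2 |a| and
    < d > <= < m > < z >; hence |H| >= (3/128) z ^ 3 pays for < z > ^ 3, and
    172 exceeds 4 * 128 / 3, the 4 coming from (1 + z) ^ 3 <= 4 (1 + z ^ 3). *)
Lemma resonance_gain_sorted m a b d : m = a + b + d -> `|d| <= `|b| <= `|a| ->
  (bracket a * bracket b * bracket d) ^+ 3 <=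
  172 * (bracket m ^+ 3 * bracket a ^+ 6 * bracket ((a + b) * (b + d) * (a + d))).
Proof.
move=> mE /andP[db ba].
have A1 := bracket_ge1 a; have B1 := bracket_ge1 b; have D1 := bracket_ge1 d.
have M1 := bracket_ge1 m; have H1 := bracket_ge1 ((a + b) * (b + d) * (a + d)).
have BA : bracket b <= bracket a by rewrite /bracket lerD2l.
have DA : bracket d <= bracket a by rewrite /bracket lerD2l (le_trans db).
have [h|h] := leP `|a| (4 * `|m|).
  have AM : bracket a <= 4 * bracket m by rewrite /bracket; lra.
  have h1 : bracket a * bracket b * bracket d <= 4 * bracket m * bracket a ^+ 2.
    rewrite expr2 -mulrA; apply: ler_pM => //; rewrite ?mulr_ge0; try lra.
    by apply: ler_pM => //; lra.
  apply: (@le_trans _ _ ((4 * bracket m * bracket a ^+ 2) ^+ 3)).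
    by rewrite lerXn2r ?nnegrE ?mulr_ge0 ?exprn_ge0//; lra.
  rewrite (_ : _ ^+ 3 = 64 * (bracket m ^+ 3 * bracket a ^+ 6)); last by ring.
  have X0 : 0 <= bracket m ^+ 3 * bracket a ^+ 6 by rewrite mulr_ge0// exprn_ge0; lra.
  move: (_ * bracket a ^+ 6) X0 => X X0.
  have := ler_wpM2l X0 H1; lra.
have dE : d = m + - (a + b) by rewrite mE; ring.
have DM : bracket d <= bracket m * bracket (a + b).
  by rewrite {1}dE; apply: le_trans (bracketD _ _) _; rewrite bracketN.
set z := `|a + b|.
have z0 : 0 <= z by exact: normr_ge0.
have za : z <= 2 * `|a| by apply: le_trans (ler_normD _ _) _; lra.
have hX : 3 / 4 * `|a| <= `|b + d|.
  have : `|a| <= `|m| + `|b + d|.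
    by apply: le_trans (ler_normB _ _); rewrite (_ : m - (b + d) = a)// mE; ring.
  by lra.
have hb : 3 / 8 * `|a| <= `|b| by have := ler_normD b d; lra.
have hY : `|a| / 8 <= `|a + d|.
  have : `|b| <= `|m| + `|a + d|.
    by apply: le_trans (ler_normB _ _); rewrite (_ : m - (a + d) = b)// mE; ring.
  by lra.
have hH : 3 / 128 * z ^+ 3 <= `|(a + b) * (b + d) * (a + d)|.
  rewrite !normrM -/z (_ : 3 / 128 * z ^+ 3 = z * (3 / 8 * z) * (z / 16)); last by field.
  apply: ler_pM; rewrite ?mulr_ge0//; try lra.
  by apply: ler_wpM2l => //; lra.
have hZ : bracket (a + b) ^+ 3 <= 172 * bracket ((a + b) * (b + d) * (a + d)).
  move: hH; rewrite /bracket -/z; move: (`|_ * _ * _|) => H hH.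
  have z3 : 0 <= z ^+ 3 by exact: exprn_ge0.
  apply: (@le_trans _ _ (4 * (1 + z ^+ 3))); last by lra.
  rewrite -subr_ge0 (_ : _ - _ = 3 * (1 + z) * (z - 1) ^+ 2); last by ring.
  by rewrite mulr_ge0 ?sqr_ge0// mulr_ge0//; lra.
have h1 : bracket a * bracket b * bracket d <= bracket a ^+ 2 * (bracket m * bracket (a + b)).
  apply: ler_pM => //; rewrite ?mulr_ge0; try lra.
  by rewrite expr2; apply: ler_wpM2l => //; lra.
apply: (@le_trans _ _ ((bracket a ^+ 2 * (bracket m * bracket (a + b))) ^+ 3)).
  have Z1 := bracket_ge1 (a + b).
  by rewrite lerXn2r ?nnegrE ?mulr_ge0 ?exprn_ge0//; lra.
rewrite (_ : _ ^+ 3 = bracket a ^+ 6 * (bracket m ^+ 3 * bracket (a + b) ^+ 3)); last by ring.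
rewrite (_ : 172 * _ = bracket a ^+ 6 * (bracket m ^+ 3 * (172 * bracket ((a + b) * (b + d) * (a + d))))); last by ring.
apply: ler_wpM2l; first by rewrite exprn_ge0//; lra.
by apply: ler_wpM2l; first by rewrite exprn_ge0//; lra.
Qed.

Lemma resonance_gain m a b :
  (bracket a * bracket b * bracket (m - a - b)) ^+ 3 <=
  172 * (bracket m ^+ 3 * bracket (largest m a b) ^+ 6 *
         bracket ((a + b) * (m - a) * (m - b))).
Proof.
set d := m - a - b.
have sorted x y w : m = x + y + w -> `|w| <= `|y| <= `|x| ->
    largest m a b = `|x| ->
    bracket a * bracket b * bracket d = bracket x * bracket y * bracket w ->
    (a + b) * (m - a) * (m - b) = (x + y) * (y + w) * (x + w) ->
    (bracket a * bracket b * bracket d) ^+ 3 <=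
    172 * (bracket m ^+ 3 * bracket (largest m a b) ^+ 6 *
         bracket ((a + b) * (m - a) * (m - b))).
  move=> mE hs hl hp hH; rewrite hp hH hl.
  have -> : bracket `|x| = bracket x by rewrite /bracket normr_id.
  exact: resonance_gain_sorted.
have mE : m = a + b + d by rewrite /d; ring.
have lE : largest m a b = Num.max `|a| (Num.max `|b| `|d|) by [].
have HE : (a + b) * (m - a) * (m - b) = (a + b) * (b + d) * (a + d) by rewrite /d; ring.
have [ab|/ltW ab] := leP `|a| `|b|; have [bd|/ltW bd] := leP `|b| `|d|; have [ad|/ltW ad] := leP `|a| `|d|.
- by apply: (sorted d b a); rewrite ?ab ?bd ?HE ?lE ?(max_r bd) ?(max_r ad)//; [rewrite mE| |]; ring.
- by apply: (sorted d b a); rewrite ?ab ?bd ?HE ?lE ?(max_r bd) ?(max_r (le_trans ab bd))//; [rewrite mE| |]; ring.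
- by apply: (sorted b d a); rewrite ?ad ?bd ?HE ?lE ?(max_l bd) ?(max_r ab)//; [rewrite mE| |]; ring.
- by apply: (sorted b a d); rewrite ?ab ?ad ?HE ?lE ?(max_l bd) ?(max_r ab)//; [rewrite mE| |]; ring.
- by apply: (sorted d a b); rewrite ?ab ?ad ?HE ?lE ?(max_r bd) ?(max_r ad)//; [rewrite mE| |]; ring.
- by apply: (sorted a d b); rewrite ?bd ?ad ?HE ?lE ?(max_r bd) ?(max_l ad)//; [rewrite mE| |]; ring.
- by apply: (sorted a b d); rewrite ?bd ?ab ?HE ?lE ?(max_l bd) ?(max_l ab)//.
- by apply: (sorted a b d); rewrite ?bd ?ab ?HE ?lE ?(max_l bd) ?(max_l ab)//.
Qed.

Lemma bracket_scale k x : k != 0 -> bracket x <= (1 + `|k|^-1) * bracket (k * x).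
Proof.
move=> k0; rewrite /bracket normrM.
have kp : 0 < `|k| by rewrite normr_gt0.
rewrite (_ : _ * _ = 1 + `|x| + (`|k|^-1 + `|k| * `|x|)); last by field; rewrite gt_eqF.
by rewrite lerDl addr_ge0 ?mulr_ge0// invr_ge0 ltW.
Qed.

(** The gain is used with exponent 2 sig / 3 <= 1/6. The factor < m > ^ (2 sig) it
    costs is cancelled by the output weight, < M > ^ (4 sig) is kept, and the resonance is
    split by < k H > <= < c > < c + k H > into one sixth of a power of < c >, which
    gam pays for, and one sixth of a power taken from p. *)
Lemma weighted_kernel_le (sig gam p k : R) : 0 <= sig <= 1 / 4 -> 1 / 6 <= gam ->
  k != 0 -> exists2 C : R, 0 <= C & forall m c a b,
  bracket m `^ (- (2 * sig)) * bracket c `^ (- gam) *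
  ((bracket a * bracket b * bracket (m - a - b)) `^ (2 * sig) *
  bracket (c + k * ((a + b) * (m - a) * (m - b))) `^ (- p)) <=
  C * symmetric_kernel (4 * sig) (p - 1 / 6) k m c a b.
Proof.
move=> /andP[s0 s1] g1 k0.
pose A := 172 * (1 + `|k|^-1).
have A0 : 0 <= A by rewrite mulr_ge0// addr_ge0.
exists (A `^ (2 * sig / 3)); first exact: powR_ge0.
move=> m c a b; rewrite /symmetric_kernel.
set H := (a + b) * (m - a) * (m - b).
set M := largest m a b; set P := bracket a * bracket b * bracket (m - a - b).
have P0 : 0 <= P by rewrite !mulr_ge0// ltW ?bracket_gt0.
have m0 := bracket_gt0 m; have M0 := bracket_gt0 M; have c0 := bracket_gt0 c.
have H0 := bracket_gt0 (k * H); have cH0 := bracket_gt0 (c + k * H).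
have hP : P ^+ 3 <= A * (bracket m ^+ 3 * bracket M ^+ 6 * bracket (k * H)).
  apply: le_trans (resonance_gain m a b) _; rewrite -/M -/H /A -(mulrA 172).
  apply: ler_wpM2l => //; rewrite [leRHS]mulrCA; apply: ler_wpM2l; last exact: bracket_scale.
  by rewrite mulr_ge0// exprn_ge0// ltW.
have e0 : 0 <= 2 * sig / 3 by lra.
have hP2 : P `^ (2 * sig) <= A `^ (2 * sig / 3) *
   (bracket m `^ (2 * sig) * bracket M `^ (4 * sig) * bracket (k * H) `^ (2 * sig / 3)).
  have cube x y n : 0 <= x -> n%:R * (2 * sig / 3) = y -> x `^ y = (x ^+ n) `^ (2 * sig / 3).
    by move=> x0 <-; rewrite powRrM powR_mulrn.
  rewrite (cube P _ 3%N)//; last by field.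
  rewrite (cube (bracket m) _ 3%N) ?(ltW m0)//; last by field.
  rewrite (cube (bracket M) _ 6%N) ?(ltW M0)//; last by field.
  have a1 : 0 <= bracket m ^+ 3 by exact/exprn_ge0/ltW.
  have a2 : 0 <= bracket M ^+ 6 by exact/exprn_ge0/ltW.
  have a3 : 0 <= bracket (k * H) by exact: ltW.
  have a12 : 0 <= bracket m ^+ 3 * bracket M ^+ 6 by exact: mulr_ge0.
  have a123 : 0 <= bracket m ^+ 3 * bracket M ^+ 6 * bracket (k * H) by exact: mulr_ge0.
  rewrite -(powRM _ a1 a2) -(powRM _ a12 a3) -(powRM _ A0 a123).
  apply: ge0_ler_powR => //; rewrite nnegrE; [exact: exprn_ge0 | exact: mulr_ge0].
have hH : bracket (k * H) `^ (2 * sig / 3) <= bracket c `^ (1 / 6) * bracket (c + k * H) `^ (1 / 6).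
  apply: (@le_trans _ _ (bracket (k * H) `^ (1 / 6))).
    by apply: ler_powR; [exact: bracket_ge1 | lra].
  rewrite -(powRM _ (ltW c0) (ltW cH0)).
  apply: ge0_ler_powR => //; rewrite ?nnegrE; [exact: ltW | by rewrite mulr_ge0 // ltW | ].
  have := bracketD (- c) (c + k * H); rewrite bracketN (_ : - c + (c + k * H) = k * H)//; ring.
have hc : bracket c `^ (- gam) <= bracket c `^ (- (1 / 6)).
  by apply: ler_powR; [exact: bracket_ge1 | lra].
rewrite (@powR_split R _ (- p) (- (p - 1 / 6)) (- (1 / 6)))//; last by ring.
rewrite !(powRN _ (2 * sig)) !(powRN _ (1 / 6)) in hc *.
have : 0 < bracket (c + k * H) `^ (1 / 6) by exact: powR_gt0.
have : 0 < bracket c `^ (1 / 6) by exact: powR_gt0.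
have : 0 < bracket m `^ (2 * sig) by exact: powR_gt0.
have : 0 <= bracket (c + k * H) `^ (- (p - 1 / 6)) by exact: powR_ge0.
have : 0 <= bracket M `^ (4 * sig) by exact: powR_ge0.
have : 0 <= A `^ (2 * sig / 3) by exact: powR_ge0.
have := powR_ge0 P (2 * sig); have := powR_ge0 (bracket c) (- gam).
move: hP2 hH hc.
move: (P `^ _) (bracket c `^ (- gam)) (A `^ _) (bracket M `^ _)
  (bracket (c + k * H) `^ (- _)) (bracket m `^ _) (bracket c `^ _)
  (bracket (c + k * H) `^ _) (bracket (k * H) `^ _).
move=> P' c' A' M' G x y w h hP2 hH hc c'0 P'0 A'0 M'0 G0 x0 y0 w0.
have -> : A' * (M' * G) = x^-1 * y^-1 * (A' * (x * M' * (y * w)) * (G * w^-1)).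
  by field; rewrite !gt_eqF.
have i0 u : 0 < u -> 0 <= u^-1 :> R by move=> u0; rewrite invr_ge0 ltW.
apply: ler_pM; rewrite ?mulr_ge0 ?i0//.
  by apply: ler_wpM2l => //; exact: i0.
apply: ler_wpM2r; first by rewrite mulr_ge0 ?i0.
apply: (le_trans hP2); apply: ler_wpM2l => //; apply: ler_wpM2l => //.
by rewrite mulr_ge0// ltW.
Qed.
End ResonanceGain.

(** * The kernel in the space frequencies *)

Section FrequencyKernel.
Context {R : realType}.
Notation mu := (@lebesgue_measure R).
Variables (alpha beta sig p gam : R).
Hypotheses (beta0 : beta != 0) (sig01 : 0 <= sig < 1 / 4)
  (p1 : 7 / 6 < p) (gam1 : 1 / 6 <= gam).

Notation phi := (phase alpha beta).

(** Up to affine functions, the phase is beta (x + kap) ^ 3, and the phase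
    - phi(- x) of a conjugated function is beta (x - kap) ^ 3. The affine parts
    cancel in the resonance, which for pure cubes factors as
    (a + b + d) ^ 3 - a ^ 3 - b ^ 3 - d ^ 3 = 3 (a + b) (b + d) (a + d), with
    d = x3 - kap. *)
Lemma resonance_identity (kap x1 x2 x3 : R) : 3 * beta * kap = alpha ->
  phi (x1 + x2 + x3) - phi x1 - phi x2 + phi (- x3) =
  3 * beta * (((x1 + kap) + (x2 + kap)) *
    ((x1 + x2 + x3 + kap) - (x1 + kap)) * ((x1 + x2 + x3 + kap) - (x2 + kap))).
Proof. by move=> <-; rewrite /phase; ring. Qed.

Definition frequency_kernel (x t x1 x2 : R) : R :=
  bracket x `^ (- (2 * sig)) * bracket (t - phi x) `^ (- gam) *
  ((bracket x1 * bracket x2 * bracket (x - x1 - x2)) `^ (2 * sig) *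
   bracket (t - phi x1 - phi x2 + phi (- (x - x1 - x2))) `^ (- p)).

Lemma frequency_kernel_ge0 x t x1 x2 : 0 <= frequency_kernel x t x1 x2.
Proof. by rewrite /frequency_kernel !mulr_ge0// powR_ge0. Qed.

Lemma measurable_phase d (T : measurableType d) (f : T -> R) :
  measurable_fun setT f -> measurable_fun setT (fun u => phi (f u)).
Proof.
by move=> mf; apply: measurable_funD; apply: measurable_funM => //; exact: measurable_funX.
Qed.

Lemma measurable_frequency_kernel d (T : measurableType d) x t (f g : T -> R) :
  measurable_fun setT f -> measurable_fun setT g ->
  measurable_fun setT (fun u => frequency_kernel x t (f u) (g u)).
Proof.
move=> mf mg.
have mbr (h : T -> R) : measurable_fun setT h -> measurable_fun setT (fun u => bracket (h u)).
  by move=> mh; apply: measurable_funD => //; exact: measurable_normr_comp.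
have m3 : measurable_fun setT (fun u => x - f u - g u).
  by apply: measurable_funB => //; exact: measurable_funB.
apply: measurable_funM => //; apply: measurable_funM.
  apply: (measurableT_comp (f := fun u : R => u `^ (2 * sig))); first exact: measurable_powR.
  apply: measurable_funM; last exact: mbr.
  by apply: measurable_funM; exact: mbr.
apply: measurable_bracket_powR; apply: measurable_funD; last first.
  by apply: measurable_phase; exact: measurableT_comp.
by apply: measurable_funB; [apply: measurable_funB => //|]; exact: measurable_phase.
Qed.

Local Open Scope ereal_scope.

(** In the shifted frequencies this is [weighted_kernel_le] followed by
    [iterated_symmetric_kernel]; the shift changes each bracket by a factor of
    at most < kap >. *)
Lemma iterated_frequency_kernel : exists2 C : R, (0 <= C)%R & forall x t : R,
  \int[mu]_x1 \int[mu]_x2 (frequency_kernel x t x1 x2)%:E <= C%:E.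
Proof.
have [s0 s1] := andP sig01.
pose k := (3 * beta)%R; have k0 : (k != 0)%R by rewrite mulf_neq0// pnatr_eq0.
pose kap := (alpha / k)%R.
have kapE : (3 * beta * kap = alpha)%R by rewrite /kap mulrC divfK.
have sig14 : (0 <= sig <= 1 / 4)%R by rewrite s0 ltW.
have [C1 C10 hC1] := weighted_kernel_le p sig14 gam1 k0.
have nu01 : (0 <= 4 * sig < 1)%R by apply/andP; split; lra.
have q1 : (1 < p - 1 / 6)%R by have := p1; lra.
have [C2 C20 hC2] := iterated_symmetric_kernel nu01 q1 k0.
pose B := (bracket kap `^ (2 * sig))%R.
have B0 : (0 <= B)%R by exact: powR_ge0.
pose C := (B * (B * B * B) * C1)%R.
have C0 : (0 <= C)%R by rewrite !mulr_ge0.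
have s20 : (0 <= 2 * sig)%R by rewrite mulr_ge0.
exists (C * C2)%R; first by rewrite mulr_ge0.
move=> x t.
pose m := (x + kap)%R; pose c := (t - phi x)%R.
pose S (x1 x2 : R) := (symmetric_kernel (4 * sig) (p - 1 / 6) k m c (x1 + kap) (x2 + kap))%:E.
have S0 x1 x2 : 0 <= S x1 x2 by rewrite lee_fin mulr_ge0// powR_ge0.
have le x1 x2 : (frequency_kernel x t x1 x2)%:E <= C%:E * S x1 x2.
  rewrite /S -EFinM lee_fin.
  have br (u v : R) : (bracket (u + v) `^ (2 * sig) <= bracket v `^ (2 * sig) * bracket u `^ (2 * sig))%R.
    rewrite -powRM ?(ltW (bracket_gt0 _))//; apply: ge0_ler_powR; rewrite ?nnegrE ?mulr_ge0 ?(ltW (bracket_gt0 _))//; last by rewrite mulrC; exact: bracketD.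
  have h0 : (bracket x `^ (- (2 * sig)) <= B * bracket m `^ (- (2 * sig)))%R.
    have := br x kap; rewrite -/m -/B !(powRN _ (2 * sig)) => h.
    by rewrite ler_pdivlMr ?powR_gt0 ?bracket_gt0// mulrC ler_pdivrMr ?powR_gt0 ?bracket_gt0.
  have br' (u v : R) : (v = u + kap \/ v = u - kap)%R -> (bracket u `^ (2 * sig) <= B * bracket v `^ (2 * sig))%R.
    move=> [->|->].
      by have := br (u + kap)%R (- kap)%R; rewrite addrK bracketN.
    by have := br (u - kap)%R kap; rewrite subrK.
  have h1 : ((bracket x1 * bracket x2 * bracket (x - x1 - x2)) `^ (2 * sig) <=
     B * B * B * (bracket (x1 + kap) * bracket (x2 + kap) * bracket (m - (x1 + kap) - (x2 + kap))) `^ (2 * sig))%R.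
    have bb (u : R) : (0 <= bracket u)%R := ltW (bracket_gt0 u).
    rewrite !powRM ?mulr_ge0//.
    have e1 := br' x1 (x1 + kap)%R (or_introl erefl).
    have e2 := br' x2 (x2 + kap)%R (or_introl erefl).
    have e3 : (bracket (x - x1 - x2) `^ (2 * sig) <= B * bracket (m - (x1 + kap) - (x2 + kap)) `^ (2 * sig))%R.
      by apply: br'; right; rewrite /m; ring.
    rewrite (_ : B * B * B * _ = (B * bracket (x1 + kap) `^ (2 * sig)) * (B * bracket (x2 + kap) `^ (2 * sig)) *
      (B * bracket (m - (x1 + kap) - (x2 + kap)) `^ (2 * sig)))%R; last by ring.
    by apply: ler_pM; rewrite ?mulr_ge0 ?powR_ge0//; apply: ler_pM; rewrite ?powR_ge0.
  have hH : (t - phi x1 - phi x2 + phi (- (x - x1 - x2)) =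
     c + k * ((x1 + kap + (x2 + kap)) * (m - (x1 + kap)) * (m - (x2 + kap))))%R.
    have := resonance_identity x1 x2 (x - x1 - x2)%R kapE.
    rewrite (_ : x1 + x2 + (x - x1 - x2) = x)%R; last by ring.
    by rewrite -/m -/k => <-; rewrite /c; ring.
  rewrite /C -(mulrA (B * (B * B * B))%R); apply: (@le_trans _ _ (B * (B * B * B) * (bracket m `^ (- (2 * sig)) * bracket c `^ (- gam) *
   ((bracket (x1 + kap) * bracket (x2 + kap) * bracket (m - (x1 + kap) - (x2 + kap))) `^ (2 * sig) *
  bracket (c + k * ((x1 + kap + (x2 + kap)) * (m - (x1 + kap)) * (m - (x2 + kap)))) `^ (- p))))%R); last first.
    by apply: ler_wpM2l; [rewrite !mulr_ge0 | exact: hC1].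
  have prod_le (D X M' c' P P' H : R) : (X <= B * M' -> P <= D * P' -> 0 <= X -> 0 <= P -> 0 <= c' -> 0 <= H ->
      X * c' * (P * H) <= B * D * (M' * c' * (P' * H)))%R.
    move=> X1 P1 X0 P0 c0 H0.
    rewrite (_ : B * D * _ = (B * M' * c') * ((D * P') * H))%R; last by ring.
    by apply: ler_pM; rewrite ?mulr_ge0//; apply: ler_wpM2r.
  by rewrite /frequency_kernel hH -/c; apply: prod_le; rewrite ?powR_ge0.
have mS : measurable_fun [set: plane R] (fun z : plane R => S z.1 z.2).
  by apply/measurable_EFinP; apply: measurable_symmetric_kernel; exact: measurable_funD.
have mF : measurable_fun [set: plane R] (fun z : plane R => (frequency_kernel x t z.1 z.2)%:E).
  by apply/measurable_EFinP; exact: measurable_frequency_kernel.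
have F0 x1 x2 : 0 <= (frequency_kernel x t x1 x2)%:E.
  by rewrite lee_fin frequency_kernel_ge0.
have iS : \int[mu]_x1 \int[mu]_x2 S x1 x2 <= C2%:E.
  pose T a b := (symmetric_kernel (4 * sig) (p - 1 / 6) k m c a b)%:E.
  have mT a : measurable_fun [set: R] (T a) by apply/measurable_EFinP; exact: measurable_symmetric_kernel.
  have T0 a b : 0 <= T a b by rewrite lee_fin mulr_ge0// powR_ge0.
  have mT2 : measurable_fun [set: plane R] (fun z : plane R => T z.1 z.2).
    by apply/measurable_EFinP; exact: measurable_symmetric_kernel.
  have hT : \int[mu]_a \int[mu]_b T a b <= C2%:E by exact: hC2.
  have SE a b : S a b = T (a + kap)%R (b + kap)%R by [].
  clearbody T; clear mS; clearbody S.
  under eq_integral => x1 _.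
    under eq_integral => x2 _ do rewrite SE.
    rewrite (ge0_integral_shift (f := T (x1 + kap)%R) kap)//.
    over.
  rewrite (ge0_integral_shift (f := fun a => \int[mu]_b T a b) kap)//.
    exact: (measurable_fun_fubini_tonelli_F (fun z : plane R => T z.1 z.2)).
  by move=> a; exact: integral_ge0.
clearbody S.
have C0' : 0 <= C%:E by rewrite lee_fin.
rewrite EFinM; apply: le_trans (lee_wpmul2l C0' iS).
have mS1 x1 : measurable_fun [set: R] (S x1).
  exact: (measurableT_comp mS (pair1_measurable x1)).
rewrite -ge0_integralZl_EFin//; last 2 first.
- by move=> x1 _; exact: integral_ge0.
- exact: (measurable_fun_fubini_tonelli_F (fun z : plane R => S z.1 z.2)).
apply: ge0_le_integral => //.
- by move=> x1 _; exact: integral_ge0.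
- exact: (measurable_fun_fubini_tonelli_F (fun z : plane R => (frequency_kernel x t z.1 z.2)%:E)).
- apply: measurable_funeM.
  exact: (measurable_fun_fubini_tonelli_F (fun z : plane R => S z.1 z.2)).
move=> x1 _; rewrite -ge0_integralZl_EFin//; last exact: mS1.
apply: ge0_le_integral => //.
- exact: (measurableT_comp mF (pair1_measurable x1)).
- by apply: measurable_funeM; exact: mS1.
Qed.
End FrequencyKernel.

(** * The kernel in space-time frequencies *)

Section Lebesgue2.
Context {R : realType}.
Notation mu := (@lebesgue_measure R).
Local Open Scope ereal_scope.

Lemma integral_lebesgue2 (f : plane R -> \bar R) :
  measurable_fun [set: plane R] f -> (forall z, 0 <= f z) ->
  \int[lebesgue2]_z f z = \int[mu]_x \int[mu]_t f (x, t).
Proof. by move=> mf f0; exact: (fubini_tonelli1 f). Qed.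

Lemma measurable_partial_integral d d' (T : measurableType d) (T' : measurableType d')
  (m : {sigma_finite_measure set T' -> \bar R}) (f : T -> T' -> \bar R) :
  measurable_fun [set: T * T'] (fun z => f z.1 z.2) -> (forall x y, 0 <= f x y) ->
  measurable_fun [set: T] (fun x => \int[m]_y f x y).
Proof. by move=> mf f0; exact: (measurable_fun_fubini_tonelli_F (fun z => f z.1 z.2)). Qed.
Arguments measurable_partial_integral {d d' T T' m} f _ _.

End Lebesgue2.

Section SpacetimeKernel.
Context {R : realType}.
Notation mu := (@lebesgue_measure R).
Variables (alpha beta sig p gam : R).
Hypotheses (beta0 : beta != 0) (sig01 : 0 <= sig < 1 / 4)
  (p1 : 7 / 6 < p) (gam1 : 1 / 6 <= gam).

Notation phi := (phase alpha beta).

Definition weight (s b : R) (z : plane R) : R :=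
  bracket z.1 `^ s * bracket (z.2 - phi z.1) `^ b.

Lemma weight_gt0 s b z : 0 < weight s b z.
Proof. by rewrite mulr_gt0// powR_gt0// bracket_gt0. Qed.

Lemma weight_ge0 s b z : 0 <= weight s b z.
Proof. exact/ltW/weight_gt0. Qed.

Lemma measurable_weight d (T : measurableType d) (f g : T -> R) s b :
  measurable_fun setT f -> measurable_fun setT g ->
  measurable_fun setT (fun u => weight s b (f u, g u)).
Proof.
move=> mf mg; apply: measurable_funM; first exact: measurable_bracket_powR.
by apply: measurable_bracket_powR; apply: measurable_funB => //; exact: measurable_phase.
Qed.

(** The squared inverse input weights times the squared output weight, under the
    convolution constraint; the conjugated third function is weighted at the
    opposite frequency. *)
Definition spacetime_kernel (z y1 y2 : plane R) : R :=
  weight (- (2 * sig)) (- gam) z *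
  (weight (2 * sig) (- p) y1 * weight (2 * sig) (- p) y2 *
   weight (2 * sig) (- p) (- (z - y1 - y2))).

Lemma spacetime_kernel_ge0 z y1 y2 : 0 <= spacetime_kernel z y1 y2.
Proof.
exact: (mulr_ge0 (weight_ge0 _ _ _) (mulr_ge0 (mulr_ge0 (weight_ge0 _ _ _) (weight_ge0 _ _ _)) (weight_ge0 _ _ _))).
Qed.

Lemma measurable_spacetime_kernel d (T : measurableType d) x t (f1 f2 f3 f4 : T -> R) :
  measurable_fun setT f1 -> measurable_fun setT f2 ->
  measurable_fun setT f3 -> measurable_fun setT f4 ->
  measurable_fun setT (fun u => spacetime_kernel (x, t) (f1 u, f2 u) (f3 u, f4 u)).
Proof.
move=> m1 m2 m3 m4; apply: measurable_funM => //; apply: measurable_funM.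
  by apply: measurable_funM; exact: measurable_weight.
apply: measurable_weight.
  by apply: measurableT_comp => //; apply: measurable_funB => //; exact: measurable_funB.
by apply: measurableT_comp => //; apply: measurable_funB => //; exact: measurable_funB.
Qed.

(** The t2-dependent part is isolated in the shape integrated by
    [bracket_convolution]. *)
Lemma spacetime_kernelE x t x1 t1 x2 t2 :
  spacetime_kernel (x, t) (x1, t1) (x2, t2) =
  (weight (- (2 * sig)) (- gam) (x, t) *
   (bracket x1 `^ (2 * sig) * bracket x2 `^ (2 * sig) * bracket (x - x1 - x2) `^ (2 * sig)) *
   bracket (t1 - phi x1) `^ (- p)) *
  (bracket (t2 - phi x2) `^ (- p) *
   bracket (t - t1 + phi (- (x - x1 - x2)) - t2) `^ (- p)).
Proof.
rewrite /spacetime_kernel /weight /=.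
rewrite (_ : - (t - t1 - t2) - phi (- (x - x1 - x2)) =
             - (t - t1 + phi (- (x - x1 - x2)) - t2)); last by ring.
by rewrite !bracketN; ring.
Qed.

Local Open Scope ereal_scope.

(** Two applications of [bracket_convolution], in t2 and then in t1, leave the
    kernel in the space frequencies. In between, Tonelli brings the integral in
    t1 inside the one in x2. *)
Lemma integral_spacetime_kernel : exists2 C : R, (0 <= C)%R & forall z : plane R,
  \int[lebesgue2]_y1 \int[lebesgue2]_y2 (spacetime_kernel z y1 y2)%:E <= C%:E.
Proof.
have p1' : (1 < p)%R by have := p1; lra.
have [C1 C10 hC1] := bracket_convolution p1'.
have [C2 C20 hC2] := iterated_frequency_kernel alpha beta0 sig01 p1 gam1.
exists (C1 * C1 * C2)%R; first by rewrite !mulr_ge0.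
move=> [x t].
pose K x1 t1 x2 t2 := spacetime_kernel (x, t) (x1, t1) (x2, t2).
have K0 x1 t1 x2 t2 : (0 <= K x1 t1 x2 t2)%R by exact: spacetime_kernel_ge0.
have mK d (T : measurableType d) (f1 f2 f3 f4 : T -> R) :
  measurable_fun setT f1 -> measurable_fun setT f2 ->
  measurable_fun setT f3 -> measurable_fun setT f4 ->
  measurable_fun setT (fun u => (K (f1 u) (f2 u) (f3 u) (f4 u))%:E).
  by move=> *; apply/measurable_EFinP; exact: measurable_spacetime_kernel.
pose W x1 x2 := (weight (- (2 * sig)) (- gam) (x, t) *
   (bracket x1 `^ (2 * sig) * bracket x2 `^ (2 * sig) * bracket (x - x1 - x2) `^ (2 * sig)))%R.
have W0 x1 x2 : (0 <= W x1 x2)%R by rewrite !mulr_ge0 ?powR_ge0.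
(* [A] is what remains after integrating in t2; its t1-integral is again a
   convolution, centered at phi x1 and [b1]. *)
pose b1 x1 x2 := (t + phi (- (x - x1 - x2)) - phi x2)%R.
pose A x1 t1 x2 := (C1 * W x1 x2 * (bracket (t1 - phi x1) `^ (- p) * bracket (b1 x1 x2 - t1) `^ (- p)))%R.
have A0 x1 t1 x2 : (0 <= A x1 t1 x2)%R by rewrite !mulr_ge0 ?powR_ge0.
have mW d (T : measurableType d) (f1 f3 : T -> R) :
  measurable_fun setT f1 -> measurable_fun setT f3 ->
  measurable_fun setT (fun u => W (f1 u) (f3 u)).
  move=> m1 m3; apply: measurable_funM => //; apply: measurable_funM.
    by apply: measurable_funM; exact: measurable_bracket_powR.
  by apply: measurable_bracket_powR; apply: measurable_funB => //; exact: measurable_funB.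
have mb1 d (T : measurableType d) (f1 f3 : T -> R) :
  measurable_fun setT f1 -> measurable_fun setT f3 ->
  measurable_fun setT (fun u => b1 (f1 u) (f3 u)).
  move=> m1 m3; apply: measurable_funB; last exact: measurable_phase.
  apply: measurable_funD => //; apply: measurable_phase.
  by apply: measurableT_comp => //; apply: measurable_funB => //; exact: measurable_funB.
have mA d (T : measurableType d) (f1 f2 f3 : T -> R) :
  measurable_fun setT f1 -> measurable_fun setT f2 -> measurable_fun setT f3 ->
  measurable_fun setT (fun u => (A (f1 u) (f2 u) (f3 u))%:E).
  move=> m1 m2 m3; apply/measurable_EFinP; apply: measurable_funM.
    by apply: measurable_funM => //; exact: mW.
  apply: measurable_funM; apply: measurable_bracket_powR; apply: measurable_funB => //.
    exact: measurable_phase.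
  exact: mb1.
have s1 x1 t1 x2 : \int[mu]_t2 (K x1 t1 x2 t2)%:E <= (A x1 t1 x2)%:E.
  under eq_integral do rewrite /K spacetime_kernelE EFinM.
  rewrite ge0_integralZl_EFin//; last 3 first.
  - by move=> t2 _; rewrite lee_fin mulr_ge0 ?powR_ge0.
  - apply/measurable_EFinP; apply: measurable_funM; apply: measurable_bracket_powR; exact: measurable_funB.
  - by rewrite !mulr_ge0 ?powR_ge0.
  have h0 : 0 <= (weight (- (2 * sig)) (- gam) (x, t) *
   (bracket x1 `^ (2 * sig) * bracket x2 `^ (2 * sig) * bracket (x - x1 - x2) `^ (2 * sig)) *
   bracket (t1 - phi x1) `^ (- p))%R%:E by rewrite lee_fin !mulr_ge0 ?powR_ge0.
  apply: le_trans (lee_wpmul2l h0 (hC1 _ _)) _.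
  rewrite -EFinM lee_fin /A /W (_ : b1 x1 x2 - t1 = t - t1 + phi (- (x - x1 - x2)) - phi x2)%R; last by rewrite /b1; ring.
  by rewrite le_eqVlt; apply/orP; left; apply/eqP; ring.
have s2 x1 x2 : \int[mu]_t1 (A x1 t1 x2)%:E <= (C1 * C1)%:E * (frequency_kernel alpha beta sig p gam x t x1 x2)%:E.
  under eq_integral do rewrite EFinM.
  rewrite ge0_integralZl_EFin//; last 3 first.
  - by move=> t1 _; rewrite lee_fin mulr_ge0 ?powR_ge0.
  - apply/measurable_EFinP; apply: measurable_funM; apply: measurable_bracket_powR; exact: measurable_funB.
  - by rewrite !mulr_ge0 ?powR_ge0.
  have h0 : 0 <= (C1 * W x1 x2)%R%:E by rewrite lee_fin !mulr_ge0 ?powR_ge0.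
  apply: le_trans (lee_wpmul2l h0 (hC1 _ _)) _.
  rewrite -!EFinM lee_fin /frequency_kernel /W /weight /= !powRM ?mulr_ge0 ?(ltW (bracket_gt0 _))//.
  rewrite (_ : b1 x1 x2 - phi x1 = t - phi x1 - phi x2 + phi (- (x - x1 - x2)))%R; last by rewrite /b1; ring.
  by rewrite le_eqVlt; apply/orP; left; apply/eqP; ring.
pose F x1 x2 := (frequency_kernel alpha beta sig p gam x t x1 x2)%:E.
have F0 x1 x2 : 0 <= F x1 x2 by rewrite lee_fin frequency_kernel_ge0.
have mF : measurable_fun [set: plane R] (fun z : plane R => F z.1 z.2).
  by apply/measurable_EFinP; exact: measurable_frequency_kernel.
have iF : \int[mu]_x1 \int[mu]_x2 F x1 x2 <= C2%:E by exact: hC2.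
have {}s2 x1 x2 : \int[mu]_t1 (A x1 t1 x2)%:E <= (C1 * C1)%:E * F x1 x2 by exact: s2.
have mST : measurable_fun setT (fun u : plane R * plane R => (spacetime_kernel (x, t) u.1 u.2)%:E).
  have -> : (fun u : plane R * plane R => (spacetime_kernel (x, t) u.1 u.2)%:E) =
    (fun u => (K u.1.1 u.1.2 u.2.1 u.2.2)%:E) by apply/funext => -[[? ?] [? ?]].
  by apply: mK; exact: measurableT_comp.
have KE x1 t1 x2 t2 : spacetime_kernel (x, t) (x1, t1) (x2, t2) = K x1 t1 x2 t2 by [].
clearbody A K F.
rewrite integral_lebesgue2; last 2 first.
- apply: (@measurable_partial_integral _ _ _ _ _ lebesgue2 (fun y1 y2 : plane R => (spacetime_kernel (x, t) y1 y2)%:E)) => //.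
  by move=> y1 y2; rewrite lee_fin spacetime_kernel_ge0.
- by move=> y1; apply: integral_ge0 => y2 _; rewrite lee_fin spacetime_kernel_ge0.
have AE x1 t1 : \int[lebesgue2]_y2 (spacetime_kernel (x, t) (x1, t1) y2)%:E <=
    \int[mu]_x2 (A x1 t1 x2)%:E.
  rewrite integral_lebesgue2; last 2 first.
  - exact: (measurableT_comp mST (pair1_measurable (x1, t1))).
  - by move=> y2; rewrite lee_fin spacetime_kernel_ge0.
  under eq_integral => x2 _ do under eq_integral => t2 _ do rewrite KE.
  apply: ge0_le_integral => //.
  - by move=> x2 _; apply: integral_ge0 => t2 _; rewrite lee_fin.
  - apply: measurable_partial_integral => //; last by move=> ? ?; rewrite lee_fin.
    by apply: mK.
  - by apply: mA.
apply: (@le_trans _ _ (\int[mu]_x1 \int[mu]_t1 \int[mu]_x2 (A x1 t1 x2)%:E)).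
  have m1 : measurable_fun [set: plane R] (fun y1 : plane R => \int[lebesgue2]_y2 (spacetime_kernel (x, t) (y1.1, y1.2) y2)%:E).
    have -> : (fun y1 : plane R => \int[lebesgue2]_y2 (spacetime_kernel (x, t) (y1.1, y1.2) y2)%:E) =
      (fun y1 : plane R => \int[lebesgue2]_y2 (spacetime_kernel (x, t) y1 y2)%:E) by apply/funext => -[? ?].
    apply: (@measurable_partial_integral _ _ _ _ _ lebesgue2 (fun y1 y2 : plane R => (spacetime_kernel (x, t) y1 y2)%:E)) => //.
    by move=> y1 y2; rewrite lee_fin spacetime_kernel_ge0.
  have p0 x1 t1 : 0 <= \int[lebesgue2]_y2 (spacetime_kernel (x, t) (x1, t1) y2)%:E.
    by apply: integral_ge0 => y2 _; rewrite lee_fin spacetime_kernel_ge0.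
  have m2 : measurable_fun [set: plane R] (fun y1 : plane R => \int[mu]_x2 (A y1.1 y1.2 x2)%:E).
    apply: measurable_partial_integral; last by move=> ? ?; rewrite lee_fin.
    by apply: mA => //; exact: measurableT_comp.
  have q0 x1 t1 : 0 <= \int[mu]_x2 (A x1 t1 x2)%:E by apply: integral_ge0 => y2 _; rewrite lee_fin.
  apply: ge0_le_integral => //.
  - by move=> x1 _; exact: integral_ge0.
  - exact: (measurable_partial_integral _ m1).
  - exact: (measurable_partial_integral _ m2).
  move=> x1 _; apply: ge0_le_integral => //.
  - exact: (measurableT_comp m1 (pair1_measurable x1)).
  - exact: (measurableT_comp m2 (pair1_measurable x1)).
have mA2 x1 : measurable_fun [set: plane R] (fun u : plane R => (A x1 u.1 u.2)%:E) by apply: mA.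
have mA3 x1 : measurable_fun [set: plane R] (fun u : plane R => (A x1 u.2 u.1)%:E) by apply: mA.
have swap x1 : \int[mu]_t1 \int[mu]_x2 (A x1 t1 x2)%:E = \int[mu]_x2 \int[mu]_t1 (A x1 t1 x2)%:E.
  by apply: (fubini_tonelli (fun u : plane R => (A x1 u.1 u.2)%:E)) => // z; rewrite lee_fin.
under eq_integral => x1 _ do rewrite swap.
have c0 : 0 <= (C1 * C1)%:E by rewrite lee_fin mulr_ge0.
rewrite EFinM; apply: le_trans (lee_wpmul2l c0 iF).
have mF1 x1 : measurable_fun [set: R] (F x1) by exact: (measurableT_comp mF (pair1_measurable x1)).
rewrite -ge0_integralZl_EFin ?mulr_ge0//; last 2 first.
- by move=> x1 _; exact: integral_ge0.
- exact: measurable_partial_integral.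
have mAA : measurable_fun [set: plane R] (fun u : plane R => \int[mu]_t1 (A u.1 t1 u.2)%:E).
  apply: measurable_partial_integral => [|? ?]; last by rewrite lee_fin.
  by apply: mA => //; exact: measurableT_comp.
have AA0 x1 x2 : 0 <= \int[mu]_t1 (A x1 t1 x2)%:E by apply: integral_ge0 => t1 _; rewrite lee_fin.
apply: ge0_le_integral => //.
- by move=> x1 _; exact: integral_ge0.
- exact: (measurable_partial_integral _ mAA).
- by apply: measurable_funeM; exact: measurable_partial_integral.
move=> x1 _; rewrite -ge0_integralZl_EFin ?mulr_ge0//; last exact: mF1.
apply: ge0_le_integral => //.
- exact: (measurableT_comp mAA (pair1_measurable x1)).
- by apply: measurable_funeM; exact: mF1.
Qed.
End SpacetimeKernel.

(** * Cauchy-Schwarz and convolutions on the plane *)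

Section IntegralTools.
Context d (T : measurableType d) (R : realType) (m : {measure set T -> \bar R}).
Local Open Scope ereal_scope.

(** The integral of a nonnegative function is a supremum over the simple functions
    below it, hence monotone for arbitrary functions; it is applied to the
    modulus of a convolution of complex functions. *)
Lemma ge0_le_integral_pointwise (f g : T -> \bar R) :
  (forall x, 0 <= f x) -> (forall x, f x <= g x) ->
  \int[m]_x f x <= \int[m]_x g x.
Proof.
move=> f0 fg; have g0 x : 0 <= g x by exact: le_trans (fg x).
rewrite !ge0_integralTE//; apply: le_ereal_sup => _ [h hf <-].
by exists h => // x; exact: le_trans (fg x).
Qed.

(** The squared form of Hoelder, meaningful also for infinite integrals. *)
Lemma cauchy_schwarz_integral (F K : T -> R) :
  measurable_fun [set: T] F -> measurable_fun [set: T] K ->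
  (forall x, 0 <= F x)%R -> (forall x, 0 <= K x)%R ->
  (\int[m]_x (F x * K x)%R%:E) `^ 2 <=
    \int[m]_x (F x ^+ 2)%:E * \int[m]_x (K x ^+ 2)%:E.
Proof.
move=> mF mK F0 K0.
have h := @hoelder _ _ _ m F K 2%R 2%R mF mK (ltr0Sn _ _) (ltr0Sn _ _) ltac:(by field).
have e f : (forall x, 0 <= f x)%R -> 'N[m]_2%:E[EFin \o f] `^ 2 = \int[m]_x (f x ^+ 2)%:E.
  move=> f0; rewrite poweR_Lnorm//; apply: eq_integral => x _ /=.
  by rewrite ger0_norm// powR_mulrn.
rewrite -!e// -poweRM ?Lnorm_ge0//.
apply: gt0_ler_poweR => //.
- by rewrite in_itv/= leey andbT integral_ge0// => x _; rewrite lee_fin mulr_ge0.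
- by rewrite in_itv/= leey andbT mule_ge0// Lnorm_ge0.
- apply: le_trans h; rewrite Lnorm1; apply: ge0_le_integral_pointwise => x.
    by rewrite lee_fin mulr_ge0.
  by rewrite /= lee_fin ler_norm.
Qed.

End IntegralTools.

Section PlaneInvariance.
Context {R : realType}.
Notation mu := (@lebesgue_measure R).
Local Open Scope ereal_scope.

Lemma measurable_section (f : plane R -> \bar R) x : measurable_fun [set: plane R] f ->
  measurable_fun [set: R] (fun t => f (x, t)).
Proof. by move=> mf; exact: (measurableT_comp mf (pair1_measurable x)). Qed.

Lemma integral_lebesgue2_shift (f : plane R -> \bar R) (a : plane R) :
  measurable_fun [set: plane R] f -> (forall z, 0 <= f z) ->
  \int[lebesgue2]_z f (z - a)%R = \int[lebesgue2]_z f z.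
Proof.
move=> mf f0; case: a => a1 a2.
have ms : measurable_fun [set: plane R] (fun z : plane R => f (z - (a1, a2))%R).
  apply: (measurableT_comp mf).
  by apply/measurable_fun_pairP; split; apply: measurable_funB.
rewrite !integral_lebesgue2//.
under eq_integral => x _.
  rewrite (ge0_integral_shift (f := fun t => f ((x - a1)%R, t)) (- a2)%R)//; last exact: measurable_section.
  over.
rewrite (ge0_integral_shift (f := fun x => \int[mu]_t f (x, t)) (- a1)%R)//.
  apply: measurable_partial_integral => //.
  by rewrite (_ : (fun z : plane R => f (z.1, z.2)) = f)//; apply/funext => -[].
by move=> x; exact: integral_ge0.
Qed.

Lemma measurable_plane_opp :
  measurable_fun [set: plane R] (fun z : plane R => (- z : plane R)%R).
Proof.
apply/measurable_fun_pairP; split.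
  exact: (measurableT_comp (@oppr_measurable R setT) measurable_fst).
exact: (measurableT_comp (@oppr_measurable R setT) measurable_snd).
Qed.

Lemma ge0_integral_lebesgue2_opp_measurable (f : plane R -> \bar R) :
  measurable_fun [set: plane R] f -> (forall z, 0 <= f z) ->
  \int[lebesgue2]_z f (- z)%R = \int[lebesgue2]_z f z.
Proof.
move=> mf f0.
have ms : measurable_fun [set: plane R] (fun z : plane R => f (- z)%R).
  exact: (measurableT_comp mf measurable_plane_opp).
rewrite !integral_lebesgue2//.
under eq_integral => x _.
  rewrite (ge0_integral_opp (f := fun t => f ((- x)%R, t)))//; last exact: measurable_section.
  over.
rewrite (ge0_integral_opp (f := fun x => \int[mu]_t f (x, t)))//.
  apply: measurable_partial_integral => //.
  by rewrite (_ : (fun z : plane R => f (z.1, z.2)) = f)//; apply/funext => -[].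
by move=> x; exact: integral_ge0.
Qed.

Lemma measurable_conv_arg : measurable_fun [set: plane R * (plane R * plane R)]
  (fun u : plane R * (plane R * plane R) => (u.1 - u.2.1 - u.2.2 : plane R)%R).
Proof.
apply/measurable_fun_pairP; split => /=.
  apply: measurable_funB; first apply: measurable_funB.
  - by apply: (measurableT_comp measurable_fst).
  - by apply: (measurableT_comp measurable_fst); apply: (measurableT_comp measurable_fst).
  - by apply: (measurableT_comp measurable_fst); apply: (measurableT_comp measurable_snd).
apply: measurable_funB; first apply: measurable_funB.
- by apply: (measurableT_comp measurable_snd).
- by apply: (measurableT_comp measurable_snd); apply: (measurableT_comp measurable_fst).
- by apply: (measurableT_comp measurable_snd); apply: (measurableT_comp measurable_snd).
Qed.

Lemma measurable_triple_product (f g h : plane R -> \bar R) d (T : measurableType d)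
    (a b c : T -> plane R) :
  measurable_fun setT f -> measurable_fun setT g -> measurable_fun setT h ->
  measurable_fun setT a -> measurable_fun setT b -> measurable_fun setT c ->
  measurable_fun setT (fun u => f (b u) * g (c u) * h (a u - b u - c u)%R).
Proof.
move=> mf mg mh ma mb mc; apply: emeasurable_funM.
  by apply: emeasurable_funM; [exact: (measurableT_comp mf)|exact: (measurableT_comp mg)].
apply: (measurableT_comp mh).
apply: (measurableT_comp measurable_conv_arg (g := fun u => (a u, (b u, c u)))).
by apply/measurable_fun_pairP; split => //=; apply/measurable_fun_pairP; split.
Qed.

Lemma measurable_inner_convolution (f g h : plane R -> \bar R) :
  measurable_fun setT f -> measurable_fun setT g -> measurable_fun setT h ->
  (forall z, 0 <= f z) -> (forall z, 0 <= g z) -> (forall z, 0 <= h z) ->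
  measurable_fun [set: plane R * plane R]
    (fun u => \int[lebesgue2]_y2 (f u.2 * g y2 * h (u.1 - u.2 - y2)%R)).
Proof.
move=> mf mg mh f0 g0 h0.
apply: (@measurable_partial_integral _ _ _ _ _ lebesgue2
    (fun (u : plane R * plane R) y2 => (f u.2 * g y2 * h (u.1 - u.2 - y2)%R))).
  by apply: measurable_triple_product => //; exact: measurableT_comp.
by move=> u y2; rewrite !mule_ge0.
Qed.

Lemma measurable_triple_convolution (f g h : plane R -> \bar R) :
  measurable_fun setT f -> measurable_fun setT g -> measurable_fun setT h ->
  (forall z, 0 <= f z) -> (forall z, 0 <= g z) -> (forall z, 0 <= h z) ->
  measurable_fun [set: plane R] (fun z =>
    \int[lebesgue2]_y1 \int[lebesgue2]_y2 (f y1 * g y2 * h (z - y1 - y2)%R)).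
Proof.
move=> mf mg mh f0 g0 h0.
apply: (@measurable_partial_integral _ _ _ _ _ lebesgue2
  (fun z y1 : plane R => \int[lebesgue2]_y2 (f y1 * g y2 * h (z - y1 - y2)%R))).
  exact: measurable_inner_convolution.
by move=> z y1; apply: integral_ge0 => y2 _; rewrite !mule_ge0.
Qed.

(** Tonelli, integrating first in the outer variable z, which only occurs in the
    translated argument of h. *)
Lemma integral_triple_convolution (f g h : plane R -> \bar R) :
  measurable_fun setT f -> measurable_fun setT g -> measurable_fun setT h ->
  (forall z, 0 <= f z) -> (forall z, 0 <= g z) -> (forall z, 0 <= h z) ->
  \int[lebesgue2]_z \int[lebesgue2]_y1 \int[lebesgue2]_y2 (f y1 * g y2 * h (z - y1 - y2)%R) =
  (\int[lebesgue2]_z f z) * (\int[lebesgue2]_z g z) * (\int[lebesgue2]_z h z).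
Proof.
move=> mf mg mh f0 g0 h0.
have F0 z y1 y2 : 0 <= f y1 * g y2 * h (z - y1 - y2)%R by rewrite !mule_ge0.
rewrite (fubini_tonelli (m1 := lebesgue2) (m2 := lebesgue2)
  (fun u : plane R * plane R => \int[lebesgue2]_y2 (f u.2 * g y2 * h (u.1 - u.2 - y2)%R)))/=; last 2 first.
- exact: measurable_inner_convolution.
- by move=> u; apply: integral_ge0.
have Hs y1 y2 : \int[lebesgue2]_z h (z - y1 - y2)%R = \int[lebesgue2]_z h z.
  rewrite -(integral_lebesgue2_shift (y1 + y2)%R mh h0).
  by apply: eq_integral => z _; rewrite opprD addrA.
pose H := \int[lebesgue2]_z h z.
have H0 : 0 <= H by exact: integral_ge0.
have in1 y1 : \int[lebesgue2]_z \int[lebesgue2]_y2 (f y1 * g y2 * h (z - y1 - y2)%R) =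
    f y1 * (H * \int[lebesgue2]_y2 g y2).
  have mFy : measurable_fun setT (fun u : plane R * plane R => f y1 * g u.2 * h (u.1 - y1 - u.2)%R).
    by apply: measurable_triple_product.
  rewrite (fubini_tonelli (m1 := lebesgue2) (m2 := lebesgue2)
    (fun u : plane R * plane R => f y1 * g u.2 * h (u.1 - y1 - u.2)%R) mFy (fun u => F0 _ _ _))/=.
  under eq_integral => y2 _.
    rewrite ge0_integralZl//; last 2 first.
    - have mz : measurable_fun setT (fun z : plane R => (z, (y1, y2))).
        exact: pair2_measurable.
      exact: (measurableT_comp mh (measurableT_comp measurable_conv_arg mz)).
    - by rewrite mule_ge0.
    rewrite Hs -/H -muleA (muleC (g y2)).
    over.
  rewrite ge0_integralZl//; last 2 first.
  - exact: measurable_funeM.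
  - by move=> y2 _; rewrite mule_ge0.
  by rewrite ge0_integralZl.
under eq_integral => y1 _ do rewrite in1.
rewrite ge0_integralZr//; last first.
  by rewrite mule_ge0// integral_ge0.
by rewrite -muleA (muleC H).
Qed.

End PlaneInvariance.

(** * Complex moduli and weighted energies *)

Section WeightedEnergy.
Context {R : realType}.
Notation mu := (@lebesgue_measure R).
Notation normc := Normc.normc.
Variables (alpha beta : R).
Notation w := (weight alpha beta).

Lemma weight_sqr (s b : R) (z : plane R) : w s b z ^+ 2 = w (s * 2) (b * 2) z.
Proof.
by rewrite /weight exprMn -!powR_mulrn ?powR_ge0// -!powRrM.
Qed.

Lemma weightN (s b : R) (z : plane R) : w (- s) (- b) z = (w s b z)^-1.
Proof. by rewrite /weight !powRN invfM. Qed.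

Lemma normc_ge0 (x : R[i]) : 0 <= normc x.
Proof. by case: x => a b; exact: sqrtr_ge0. Qed.

Lemma le_Re_normc (x : R[i]) : `|complex.Re x| <= normc x.
Proof.
by case: x => a b /=; rewrite -sqrtr_sqr ler_wsqrtr// lerDl sqr_ge0.
Qed.

Lemma le_Im_normc (x : R[i]) : `|complex.Im x| <= normc x.
Proof.
by case: x => a b /=; rewrite -sqrtr_sqr ler_wsqrtr// lerDr sqr_ge0.
Qed.

Lemma normc_le (a b : R) : normc (Complex a b) <= `|a| + `|b|.
Proof.
rewrite /= -[leRHS]ger0_norm ?addr_ge0// -sqrtr_sqr ler_wsqrtr//.
rewrite sqrrD !real_normK ?num_real// lerD2r lerDl.
by rewrite mulrn_wge0// mulr_ge0.
Qed.

Lemma measurable_normc d (T : measurableType d) (f : T -> R[i]) :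
  cmeasurable f -> measurable_fun setT (fun x => normc (f x)).
Proof.
move=> [mr mi].
have -> : (fun x => normc (f x)) =
    (fun x => (complex.Re (f x) ^+ 2 + complex.Im (f x) ^+ 2) `^ 2^-1).
  by apply/funext => x; case: (f x) => a b /=; rewrite powR12_sqrt// addr_ge0// sqr_ge0.
apply: (measurableT_comp (measurable_powR 2^-1)).
by apply: measurable_funD; exact: measurable_funX.
Qed.

Lemma cmeasurable_comp d d' (T : measurableType d) (T' : measurableType d')
  (f : T' -> R[i]) (g : T -> T') : cmeasurable f -> measurable_fun setT g -> cmeasurable (fun x => f (g x)).
Proof.
by move=> [mr mi] mg; split; [exact: (measurableT_comp mr mg) | exact: (measurableT_comp mi mg)].
Qed.

Lemma cmeasurableM d (T : measurableType d) (f g : T -> R[i]) :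
  cmeasurable f -> cmeasurable g -> cmeasurable (fun x => f x * g x).
Proof.
move=> [fr fi] [gr gi]; split.
  have -> : (fun x => complex.Re (f x * g x)) =
    (fun x => complex.Re (f x) * complex.Re (g x) - complex.Im (f x) * complex.Im (g x)).
    by apply/funext => x; case: (f x) => ? ?; case: (g x).
  by apply: measurable_funB; exact: measurable_funM.
have -> : (fun x => complex.Im (f x * g x)) =
  (fun x => complex.Re (f x) * complex.Im (g x) + complex.Im (f x) * complex.Re (g x)).
  by apply/funext => x; case: (f x) => ? ?; case: (g x).
by apply: measurable_funD; exact: measurable_funM.
Qed.

Local Open Scope ereal_scope.

(** The integral over the plane of the energy density is the square of the norm
    ([Xnorm_hat_sqr]). *)
Definition energy (s b : R) (h : plane R -> R[i]) (z : plane R) : \bar R :=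
  ((w s b z * normc (h z)) ^+ 2)%R%:E.

Lemma energy_ge0 s b h z : 0 <= energy s b h z.
Proof. by rewrite lee_fin sqr_ge0. Qed.

Lemma Xnorm_hat_ge0 s b h : 0 <= Xnorm_hat alpha beta s b h.
Proof. exact: Lnorm_ge0. Qed.

Lemma Xnorm_hat_sqr s b (h : plane R -> R[i]) :
  Xnorm_hat alpha beta s b h `^ 2 = \int[mu]_x \int[mu]_t energy s b h (x, t).
Proof.
rewrite /Xnorm_hat poweR_Lnorm//; apply: eq_integral => x _ /=.
rewrite gee0_abs ?Lnorm_ge0// poweR_Lnorm//; apply: eq_integral => t _ /=.
rewrite /energy /weight/= -powR_mulrn ?ger0_norm//.
all: by rewrite !mulr_ge0 ?powR_ge0 ?normc_ge0.
Qed.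

Lemma measurable_energy s b h : cmeasurable h -> measurable_fun [set: plane R] (energy s b h).
Proof.
move=> mh; apply/measurable_EFinP; apply: measurable_funX; apply: measurable_funM; last exact: measurable_normc.
have -> : w s b = (fun u => w s b (u.1, u.2)) by apply/funext => -[].
exact: measurable_weight.
Qed.

(** The constant is 2 and not 1 because real and imaginary parts are bounded
    separately. If one of them is not integrable, its extended integral
    is infinite, hence read as 0, and the bound still holds. *)
Lemma cintegral_le d (T : measurableType d) (m : {measure set T -> \bar R}) (f : T -> R[i]) :
  cmeasurable f -> (normc (cintegral m f))%:E <= 2%:E * \int[m]_x (normc (f x))%:E.
Proof.
move=> [mr mi].
have part (g : T -> R) : measurable_fun setT g -> (forall x, `|g x| <= normc (f x))%R ->
    (`|\int[m]_x g x|%R)%:E <= \int[m]_x (normc (f x))%:E.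
  move=> mg hg.
  have h : `| \int[m]_x (g x)%:E | <= \int[m]_x (normc (f x))%:E.
    apply: (@le_trans _ _ (\int[m]_x `|(g x)%:E|)).
      by apply: le_abse_integral => //; exact/measurable_EFinP.
    by apply: ge0_le_integral_pointwise => x //; rewrite lee_fin.
  rewrite /Rintegral; move: h; case: (\int[m]_x (g x)%:E) => [r| |] //= h.
  - by rewrite normr0 integral_ge0// => x _; rewrite lee_fin normc_ge0.
  - by rewrite normr0 integral_ge0// => x _; rewrite lee_fin normc_ge0.
apply: (@le_trans _ _ ((`|\int[m]_x complex.Re (f x)|%R)%:E + (`|\int[m]_x complex.Im (f x)|%R)%:E)).
  by rewrite -EFinD lee_fin; exact: normc_le.
rewrite mule_natl mule2n; apply: leeD; apply: part => // x; [exact: le_Re_normc|exact: le_Im_normc].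
Qed.

Lemma cintegrable_normc d (T : measurableType d) (m : {measure set T -> \bar R}) (f : T -> R[i]) :
  cmeasurable f -> \int[m]_x (normc (f x))%:E < +oo -> cintegrable m f.
Proof.
move=> [mr mi] foo.
have part (g : T -> R) : measurable_fun setT g -> (forall x, `|g x| <= normc (f x))%R ->
    m.-integrable setT (fun x => (g x)%:E).
  move=> mg hg; apply/integrableP; split; first exact/measurable_EFinP.
  by apply: le_lt_trans foo; apply: ge0_le_integral_pointwise => x //; rewrite lee_fin.
by split; apply: part => // x; [exact: le_Re_normc|exact: le_Im_normc].
Qed.

End WeightedEnergy.

(** * The trilinear estimate on the Fourier side *)

Section Estimate.
Context {R : realType}.
Notation mu := (@lebesgue_measure R).
Notation normc := Normc.normc.
Variables (alpha beta s b : R).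
Hypotheses (beta0 : beta != 0) (hs : - (1 / 4) < s) (hs0 : s <= 0)
    (hb : 7 / 12 < b) (hb1 : b < 11 / 12).
Notation w := (weight alpha beta).
Local Open Scope ereal_scope.

(** The energy of a transform h = conj (hat w (- z)), measured with the weights of
    w. *)
Definition reflected_energy (h : plane R -> R[i]) (z : plane R) : \bar R :=
  ((w s b (- z)%R * normc (h z)) ^+ 2)%R%:E.

Lemma reflected_energy_ge0 h z : 0 <= reflected_energy h z.
Proof. by rewrite lee_fin sqr_ge0. Qed.

Lemma measurable_weight_plane (s' b' : R) d (T : measurableType d) (f : T -> plane R) :
  measurable_fun setT f -> measurable_fun setT (fun u => w s' b' (f u)).
Proof.
move=> mf.
have -> : (fun u => w s' b' (f u)) = (fun u => w s' b' ((f u).1, (f u).2)).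
  by apply/funext => u; case: (f u).
by apply: measurable_weight; exact: measurableT_comp.
Qed.

Lemma measurable_reflected_energy (h : plane R -> R[i]) : cmeasurable h ->
  measurable_fun [set: plane R] (reflected_energy h).
Proof.
move=> mh; apply/measurable_EFinP; apply: measurable_funX; apply: measurable_funM; last exact: measurable_normc.
exact: (measurable_weight_plane _ _ measurable_plane_opp).
Qed.

Definition energy_convolution f g h z : \bar R :=
  \int[lebesgue2]_y1 \int[lebesgue2]_y2
    (energy alpha beta s b f y1 * energy alpha beta s b g y2 *
     reflected_energy h (z - y1 - y2)%R).

Lemma measurable_conv_shift z : measurable_fun setT
  (fun y : plane R * plane R => (z - y.1 - y.2 : plane R)%R).
Proof.
have m1 : measurable_fun setT (fun y : plane R * plane R => (z, y)) by exact: pair1_measurable.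
exact: (measurableT_comp measurable_conv_arg m1).
Qed.

Lemma cmeasurable_conv3_integrand (f g h : plane R -> R[i]) z : cmeasurable f -> cmeasurable g -> cmeasurable h ->
  cmeasurable (conv3_integrand f g h z).
Proof.
move=> mf mg mh; apply: cmeasurableM; last exact: (cmeasurable_comp mh (measurable_conv_shift z)).
by apply: cmeasurableM; [exact: (cmeasurable_comp mf measurable_fst)|exact: (cmeasurable_comp mg measurable_snd)].
Qed.

(** Cauchy-Schwarz in the convolution variables, for the product of the weighted
    moduli [F] and the product of the inverse weights [K]. The integral of
    [K ^ 2] times the squared output weight is the space-time kernel with
    exponents sig = - s, p = 2 b and gam = 2 - 2 b. *)
Lemma trilinear_pointwise : exists2 C : R, (0 <= C)%R &
  forall f g h : plane R -> R[i], cmeasurable f -> cmeasurable g -> cmeasurable h ->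
  forall z : plane R,
  (w s (b - 1) z ^+ 2)%R%:E *
   (\int[(lebesgue2 \x lebesgue2)]_y (normc (conv3_integrand f g h z y))%:E) `^ 2
  <= C%:E * energy_convolution f g h z.
Proof.
pose sig := (- s)%R; pose p := (b * 2)%R; pose gam := (2 - b * 2)%R.
have sig01 : (0 <= sig < 1 / 4)%R by apply/andP; split; have := hs; have := hs0; rewrite /sig; lra.
have p1 : (7 / 6 < p)%R by have := hb; rewrite /p; lra.
have gam1 : (1 / 6 <= gam)%R by have := hb1; rewrite /gam; lra.
have [C C0 hC] := integral_spacetime_kernel alpha beta0 sig01 p1 gam1.
exists C => // f g h mf mg mh z.
pose F (y : plane R * plane R) := (w s b y.1 * normc (f y.1) * (w s b y.2 * normc (g y.2)) *
  (w s b (- (z - y.1 - y.2)) * normc (h (z - y.1 - y.2))))%R.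
pose K (y : plane R * plane R) := ((w s b y.1)^-1 * (w s b y.2)^-1 * (w s b (- (z - y.1 - y.2)))^-1)%R.
have mshift := measurable_conv_shift z.
have msN : measurable_fun setT (fun y : plane R * plane R => (- (z - y.1 - y.2) : plane R)%R).
  exact: (measurableT_comp measurable_plane_opp mshift).
have mF : measurable_fun setT F.
  apply: measurable_funM; first apply: measurable_funM; apply: measurable_funM.
  - exact: measurable_weight_plane.
  - exact: (measurable_normc (cmeasurable_comp mf measurable_fst)).
  - exact: measurable_weight_plane.
  - exact: (measurable_normc (cmeasurable_comp mg measurable_snd)).
  - exact: measurable_weight_plane.
  - exact: (measurable_normc (cmeasurable_comp mh mshift)).
have mK : measurable_fun setT K.
  rewrite /K; under eq_fun do rewrite -!weightN.
  by apply: measurable_funM; first apply: measurable_funM; exact: measurable_weight_plane.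
have wi y : (0 <= (w s b y)^-1)%R by rewrite invr_ge0 weight_ge0.
have wn y (c : R[i]) : (0 <= w s b y * normc c)%R by exact: mulr_ge0 (weight_ge0 _ _ _ _ _) (normc_ge0 _).
have F0 y : (0 <= F y)%R by exact: mulr_ge0 (mulr_ge0 (wn _ _) (wn _ _)) (wn _ _).
have K0 y : (0 <= K y)%R by exact: mulr_ge0 (mulr_ge0 (wi _) (wi _)) (wi _).
have e3 (A B D : R) : ((A * B * D) ^+ 2 = A ^+ 2 * B ^+ 2 * D ^+ 2)%R by ring.
have cs := cauchy_schwarz_integral (lebesgue2 \x lebesgue2)%E mF mK F0 K0.
have FK y : (F y * K y)%R = normc (conv3_integrand f g h z y).
  rewrite /conv3_integrand !Normc.normcM /F /K.
  by field; rewrite !gt_eqF// weight_gt0.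
under [X in _ * X `^ 2 <= _]eq_integral => y _ do rewrite -FK.
have w0 : 0 <= (w s (b - 1) z ^+ 2)%R%:E by rewrite lee_fin sqr_ge0.
apply: le_trans (lee_wpmul2l w0 cs) _.
rewrite muleCA muleC; apply: lee_pmul.
- by apply: mule_ge0 => //; apply: integral_ge0 => y _; rewrite lee_fin sqr_ge0.
- by apply: integral_ge0 => y _; rewrite lee_fin sqr_ge0.
- have m2 : measurable_fun setT (fun y => ((K y) ^+ 2)%:E).
    by apply/measurable_EFinP; exact: measurable_funX.
  rewrite (fubini_tonelli1 (m1 := lebesgue2) (m2 := lebesgue2) _ m2); last by move=> y; rewrite lee_fin sqr_ge0.
  rewrite -ge0_integralZl//; last 2 first.
  - apply: (@measurable_partial_integral _ _ _ _ _ lebesgue2 (fun y1 y2 => ((K (y1, y2)) ^+ 2)%:E)).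
      by rewrite (_ : (fun y => _) = (fun y => ((K y) ^+ 2)%:E))//; apply/funext => -[].
    by move=> ? ?; rewrite lee_fin sqr_ge0.
  - by move=> y1 _; apply: integral_ge0 => y _; rewrite lee_fin sqr_ge0.
  apply: le_trans (hC z); apply: ge0_le_integral_pointwise => y1.
    by apply: mule_ge0 => //; apply: integral_ge0 => y _; rewrite lee_fin sqr_ge0.
  rewrite -ge0_integralZl//; last 2 first.
  - exact: (measurableT_comp m2 (pair1_measurable y1)).
  - by move=> y2 _; rewrite lee_fin sqr_ge0.
  apply: ge0_le_integral_pointwise => y2.
    by rewrite -EFinM lee_fin mulr_ge0// sqr_ge0.
  rewrite -EFinM lee_fin /K/= -!weightN e3 !weight_sqr /spacetime_kernel.
  rewrite (_ : (b - 1) * 2 = - gam)%R; last by rewrite /gam; ring.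
  rewrite (_ : s * 2 = - (2 * sig))%R; last by rewrite /sig; ring.
  rewrite (_ : - s * 2 = 2 * sig)%R; last by rewrite /sig; ring.
  by rewrite (_ : - b * 2 = - p)%R// /p; ring.
have m2 : measurable_fun setT (fun y => ((F y) ^+ 2)%:E).
  by apply/measurable_EFinP; exact: measurable_funX.
rewrite (fubini_tonelli1 (m1 := lebesgue2) (m2 := lebesgue2) _ m2); last by move=> y; rewrite lee_fin sqr_ge0.
apply: ge0_le_integral_pointwise => y1.
  by apply: integral_ge0 => y _; rewrite lee_fin sqr_ge0.
apply: ge0_le_integral_pointwise => y2; first by rewrite lee_fin sqr_ge0.
by rewrite /energy /reflected_energy -!EFinM lee_fin /F/= e3.
Qed.

Lemma integral_energy_convolution (f g h : plane R -> R[i]) :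
  cmeasurable f -> cmeasurable g -> cmeasurable h ->
  \int[mu]_x \int[mu]_t energy_convolution f g h (x, t) =
  (Xnorm_hat alpha beta s b f `^ 2) * (Xnorm_hat alpha beta s b g `^ 2) *
  \int[lebesgue2]_z reflected_energy h z.
Proof.
move=> mf mg mh.
have e0 k z := @energy_ge0 R alpha beta s b k z.
have r0 z := reflected_energy_ge0 h z.
have me k : cmeasurable k -> measurable_fun setT (energy alpha beta s b k) by exact: measurable_energy.
have mr := measurable_reflected_energy mh.
rewrite !Xnorm_hat_sqr -(integral_lebesgue2 (me _ mf) (e0 f)) -(integral_lebesgue2 (me _ mg) (e0 g)).
rewrite -(integral_triple_convolution (me _ mf) (me _ mg) mr)//.
rewrite [RHS]integral_lebesgue2//.
  exact: (measurable_triple_convolution (me _ mf) (me _ mg) mr).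
by move=> z; apply: integral_ge0 => y1 _; apply: integral_ge0 => y2 _; rewrite !mule_ge0.
Qed.

Lemma measurable_energy_convolution (f g h : plane R -> R[i]) :
  cmeasurable f -> cmeasurable g -> cmeasurable h ->
  measurable_fun [set: plane R] (energy_convolution f g h).
Proof.
move=> mf mg mh; apply: measurable_triple_convolution;
  try (exact: measurable_energy); try (exact: measurable_reflected_energy).
- by move=> z; exact: energy_ge0.
- by move=> z; exact: energy_ge0.
- by move=> z; exact: reflected_energy_ge0.
Qed.

Lemma energy_convolution_ge0 (f g h : plane R -> R[i]) z : 0 <= energy_convolution f g h z.
Proof.
apply: integral_ge0 => y1 _; apply: integral_ge0 => y2 _.
by rewrite !mule_ge0 ?energy_ge0 ?reflected_energy_ge0.
Qed.

(** The pointwise bound has a right-hand side of finite integral, hence finite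
    almost everywhere, which gives the absolute convergence; integrating it
    gives the norm. *)
Lemma trilinear_estimate : exists C : R,
  forall f g h : plane R -> R[i], cmeasurable f -> cmeasurable g -> cmeasurable h ->
  Xnorm_hat alpha beta s b f < +oo -> Xnorm_hat alpha beta s b g < +oo ->
  \int[lebesgue2]_z reflected_energy h z < +oo ->
  {ae lebesgue2, forall z, conv3_converges f g h z} /\
  Xnorm_hat alpha beta s (b - 1) (conv3 f g h) <=
  C%:E * Xnorm_hat alpha beta s b f * Xnorm_hat alpha beta s b g *
    (\int[lebesgue2]_z reflected_energy h z) `^ 2^-1.
Proof.
have [C C0 hC] := trilinear_pointwise.
exists ((4 * C) `^ 2^-1)%R => f g h mf mg mh ff gf hf.
have C40 : (0 <= 4 * C)%R by rewrite mulr_ge0.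
have G0 := energy_convolution_ge0 f g h.
have mG := measurable_energy_convolution mf mg mh.
have iG := integral_energy_convolution mf mg mh.
have E0 : 0 <= \int[lebesgue2]_z reflected_energy h z.
  by apply: integral_ge0 => z _; exact: reflected_energy_ge0.
have p0 (x : \bar R) r : 0 <= x `^ r by exact: poweR_ge0.
have X0 k := Xnorm_hat_ge0 alpha beta s b k.
have Nfin : \int[lebesgue2]_z energy_convolution f g h z < +oo.
  have fin k : Xnorm_hat alpha beta s b k < +oo -> Xnorm_hat alpha beta s b k `^ 2 \is a fin_num.
    by move=> kf; rewrite ge0_fin_numE// poweR_lty.
  rewrite integral_lebesgue2// iG; apply: lte_mul_pinfty => //; first exact: mule_ge0.
  by rewrite fin_numM ?fin.
pose I z := \int[(lebesgue2 \x lebesgue2)]_y (normc (conv3_integrand f g h z y))%:E.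
have I0 z : 0 <= I z by apply: integral_ge0 => y _; rewrite lee_fin normc_ge0.
have w0 z : (0 < w s (b - 1) z ^+ 2)%R by rewrite exprn_gt0// weight_gt0.
have mI z := cmeasurable_conv3_integrand z mf mg mh.
split.
  have intG : lebesgue2.-integrable setT (energy_convolution f g h).
    apply/integrableP; split => //.
    by under eq_integral do rewrite gee0_abs//.
  have := integrable_ae measurableT intG; apply: filterS => z /(_ Logic.I).
  move=> Gfin; apply: cintegrable_normc; first exact: mI.
  rewrite -/(I z).
  have h1 := hC f g h mf mg mh z; rewrite -/(I z) in h1.
  have h2 : C%:E * energy_convolution f g h z < +oo by rewrite lte_mul_pinfty// -ge0_fin_numE.
  apply: (@lty_poweRy _ _ 2%R) => //.
  have := le_lt_trans h1 h2.
  have /orP[/eqP->|//] : (I z `^ 2 == +oo) || (I z `^ 2 < +oo) by rewrite -le_eqVlt leey.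
  by rewrite gt0_muley// lte_fin.
have pt z : energy alpha beta s (b - 1) (conv3 f g h) z <= (4 * C)%:E * energy_convolution f g h z.
  have h1 := hC f g h mf mg mh z; rewrite -/(I z) in h1.
  have h2 := cintegral_le (lebesgue2 \x lebesgue2)%E (mI z).
  rewrite -/(I z) -/(conv3 f g h z) in h2.
  have sqr_le (N : R) : (0 <= N)%R -> N%:E <= 2%:E * I z -> (N ^+ 2)%:E <= 4%:E * I z `^ 2.
    move=> N0 hN.
    have -> : 4%:E * I z `^ 2 = (2%:E * I z) `^ 2.
      by rewrite poweRM// poweR_EFin powR_mulrn//; congr (_%:E * _); ring.
    rewrite -powR_mulrn// -poweR_EFin; apply: gt0_ler_poweR => //.
    - by rewrite in_itv/= leey andbT.
    - by rewrite in_itv/= leey andbT mule_ge0.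
  have h3 := sqr_le _ (normc_ge0 _) h2.
  rewrite /energy exprMn EFinM.
  have w0' : 0 <= (w s (b - 1) z ^+ 2)%R%:E by rewrite lee_fin ltW.
  apply: le_trans (lee_wpmul2l w0' h3) _.
  rewrite muleCA (EFinM 4 C) -[leRHS]muleA; apply: lee_wpmul2l => //; exact: h1.
have sq : Xnorm_hat alpha beta s (b - 1) (conv3 f g h) `^ 2 <=
   (4 * C)%:E * ((Xnorm_hat alpha beta s b f `^ 2) * (Xnorm_hat alpha beta s b g `^ 2) *
  \int[lebesgue2]_z reflected_energy h z).
  rewrite Xnorm_hat_sqr -iG -(integral_lebesgue2 mG G0) -ge0_integralZl_EFin//.
  rewrite integral_lebesgue2//; last 2 first.
  - exact: measurable_funeM.
  - by move=> z; rewrite mule_ge0// lee_fin.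
  apply: ge0_le_integral_pointwise => x.
    by apply: integral_ge0 => t _; exact: energy_ge0.
  by apply: ge0_le_integral_pointwise => t //; exact: energy_ge0.
have sqrtK (x : \bar R) : 0 <= x -> (x `^ 2) `^ 2^-1 = x.
  by move=> x0; rewrite -poweRrM mulfV// poweRe1.
rewrite -[leLHS]sqrtK ?Xnorm_hat_ge0//.
have -> : ((4 * C) `^ 2^-1)%:E * Xnorm_hat alpha beta s b f * Xnorm_hat alpha beta s b g *
    (\int[lebesgue2]_z reflected_energy h z) `^ 2^-1 =
  ((4 * C)%:E * ((Xnorm_hat alpha beta s b f `^ 2) * (Xnorm_hat alpha beta s b g `^ 2) *
  \int[lebesgue2]_z reflected_energy h z)) `^ 2^-1.
  by rewrite !poweRM ?mule_ge0// !sqrtK// poweR_EFin !muleA.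
apply: gt0_ler_poweR => //.
- by rewrite in_itv/= leey andbT.
- by rewrite in_itv/= leey andbT !mule_ge0// lee_fin.
Qed.
End Estimate.

(** * Functions with vanishing integrals over quadrants *)

Section DensityMeasure.
Context d (T : measurableType d) (R : realType) (m : {measure set T -> \bar R}).
Variables (f : T -> \bar R) (mf : measurable_fun setT f) (f0 : forall x, (0 <= f x)%E).
Local Open Scope ereal_scope.

(** The proof arguments carry the facts that make the indefinite integral of f a
    measure, so that this structure can be inferred. *)
Definition density of measurable_fun setT f & (forall x, 0 <= f x) :=
  fun A : set T => \int[m]_(x in A) f x.
Notation nu := (density mf f0).

Let density0 : nu set0 = 0. Proof. exact: integral_set0. Qed.

Let density_ge0 A : 0 <= nu A. Proof. exact: integral_ge0. Qed.

Let density_sigma_additive : semi_sigma_additive nu.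
Proof.
move=> A mA tA mUA; rewrite /density ge0_integral_bigcup//.
  by apply: is_cvg_ereal_nneg_natsum_cond => n _ _; exact: integral_ge0.
exact: measurable_funTS.
Qed.

HB.instance Definition _ := isMeasure.Build _ _ _ nu density0 density_ge0 density_sigma_additive.
End DensityMeasure.

Section QuadrantUniqueness.
Context {R : realType}.
Local Open Scope ereal_scope.

(** Rays are stable under intersection and generate the Borel sets. *)
Lemma measure_ray_unique (m1 m2 : {measure set (measurableTypeR R) -> \bar R}) :
  m1 setT < +oo -> (forall a, m1 `[a, +oo[%classic = m2 `[a, +oo[%classic) ->
  forall A, measurable A -> m1 A = m2 A.
Proof.
move=> fin h A mA.
apply: (@measure_unique _ R (measurableTypeR R) (@RGenCInfty.G R) (fun n => `[(- n%:R)%R, +oo[%classic)) => //.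
- exact: RGenCInfty.measurableE.
- move=> _ _ [x ->] [y ->]; exists (Num.max x y).
  by apply/seteqP; split => z /=; rewrite !in_itv/= !andbT ge_max => /andP.
- by move=> n; eexists; reflexivity.
- apply/seteqP; split => // x _.
  exists (Num.truncn `|x|).+1 => //=; rewrite in_itv/= andbT lerNl.
  apply: (@le_trans _ _ `|x|%R); first by rewrite -normrN ler_norm.
  by apply/ltW; exact: truncnS_gt.
- by move=> _ [x ->].
- move=> k; apply: le_lt_trans fin; apply: le_measure; rewrite ?inE//.
Qed.

(** The one-dimensional statement is applied to each factor in turn: with the
    second side a ray fixed, the restriction of the measure to that strip is
    projected to the first coordinate, and then the roles are exchanged. *)
Lemma measure_quadrant_unique (m1 m2 : {measure set (plane R) -> \bar R}) :
  m1 setT < +oo ->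
  (forall a b, m1 (`[a, +oo[ `*` `[b, +oo[)%classic = m2 (`[a, +oo[ `*` `[b, +oo[)%classic) ->
  forall A, measurable A -> m1 A = m2 A.
Proof.
move=> fin h A mA.
have mT (B : set (measurableTypeR R)) : measurable B -> measurable (setT `*` B : set (plane R)).
  by move=> mB; exact: measurableX.
have mT' (B : set (measurableTypeR R)) : measurable B -> measurable (B `*` setT : set (plane R)).
  by move=> mB; exact: measurableX.
have finS (B : set (plane R)) : measurable B -> m1 B < +oo.
  by move=> mB; apply: le_lt_trans fin; apply: le_measure; rewrite ?inE.
have s1 b (B : set (measurableTypeR R)) : measurable B ->
    m1 (B `*` `[b, +oo[%classic) = m2 (B `*` `[b, +oo[%classic).
  have mI : measurable (setT `*` `[b, +oo[%classic : set (plane R)) by exact: mT.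
  have E (m : {measure set (plane R) -> \bar R}) (D : set (measurableTypeR R)) :
      m (D `*` `[b, +oo[%classic) = pushforward (mrestr m mI) (@fst (measurableTypeR R) (measurableTypeR R)) D.
    by rewrite /pushforward /mrestr; congr (m _); apply/seteqP; split => -[x y] /=; tauto.
  move=> mB; rewrite !E.
  apply: (measure_ray_unique (m1 := pushforward (mrestr m1 mI) _) (m2 := pushforward (mrestr m2 mI) _)) => //.
    by rewrite /= -E; apply: finS; exact: measurableX.
  by move=> a; rewrite /= -!E.
have s2 (B C : set (measurableTypeR R)) : measurable B -> measurable C ->
    m1 (B `*` C) = m2 (B `*` C).
  move=> mB.
  have mI : measurable (B `*` setT : set (plane R)) by exact: mT'.
  have E (m : {measure set (plane R) -> \bar R}) (D : set (measurableTypeR R)) :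
      m (B `*` D) = pushforward (mrestr m mI) (@snd (measurableTypeR R) (measurableTypeR R)) D.
    by rewrite /pushforward /mrestr; congr (m _); apply/seteqP; split => -[x y] /=; tauto.
  move=> mC; rewrite !E.
  apply: (measure_ray_unique (m1 := pushforward (mrestr m1 mI) _) (m2 := pushforward (mrestr m2 mI) _)) => //.
    by rewrite /= -E; apply: finS; exact: measurableX.
  by move=> a; rewrite /= -!E; exact: s1.
apply: (measure_unique [set X `*` Y | X in measurable & Y in measurable] (fun=> setT)) => //.
- exact: measurable_prod_measurableType.
- move=> _ _ [X mX [Y mY <-]] [X' mX' [Y' mY' <-]].
  exists (X `&` X'); first exact: measurableI.
  by exists (Y `&` Y'); [exact: measurableI | rewrite setXI].
- by move=> i; exists setT => //; exists setT => //; rewrite setXTT.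
- by apply/seteqP; split => // x _; exists 0%N.
- by move=> _ [X mX [Y mY <-]]; exact: s2.
Qed.

(** The positive and the negative part are densities of two finite measures that
    agree on quadrants, hence everywhere; so the two parts agree almost
    everywhere, and their product being 0 both vanish. *)
Lemma ae_eq0_of_quadrants (g : plane R -> R) :
  lebesgue2.-integrable setT (EFin \o g) ->
  (forall a b, \int[lebesgue2]_(z in (`[a, +oo[ `*` `[b, +oo[)%classic) (g z)%:E = 0) ->
  {ae lebesgue2, forall z, g z = 0%R}.
Proof.
move=> ig h; pose G : plane R -> \bar R := EFin \o g.
have mG : measurable_fun setT G by exact: measurable_int ig.
have mP := measurable_funepos mG; have mN := measurable_funeneg mG.
have P0 z : 0 <= G^\+ z by exact: funepos_ge0.
have N0 z : 0 <= G^\- z by exact: funeneg_ge0.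
have iP : lebesgue2.-integrable setT G^\+ by exact: integrable_funepos.
have eqA A : measurable A -> \int[lebesgue2]_(z in A) G^\+ z = \int[lebesgue2]_(z in A) G^\- z.
  move=> mA; rewrite -[LHS]/(density lebesgue2 mP P0 A) -[RHS]/(density lebesgue2 mN N0 A).
  apply: measure_quadrant_unique => //.
    by rewrite /= /density; exact: integral_funepos_lt_pinfty.
  move=> a b; rewrite /= /density.
  have e := integralE lebesgue2 (`[a, +oo[ `*` `[b, +oo[)%classic G.
  have e' : \int[lebesgue2]_(z in (`[a, +oo[ `*` `[b, +oo[)%classic) G z = 0 by exact: h.
  move: e; rewrite e' => /esym e.
  have mQ : measurable (`[a, +oo[ `*` `[b, +oo[ : set (plane R))%classic by exact: measurableX.
  have iQ : lebesgue2.-integrable (`[a, +oo[ `*` `[b, +oo[)%classic G.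
    exact: (integrableS measurableT mQ (@subsetT _ _) ig).
  have f1 := integrable_pos_fin_num mQ iQ; have f2 := integrable_neg_fin_num mQ iQ.
  move: e f1 f2; move: (\int[_]_(x in _) _ x) (\int[_]_(x in _) _ x) => [p| |] [n| |] //=.
  by move=> [/eqP]; rewrite subr_eq0 => /eqP ->.
have := integral_ae_eq measurableT iP mN (fun E _ mE => eqA E mE).
apply: filterS => z /(_ Logic.I) e.
move: e; rewrite funeposE funenegE /G /= -!EFin_max => -[].
by case: (leP (g z) 0%R) => h1; case: (leP (- g z)%R 0%R) => h2; lra.
Qed.

End QuadrantUniqueness.

(** * Gaussian-logistic test functions *)

Section TestFunctions.
Context {R : realType}.
Implicit Types (c d x u : R) (f g : R -> R).

Definition logistic u : R := (1 + expR (- u))^-1.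

Lemma logistic_den_gt0 u : 0 < 1 + expR (- u).
Proof. by rewrite addr_gt0// expR_gt0. Qed.

Lemma logistic_ge0 u : 0 <= logistic u.
Proof. by rewrite invr_ge0 ltW// logistic_den_gt0. Qed.

Lemma logistic_le1 u : logistic u <= 1.
Proof. by rewrite invf_le1 ?logistic_den_gt0// lerDl expR_ge0. Qed.

Global Instance is_derive_logistic u : is_derive u 1 logistic (logistic u * (1 - logistic u)).
Proof.
have h : 1 + expR (- u) != 0 by rewrite gt_eqF// logistic_den_gt0.
have d1 : is_derive u 1 (fun u => 1 + expR (- u)) (- expR (- u)).
  have d2 : is_derive u 1 (fun u => expR (- u)) (expR (- u) * - 1).
    exact: (@is_derive1_comp _ expR -%R).
  by rewrite -mulrN1 -[X in is_derive _ _ _ X]add0r; exact: is_deriveD.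
have d3 := @is_deriveV R (fun u : R => 1 + expR (- u)) u (- expR (- u)) 1 h d1.
apply: (is_derive_eq d3).
rewrite /logistic /GRing.scale/=; field.
exact: h.
Qed.

(** These functions approximate Gaussians cut off to a half-line, and since
    logistic' = logistic (1 - logistic) their span is closed under
    differentiation. *)
Definition gauss_mono c d (i j : nat) x : R :=
  x ^+ i * logistic (c * x + d) ^+ j * expR (- x ^+ 2).

Inductive gauss_poly c d : (R -> R) -> Prop :=
| gauss_poly_mono i j : gauss_poly c d (gauss_mono c d i j)
| gauss_poly_add f g : gauss_poly c d f -> gauss_poly c d g ->
    gauss_poly c d (fun x => f x + g x)
| gauss_poly_scale a f : gauss_poly c d f -> gauss_poly c d (fun x => a * f x).

Lemma gauss_poly_derive c d f : gauss_poly c d f ->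
  exists2 f', gauss_poly c d f' & forall x, is_derive x 1 f (f' x).
Proof.
elim=> [i j|{}f g _ [f' Pf' df] _ [g' Pg' dg]|a {}f _ [f' Pf' df]].
- exists (fun x => (i%:R * gauss_mono c d i.-1 j x + (j%:R * c) * gauss_mono c d i j x) +
    ((- (j%:R * c)) * gauss_mono c d i j.+1 x + (- 2) * gauss_mono c d i.+1 j x)).
    by repeat (apply: gauss_poly_add || apply: gauss_poly_scale || apply: gauss_poly_mono).
  move=> x; rewrite /gauss_mono.
  have dl : is_derive x 1 (fun x => logistic (c * x + d)) (logistic (c * x + d) * (1 - logistic (c * x + d)) * c).
    apply: (@is_derive1_comp _ logistic (fun x => c * x + d)).
    rewrite -[X in is_derive _ _ _ X]addr0; apply: is_deriveD.
    rewrite -[X in is_derive _ _ _ X]mulr1; exact: is_deriveZ.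
  have de : is_derive x 1 (fun x => expR (- x ^+ 2)) (expR (- x ^+ 2) * - (2 * x)).
    apply: (@is_derive1_comp _ expR (fun x => - x ^+ 2)).
    apply: is_deriveN; apply: (is_derive_eq (is_deriveX 2 (is_derive_id x (1 : R)))).
    by rewrite /GRing.scale/= expr1 mulr1.
  have dx := is_deriveX i (is_derive_id x (1 : R)).
  have dL := is_deriveX j dl.
  have E : (fun y : R => y ^+ i * logistic (c * y + d) ^+ j * expR (- y ^+ 2)) =
     id ^+ i * (fun y => logistic (c * y + d)) ^+ j * (fun y => expR (- y ^+ 2)).
    by apply/funext => y; rewrite !fctE.
  rewrite E; apply: (is_derive_eq (is_deriveM (is_deriveM dx dL) de)).
  rewrite /GRing.scale/= !fctE /=.
  clear E; case: i dx => [|i] dx; case: j dL => [|j] dL; rewrite /= ?mulr0n ?mul0r ?exprS; ring.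
- by exists (fun x => f' x + g' x); [exact: gauss_poly_add|move=> x; exact: is_deriveD].
- by exists (fun x => a * f' x); [exact: gauss_poly_scale|move=> x; exact: is_deriveZ].
Qed.

(** (1 + |x|) ^ N is at most N! exp (1 + |x|), and 1 + |x| <= 2 + x ^ 2. *)
Lemma gaussian_decay (N : nat) : exists M : R, forall x, (1 + `|x|) ^+ N * expR (- x ^+ 2) <= M.
Proof.
exists (N`!%:R * expR 2) => x.
have x0 : 0 <= 1 + `|x| by rewrite addr_ge0.
have h1 : (1 + `|x|) ^+ N <= N`!%:R * expR (1 + `|x|).
  case: N => [|N]; first by rewrite expr0 fact0 mul1r; apply: le_trans (expR_ge1Dx _); lra.
  have := expR_ge1Dxn N x0; rewrite -ler_pdivrMl ?ltr0n ?fact_gt0// => h.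
  by rewrite mulrC; lra.
have h2 : expR (1 + `|x|) <= expR 2 * expR (x ^+ 2).
  rewrite -expRD ler_expR.
  have := sqr_ge0 (`|x| - 1); rewrite -(real_normK (num_real x)).
  have := normr_ge0 x; move: `|x| => y; nra.
rewrite expRN ler_pdivrMr ?expR_gt0// -mulrA.
by apply: le_trans h1 _; apply: ler_wpM2l.
Qed.

Lemma gauss_poly_bounded c d f : gauss_poly c d f ->
  forall n, exists M : R, forall x, (1 + `|x|) ^+ n * `|f x| <= M.
Proof.
elim=> [i j|{}f g _ hf _ hg|a {}f _ hf] n.
- have [M hM] := gaussian_decay (n + i); exists M => x; apply: le_trans (hM x).
  rewrite /gauss_mono !normrM (ger0_norm (expR_ge0 _)) mulrA; apply: ler_wpM2r; first exact: expR_ge0.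
  rewrite exprD; apply: ler_wpM2l; first by rewrite exprn_ge0// addr_ge0.
  rewrite -[leRHS]mulr1; apply: ler_pM => //.
    by rewrite normrX lerXn2r ?nnegrE ?addr_ge0// lerDr.
  rewrite normrX ger0_norm ?logistic_ge0// exprn_ile1 ?logistic_ge0 ?logistic_le1//.
- have [M hM] := hf n; have [M' hM'] := hg n; exists (M + M') => x.
  apply: le_trans (lerD (hM x) (hM' x)); rewrite -mulrDr; apply: ler_wpM2l.
    by rewrite exprn_ge0// addr_ge0.
  exact: ler_normD.
- have [M hM] := hf n; exists (`|a| * M) => x.
  by rewrite normrM mulrCA; apply: ler_wpM2l.
Qed.

(** Along an axis, a function with separated variables is a multiple of a function
    of one variable, and a partial derivative is an ordinary one. *)
Lemma derive_slice1 (f g : R -> R) (f' : R) (z : R * R) : is_derive z.1 1 f f' ->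
  derivable (fun y : R * R => f y.1 * g y.2) z (axis false) /\
  'D_(axis false) (fun y : R * R => f y.1 * g y.2) z = f' * g z.2.
Proof.
move=> df; have [hd hv] : is_derive z.1 1 (fun x => g z.2 *: f x) (g z.2 *: f') by exact: is_deriveZ.
have e : (fun h : R => h^-1 *: (((fun y : R * R => f y.1 * g y.2) \o shift z) (h *: axis false) - f z.1 * g z.2)) =
  (fun h : R => h^-1 *: (((fun x => g z.2 *: f x) \o shift z.1) (h *: 1) - g z.2 *: f z.1)).
  apply/funext => h /=; congr (_ *: (_ - _)); last by rewrite mulrC.
  by rewrite /GRing.scale/= mulr0 add0r mulrC.
split; first by rewrite /derivable e.
by rewrite /derive e -/(derive _ _ _) hv /GRing.scale/= mulrC.
Qed.

Lemma derive_slice2 (f g : R -> R) (g' : R) (z : R * R) : is_derive z.2 1 g g' ->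
  derivable (fun y : R * R => f y.1 * g y.2) z (axis true) /\
  'D_(axis true) (fun y : R * R => f y.1 * g y.2) z = f z.1 * g'.
Proof.
move=> df; have [hd hv] : is_derive z.2 1 (fun x => f z.1 *: g x) (f z.1 *: g') by exact: is_deriveZ.
have e : (fun h : R => h^-1 *: (((fun y : R * R => f y.1 * g y.2) \o shift z) (h *: axis true) - f z.1 * g z.2)) =
  (fun h : R => h^-1 *: (((fun x => f z.1 *: g x) \o shift z.2) (h *: 1) - f z.1 *: g z.2)).
  apply/funext => h /=; congr (_ *: (_ - _)).
  by rewrite /GRing.scale/= mulr0 add0r.
split; first by rewrite /derivable e.
by rewrite /derive e -/(derive _ _ _) hv.
Qed.

(** The partial derivatives stay separated because each factor is differentiated
    within its own span. *)
Lemma partials_gauss_poly c d c' d' f g (w : seq bool) : gauss_poly c d f -> gauss_poly c' d' g ->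
  exists f' g', [/\ gauss_poly c d f', gauss_poly c' d' g' &
    partials w (fun z : R * R => f z.1 * g z.2) = (fun z => f' z.1 * g' z.2)].
Proof.
move=> Pf Pg; elim: w => [|k w [f1 [g1 [Pf1 Pg1 e]]]]; first by exists f, g.
have [f2 Pf2 df] := gauss_poly_derive Pf1; have [g2 Pg2 dg] := gauss_poly_derive Pg1.
case: k.
  exists f1, g2; split=> //=; apply/funext => z; rewrite -/(partials w _) e.
  by have [_] := derive_slice2 f1 (dg z.2).
exists f2, g1; split=> //=; apply/funext => z; rewrite -/(partials w _) e.
by have [_] := derive_slice1 g1 (df z.1).
Qed.

Lemma partials0 (w : seq bool) : partials w (fun _ : R * R => 0 : R) = fun=> 0.
Proof.
elim: w => [//|k w IH] /=; apply/funext => z; rewrite -/(partials w _) IH.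
exact: derive_cst.
Qed.

Lemma schwartz_gauss_poly c d c' d' f g : gauss_poly c d f -> gauss_poly c' d' g ->
  schwartz (fun z : R * R => Complex (f z.1 * g z.2) 0).
Proof.
move=> Pf Pg; split => /=.
- move=> w k z; have [f1 [g1 [Pf1 Pg1 ->]]] := partials_gauss_poly w Pf Pg.
  have [f2 Pf2 df] := gauss_poly_derive Pf1; have [g2 Pg2 dg] := gauss_poly_derive Pg1.
  by case: k; [have [] := derive_slice2 f1 (dg z.2)|have [] := derive_slice1 g1 (df z.1)].
- by move=> w k z; rewrite partials0; exact: derivable_cst.
- move=> n w; have [f1 [g1 [Pf1 Pg1 e]]] := partials_gauss_poly w Pf Pg.
  have [M hM] := gauss_poly_bounded Pf1 n; have [M' hM'] := gauss_poly_bounded Pg1 n.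
  exists (M * M') => z.
  rewrite partials0 e.
  rewrite expr0n/= addr0 sqrtr_sqr normrM.
  have p1 (y : R) : 0 <= 1 + `|y| by rewrite addr_ge0.
  apply: (@le_trans _ _ (((1 + `|z.1|) ^+ n * `|f1 z.1|) * ((1 + `|z.2|) ^+ n * `|g1 z.2|))).
    rewrite mulrACA; apply: ler_wpM2r; first exact: mulr_ge0.
    rewrite -exprMn lerXn2r ?nnegrE ?mulr_ge0 ?addr_ge0//.
    rewrite prod_normE /= mulrDl mul1r mulrDr mulr1.
    have n1 := normr_ge0 z.1; have n2 := normr_ge0 z.2.
    have : Num.max `|z.1| `|z.2| <= `|z.1| + `|z.2| by rewrite ge_max lerDl lerDr n1 n2.
    have := mulr_ge0 n1 n2; lra.
  by apply: ler_pM; rewrite ?mulr_ge0 ?exprn_ge0.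
Qed.

End TestFunctions.

(** * Functions vanishing against all tests *)

Section FourierUniqueness.
Context {R : realType}.

(** The argument is n ^ 2 (x - a) + n. The drift n dominates at x = a and is
    dominated by n ^ 2 (x - a) elsewhere, so the limit is 1 at a itself as in a
    closed ray. *)
Lemma logistic_step (a x : R) :
  (logistic (n%:R ^+ 2 * x + (n%:R - n%:R ^+ 2 * a)) @[n --> \oo] -->
    (if a <= x then 1 else 0 : R))%classic.
Proof.
have harm := @cvg_harmonic R.
have one (u : R) n : n%:R <= u -> 1 - n.+1%:R^-1 <= logistic u.
  move=> un; have u0 : 0 <= u by exact: le_trans un.
  have h1 : expR (- u) <= n.+1%:R^-1.
    rewrite expRN lef_pV2 ?posrE ?expR_gt0 ?ltr0n//.
    by apply: le_trans (expR_ge1Dx u); rewrite -natr1 addrC lerD2l.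
  have e0 := expR_gt0 (- u).
  have t0 : 0 <= n.+1%:R^-1 :> R by rewrite invr_ge0.
  rewrite /logistic -[leRHS]mul1r ler_pdivlMr ?logistic_den_gt0//.
  move: h1 t0 e0; move: (expR (- u)) (n.+1%:R^-1) => E t h1 t0 E0.
  by have := mulr_ge0 t0 (ltW E0); lra.
have zero (u : R) n : u <= - n%:R -> logistic u <= n.+1%:R^-1.
  move=> un; rewrite /logistic lef_pV2 ?posrE ?logistic_den_gt0 ?ltr0n//.
  have := expR_ge1Dx (- u); rewrite -natr1; lra.
case: ifPn => ax.
  apply/cvgrPdist_le => /= e e0; near=> n.
  have un : n%:R <= n%:R ^+ 2 * x + (n%:R - n%:R ^+ 2 * a).
    have : 0 <= n%:R ^+ 2 * (x - a) by rewrite mulr_ge0 ?sqr_ge0// subr_ge0.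
    by rewrite mulrBr addrCA lerDl.
  have := one _ _ un; have := logistic_le1 (n%:R ^+ 2 * x + (n%:R - n%:R ^+ 2 * a)).
  have : n.+1%:R^-1 <= e.
    near: n; move/cvgrPdist_le : harm => /(_ e e0); apply: filterS => n.
    by rewrite sub0r normrN ger0_norm// invr_ge0.
  move=> h1 h2 h3; rewrite ger0_norm ?subr_ge0// lerBlDr -lerBlDl.
  by apply: le_trans h3; rewrite lerD2l lerN2.
rewrite -ltNge in ax.
apply/cvgrPdist_le => /= e e0; near=> n.
have un : n%:R ^+ 2 * x + (n%:R - n%:R ^+ 2 * a) <= - n%:R.
  have h : 2 / (a - x) <= n%:R by near: n; exact: nbhs_infty_ger.
  have d0 : 0 < a - x by rewrite subr_gt0.
  rewrite ler_pdivrMr// in h.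
  have := ler_wpM2l (ler0n R n) h; lra.
have := zero _ _ un; have := logistic_ge0 (n%:R ^+ 2 * x + (n%:R - n%:R ^+ 2 * a)).
have : n.+1%:R^-1 <= e.
  near: n; move/cvgrPdist_le : harm => /(_ e e0); apply: filterS => n.
  by rewrite sub0r normrN ger0_norm// invr_ge0.
by move=> h1 h2 h3; rewrite sub0r normrN ger0_norm// (le_trans h3).
Unshelve. all: by end_near.
Qed.

Local Open Scope ereal_scope.

(** With the products of two steep test functions, dominated convergence shows
    that g times a Gaussian has vanishing integral over every quadrant. The
    dominating function is g times the Gaussian itself, integrable because the
    Gaussian is one of the tests. *)
Lemma ae_eq0_of_tests (g : plane R -> R) : measurable_fun setT g ->
  (forall c d c' d' f1 f2, gauss_poly c d f1 -> gauss_poly c' d' f2 ->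
     lebesgue2.-integrable setT (fun z : plane R => (g z * (f1 z.1 * f2 z.2))%:E) /\
     \int[lebesgue2]_z (g z * (f1 z.1 * f2 z.2))%:E = 0) ->
  {ae lebesgue2, forall z, g z = 0%R}.
Proof.
move=> mg test.
pose rho (z : plane R) : R := (expR (- z.1 ^+ 2) * expR (- z.2 ^+ 2))%R.
have rho0 z : (0 < rho z)%R by rewrite mulr_gt0// expR_gt0.
have iG : lebesgue2.-integrable setT (EFin \o (fun z => g z * rho z)%R).
  have [h _] := test 0%R 0%R 0%R 0%R _ _ (gauss_poly_mono 0 0 0 0) (gauss_poly_mono 0 0 0 0).
  apply: eq_integrable h => // z _.
  by rewrite /gauss_mono !expr0 !mul1r.
have G0 : {ae lebesgue2, forall z, (g z * rho z = 0)%R}.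
  apply: (ae_eq0_of_quadrants iG) => a b.
  pose cc (n : nat) : R := (n%:R ^+ 2)%R.
  pose dd (a : R) (n : nat) : R := (n%:R - n%:R ^+ 2 * a)%R.
  pose F (n : nat) (z : plane R) : \bar R :=
    (g z * (gauss_mono (cc n) (dd a n) 0 1 z.1 * gauss_mono (cc n) (dd b n) 0 1 z.2))%R%:E.
  have FE n z : F n z = (g z * rho z * (logistic (cc n * z.1 + dd a n) * logistic (cc n * z.2 + dd b n)))%R%:E.
    by rewrite /F /gauss_mono /rho !expr0 !expr1 !mul1r; congr EFin; ring.
  pose Q : set (plane R) := (`[a, +oo[ `*` `[b, +oo[)%classic.
  have mQ : measurable Q by exact: measurableX.
  have mF n : measurable_fun setT (F n).
    exact: measurable_int (test _ _ _ _ _ _ (gauss_poly_mono _ _ _ _) (gauss_poly_mono _ _ _ _)).1.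
  pose lim : plane R -> \bar R := (EFin \o (fun z => g z * rho z)%R) \_ Q.
  have mlim : measurable_fun setT lim.
    have mG : measurable_fun setT (EFin \o (fun z => g z * rho z)%R) by exact: measurable_int iG.
    by apply/(measurable_restrictT _ mQ); exact: (measurable_funS measurableT (@subsetT _ _) mG).
  have Fcv : {ae lebesgue2, forall z, setT z -> (F n z @[n --> \oo] --> lim z)%classic}.
    apply: aeW => z _; under eq_fun do rewrite FE.
    have -> : lim z = (g z * rho z * ((if a <= z.1 then 1 else 0) * (if b <= z.2 then 1 else 0)))%R%:E.
      rewrite /lim patchE; case: ifPn => [|/negP h].
        by rewrite inE /Q/= !in_itv/= !andbT => -[-> ->]; rewrite !mulr1.
      case: ifPn => h1; last by rewrite mul0r mulr0.
      case: ifPn => h2; last by rewrite !mulr0.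
      by exfalso; apply: h; rewrite inE /Q/= !in_itv/= !andbT.
    apply: cvg_EFin; first exact: nearW.
    apply: cvgM; first exact: cvg_cst.
    by apply: cvgM; exact: logistic_step.
  have Fdom : {ae lebesgue2, forall z n, setT z -> `|F n z| <= (`|g z * rho z|)%:E}.
    apply: aeW => z n _; rewrite FE abse_EFin lee_fin normrM ler_piMr//.
    rewrite ger0_norm ?mulr_ge0 ?logistic_ge0//.
    by rewrite -[leRHS]mulr1 ler_pM ?logistic_ge0 ?logistic_le1.
  have [_ _ cv] := dominated_convergence measurableT mF mlim Fcv (integrable_norm iG) Fdom.
  have Fint n : \int[lebesgue2]_z F n z = 0.
    by have [_] := test _ _ _ _ _ _ (gauss_poly_mono (cc n) (dd a n) 0 1) (gauss_poly_mono (cc n) (dd b n) 0 1).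
  have : \int[lebesgue2]_z lim z = 0.
    rewrite (_ : [sequence _]_n = fun=> 0) in cv; last by apply/funext => n; exact: Fint.
    by apply: (cvg_unique _ cv) => //; exact: cvg_cst.
  by rewrite -integral_mkcond.
apply: filterS G0 => z /eqP; rewrite mulf_eq0 => /orP[/eqP//|].
by rewrite gt_eqF.
Qed.
End FourierUniqueness.

(** * Fourier transforms of conjugate distributions *)

Import HBNNSimple.

Section Reflection.
Context {R : realType}.
Notation normc := Normc.normc.
Local Open Scope ereal_scope.

(** Reflecting the simple functions below f extends the measurable case to
    arbitrary f. This generality is needed because the Fourier integral of a
    conjugate is rewritten for an arbitrary function. *)
Lemma ge0_integral_lebesgue2_opp (f : plane R -> \bar R) : (forall z, 0 <= f z) ->
  \int[lebesgue2]_z f (- z)%R = \int[lebesgue2]_z f z.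
Proof.
have le (k : plane R -> \bar R) : (forall z, 0 <= k z) ->
    \int[lebesgue2]_z k z <= \int[lebesgue2]_z k (- z)%R.
  move=> k0; rewrite [leLHS]ge0_integralTE//; apply: ge_ereal_sup => _ [h hk <-].
  have mh : measurable_fun [set: plane R] (fun z : plane R => (h z)%:E) by apply/measurable_EFinP.
  have h0 z : 0 <= (h z)%:E by rewrite lee_fin.
  rewrite -integralT_nnsfun -(ge0_integral_lebesgue2_opp_measurable mh h0).
  by apply: ge0_le_integral_pointwise => z; [rewrite lee_fin|exact: hk].
move=> f0; apply/le_anti/andP; split; last exact: le.
apply: le_trans (le (fun z => f (- z)%R) _) _ => //.
by under eq_integral do rewrite opprK.
Qed.

Lemma integral_lebesgue2_opp (f : plane R -> \bar R) :
  \int[lebesgue2]_z f (- z)%R = \int[lebesgue2]_z f z.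
Proof.
rewrite integralE [RHS]integralE; congr (_ - _).
  rewrite -[RHS]ge0_integral_lebesgue2_opp//.
  by apply: eq_integral => z _; rewrite !funeposE.
rewrite -[RHS]ge0_integral_lebesgue2_opp//.
by apply: eq_integral => z _; rewrite !funenegE.
Qed.

Lemma cintegral_opp (f : plane R -> R[i]) :
  cintegral lebesgue2 (fun z => f (- z)%R) = cintegral lebesgue2 f.
Proof.
rewrite /cintegral /Rintegral; congr (Complex (fine _) (fine _)).
  exact: (integral_lebesgue2_opp (fun z => (complex.Re (f z))%:E)).
exact: (integral_lebesgue2_opp (fun z => (complex.Im (f z))%:E)).
Qed.

(** An infinite integral is read as 0 on both sides. *)
Lemma RintegralN d (T : measurableType d) (m : {measure set T -> \bar R}) (g : T -> R) :
  (\int[m]_x (- g x) = - \int[m]_x g x)%R.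
Proof.
have fineB (x y : \bar R) : fine (x - y) = (- fine (y - x))%R.
  by case: x y => [x| |] [y| |] //=; rewrite ?oppr0// opprB.
rewrite /Rintegral integralE [in RHS]integralE fineB; congr (- fine (_ - _))%R.
  by apply: eq_integral => x _; rewrite funenegE funeposE -EFinN opprK.
by apply: eq_integral => x _; rewrite funenegE funeposE.
Qed.

Lemma cintegral_conj d (T : measurableType d) (m : {measure set T -> \bar R}) (f : T -> R[i]) :
  (cintegral m f)^*%C = cintegral m (fun x => (f x)^*%C).
Proof.
rewrite /cintegral /=; congr Complex.
  by congr (fine _); apply: eq_integral => x _; case: (f x).
by rewrite -RintegralN; congr (fine _); apply: eq_integral => x _; case: (f x).
Qed.

End Reflection.

Section SchwartzReflection.
Context {R : realType}.
Implicit Types (P : R * R -> R).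

(** A directional derivative is an ordinary derivative along a line, which makes
    the one-dimensional chain rule available. *)
Lemma is_derive_line P (z v : R * R) (l : R) :
  is_derive z v P l <-> is_derive (0 : R) (1 : R) (fun t : R => P (t *: v + z)) l.
Proof.
have e : (fun h : R => h^-1 *: ((P \o shift z) (h *: v) - P z)) =
  (fun h : R => h^-1 *: (((fun t : R => P (t *: v + z)) \o shift 0) (h *: 1) - P (0 *: v + z))).
  by apply/funext => h /=; rewrite addr0 -[h *: 1]/(h * 1) mulr1 scale0r add0r.
split=> -[hd hv].
  by split; [rewrite /derivable -e | rewrite /derive -e].
by split; [rewrite /derivable e | rewrite /derive e].
Qed.

Lemma is_derive_opp_arg P (z v : R * R) (l : R) :
  is_derive (- z) v P l -> is_derive z v (fun y => P (- y)) (- l).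
Proof.
move=> /is_derive_line h; apply/is_derive_line.
have e : (fun t : R => P (- (t *: v + z))) = (fun t : R => P (t *: v + - z)) \o -%R.
  by apply/funext => t /=; rewrite opprD scaleNr.
rewrite e (_ : - l = l * - 1); last by rewrite mulrN1.
apply: (@is_derive1_comp _ (fun t : R => P (t *: v + - z)) -%R).
by rewrite oppr0.
Qed.

(** The scalar c is carried along because the real and imaginary parts of the
    reflected conjugate are reflected with the factors 1 and -1. *)
Lemma partials_scale_opp (c : R) P (w : seq bool) : smooth P ->
  partials w (fun z => c * P (- z)) = fun z => c * (-1) ^+ size w * partials w P (- z).
Proof.
move=> sP; elim: w => [|k w IH] /=; first by apply/funext => z; rewrite mulr1.
apply/funext => z; rewrite -/(partials w _) IH -/(partials w P).
have d : is_derive (- z) (axis k) (partials w P) ('D_(axis k) (partials w P) (- z)).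
  by split => //; exact: sP.
have d1 := is_derive_opp_arg d.
have d2 := is_deriveZ (c * (-1) ^+ size w) d1.
have -> := @derive_val _ _ _ _ _ _ _ d2.
by rewrite /GRing.scale/= exprS; ring.
Qed.

Lemma smooth_scale_opp (c : R) P : smooth P -> smooth (fun z => c * P (- z)).
Proof.
move=> sP w k z; rewrite partials_scale_opp//.
have d : is_derive (- z) (axis k) (partials w P) ('D_(axis k) (partials w P) (- z)).
  by split => //; exact: sP.
by have [] := is_deriveZ (c * (-1) ^+ size w) (is_derive_opp_arg d).
Qed.

Definition conj_reflect (f : R * R -> R[i]) : R * R -> R[i] := fun z => (f (- z))^*%C.

Lemma schwartz_conj_reflect f : schwartz f -> schwartz (conj_reflect f).
Proof.
move=> [sr si hb].
have er : (fun y => complex.Re (conj_reflect f y)) = (fun y => 1 * complex.Re (f (- y))).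
  by apply/funext => y; rewrite /conj_reflect mul1r; case: (f (- y)).
have ei : (fun y => complex.Im (conj_reflect f y)) = (fun y => -1 * complex.Im (f (- y))).
  by apply/funext => y; rewrite /conj_reflect mulN1r; case: (f (- y)).
split.
- by rewrite er; apply: (@smooth_scale_opp 1 _ sr).
- by rewrite ei; apply: (@smooth_scale_opp (-1) _ si).
move=> n w; have [M hM] := hb n w; exists M => z; apply: le_trans (hM (- z)).
rewrite normrN /cpartials er ei (partials_scale_opp 1 w sr) (partials_scale_opp (-1) w si) /=.
rewrite le_eqVlt; apply/orP; left; apply/eqP; congr (_ * Num.sqrt _).
by rewrite !exprMn sqrrN expr1n !mul1r -exprM mulnC exprM sqrrN expr1n expr1n !mul1r.
Qed.

Lemma conj_fourier (f : R * R -> R[i]) :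
  (fun zeta => (fourier f zeta)^*%C) = fourier (conj_reflect f).
Proof.
apply/funext => zeta; rewrite /fourier cintegral_conj -cintegral_opp.
congr cintegral; apply/funext => z /=; rewrite /conj_reflect.
rewrite !mulNr -opprD cosN sinN opprK.
by case: (f (- z)) => a b; rewrite /GRing.mul/=; congr Complex; ring.
Qed.

End SchwartzReflection.

Section FourierConj.
Context {R : realType}.
Implicit Types (h : plane R -> R[i]).

Lemma integrable_opp (g : plane R -> R) :
  lebesgue2.-integrable setT (fun z => (g z)%:E) ->
  lebesgue2.-integrable setT (fun z => (g (- z))%:E).
Proof.
move=> /integrableP[mg ig]; apply/integrableP; split.
  exact: (measurableT_comp mg measurable_plane_opp).
by rewrite (integral_lebesgue2_opp (fun z => `|(g z)%:E|)%E).
Qed.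

(** By definition the conjugate distribution maps F f to
    conj (T (conj (F f))), and conj (F f) is the transform of the reflected
    conjugate of f; hence the pairing of T with the latter, conjugated and
    reflected under the integral, is the required pairing. *)
Lemma is_fourier_conj T h : is_fourier T h -> is_fourier (conj_distr T) (conj_reflect h).
Proof.
move=> [mh hf]; split.
  have [mr mi] := cmeasurable_comp mh measurable_plane_opp; split.
    by rewrite (_ : (fun z => _) = (fun z => complex.Re (h (- z))))//; apply/funext => z; rewrite /conj_reflect; case: (h (- z)).
  rewrite (_ : (fun z => _) = (fun z => - complex.Im (h (- z)))); last first.
    by apply/funext => z; rewrite /conj_reflect; case: (h (- z)).
  exact: (measurableT_comp (@oppr_measurable R setT) mi).
move=> f sf; have [[ir ii] ef] := hf _ (schwartz_conj_reflect sf).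
have e : (fun z => conj_reflect h z * f z) = (fun z => ((h (- z)) * conj_reflect f (- z))^*%C).
  apply/funext => z; rewrite /conj_reflect opprK.
  by case: (h (- z)) => a b; case: (f z) => c d; rewrite /GRing.mul/=; congr Complex; ring.
split.
  rewrite e; split.
    have := integrable_opp ir; apply: eq_integrable => // z _.
    by case: (_ * _).
  have := integrableN (integrable_opp ii); apply: eq_integrable => // z _ /=.
  by case: (_ * _).
rewrite /conj_distr conj_fourier ef cintegral_conj -cintegral_opp e.
by congr cintegral; apply/funext => z.
Qed.

(** Since the tests are real, the real and imaginary parts can be compared
    separately. *)
Lemma is_fourier_unique T h h' : is_fourier T h -> is_fourier T h' ->
  {ae lebesgue2, forall z, h z = h' z}.
Proof.
move=> [[mr mi] hf] [[mr' mi'] hf'].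
have key (re : R[i] -> R) : (forall (x y : R[i]) (c : R), re (x * Complex c 0) = re x * c) ->
    measurable_fun setT (fun z => re (h z)) -> measurable_fun setT (fun z => re (h' z)) ->
    (forall f, schwartz f -> [/\ lebesgue2.-integrable setT (fun z => (re (h z * f z))%:E),
       lebesgue2.-integrable setT (fun z => (re (h' z * f z))%:E) &
       (\int[lebesgue2]_z re (h z * f z) = \int[lebesgue2]_z re (h' z * f z))%R]) ->
    {ae lebesgue2, forall z, re (h z) - re (h' z) = 0}.
  move=> reM m m' hre; apply: ae_eq0_of_tests; first exact: measurable_funB.
  move=> c d c' d' f1 f2 P1 P2; have [i1 i2 e] := hre _ (schwartz_gauss_poly P1 P2).
  have E : (fun z : plane R => ((re (h z) - re (h' z)) * (f1 z.1 * f2 z.2))%:E) =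
    (fun z : plane R => (re (h z * Complex (f1 z.1 * f2 z.2) 0))%:E -
                        (re (h' z * Complex (f1 z.1 * f2 z.2) 0))%:E)%E.
    by apply/funext => z; rewrite !reM// -EFinB mulrBl.
  split; first by rewrite E; exact: integrableB.
  rewrite E integralB//.
  move: e; rewrite /Rintegral.
  have := integrable_fin_num measurableT i1; have := integrable_fin_num measurableT i2.
  move: (\int[_]_z _)%E (\int[_]_z _)%E => [x| |] [y| |]//= _ _ ->.
  by rewrite -EFinB subrr.
have hr : {ae lebesgue2, forall z, complex.Re (h z) - complex.Re (h' z) = 0}.
  apply: key => //; first by move=> [a b] y c /=; ring.
  move=> f sf; have [[i1 _] e1] := hf _ sf; have [[i2 _] e2] := hf' _ sf.
  by split => //; move: e2; rewrite e1 => -[].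
have hi : {ae lebesgue2, forall z, complex.Im (h z) - complex.Im (h' z) = 0}.
  apply: key => //; first by move=> [a b] y c /=; ring.
  move=> f sf; have [[_ i1] e1] := hf _ sf; have [[_ i2] e2] := hf' _ sf.
  by split => //; move: e2; rewrite e1 => -[].
apply: filterS2 hr hi => z /eqP; rewrite subr_eq0 => /eqP er /eqP; rewrite subr_eq0 => /eqP ei.
by case: (h z) (h' z) er ei => [a b] [a' b'] /= -> ->.
Qed.

Lemma hatP T : (exists h, is_fourier T h) -> is_fourier T (hat T).
Proof. by move=> [h Th]; exact: (xgetPex _ (ex_intro _ h Th)). Qed.

End FourierConj.

(** * The trilinear estimate *)

Section ConjugateNorm.
Context {R : realType}.
Variables (alpha beta s b : R).
Local Open Scope ereal_scope.

(** The chosen transform of the conjugate agrees almost everywhere with the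
    reflected conjugate of the transform, and the reflection is measure
    preserving. *)
Lemma integral_reflected_energy (T : (R * R -> R[i]) -> R[i]) :
  (exists h, is_fourier T h) ->
  \int[lebesgue2]_z reflected_energy alpha beta s b (hat (conj_distr T)) z =
  Xnorm alpha beta s b T `^ 2.
Proof.
move=> ex; have fT := hatP ex; have fc := is_fourier_conj fT.
have fc' := hatP (ex_intro _ _ fc).
have ae := is_fourier_unique fc' fc.
rewrite /Xnorm Xnorm_hat_sqr -integral_lebesgue2; last 2 first.
- exact: measurable_energy fT.1.
- by move=> z; exact: energy_ge0.
rewrite -[RHS]integral_lebesgue2_opp.
apply: ge0_ae_eq_integral => //.
- exact: (measurable_reflected_energy alpha beta s b fc'.1).
- exact: (measurableT_comp (measurable_energy alpha beta s b fT.1) measurable_plane_opp).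
- by move=> z _; exact: reflected_energy_ge0.
- by move=> z _; exact: energy_ge0.
apply: filterS ae => z e _; rewrite /reflected_energy /energy e /conj_reflect.
congr ((_ * _) ^+ 2)%:E; case: (hat T (- z)%R) => x y /=.
by rewrite sqrrN.
Qed.
End ConjugateNorm.

Theorem theorem3 (R : realType) (alpha beta : R) (hbeta : beta != 0)
    (s b : R) (hs : - (1 / 4) < s) (hs0 : s <= 0)
    (hb : 7 / 12 < b) (hb1 : b < 11 / 12) :
  exists C : R, forall u v w : (R * R -> R[i]) -> R[i],
    Xspace alpha beta s b u ->
    Xspace alpha beta s b v ->
    Xspace alpha beta s b w ->
    {ae lebesgue2, forall z,
       conv3_converges (hat u) (hat v) (hat (conj_distr w)) z} /\
    (Xnorm_hat alpha beta s (b - 1)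
       (conv3 (hat u) (hat v) (hat (conj_distr w)))
     <= C%:E * Xnorm alpha beta s b u * Xnorm alpha beta s b v
          * Xnorm alpha beta s b w)%E.
Proof.
have [C hC] := trilinear_estimate alpha hbeta hs hs0 hb hb1.
exists C => u v w [_ exu fu] [_ exv fv] [_ exw fw].
have E := integral_reflected_energy alpha beta s b exw.
have fc := hatP (ex_intro _ _ (is_fourier_conj (hatP exw))).
have fin : (\int[lebesgue2]_z reflected_energy alpha beta s b (hat (conj_distr w)) z < +oo)%E.
  by rewrite E poweR_lty.
have [h1 h2] := hC _ _ _ (hatP exu).1 (hatP exv).1 fc.1 fu fv fin.
split => //; move: h2; rewrite E -poweRrM mulfV// poweRe1//.
exact: Xnorm_hat_ge0.
Qed.
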